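(* Let $X$ be a compact generalized Hermitian manifold with $\dim_{\mathbb R}X=2n$ and let $\epsilon=\epsilon(t)\in\wedge^2L^*$ be the integrable generalized Beltrami differential defining the fibre $X_\epsilon=X_{\epsilon(t)}$ of a smooth family $\pi:\mathcal X\to\Delta\subset\mathbb C$ of generalized complex manifolds with $\pi^{-1}(0)=X$. Assume $\|\epsilon\|_{L^\infty}<1$. Then for every $0\le k\le 2n$ and every $\sigma\in U^{k-n}(X)$, $$\overline\partial_t(\mathcal E(\sigma))=0\iff\big([\partial,\epsilon\,\cdot]+\overline\partial\big)\big((1-\epsilon\epsilon^* )(\sigma)\big)=0,$$ where $\overline\partial_t$ is the $\overline\partial$-operator of $X_{\epsilon(t)}$ and $[\partial,\epsilon\,\cdot]=\partial\circ\epsilon\cdot-\epsilon\cdot\partial$.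
   Context: Generalized complex structures. $X$ is a smooth manifold, $\dim_{\mathbb R}X=2n$, $H$ a fixed closed real 3-form. On $T_X\oplus T_X^*$ (complexified when needed) put $\langle Y+\xi,Z+\eta\rangle=\xi(Z)+\eta(Y)$, also written $a(b)$ for $\langle a,b\rangle$. The Courant bracket is $[Y+\xi,Z+\eta]=[Y,Z]+L_Y\eta-L_Z\xi-\frac12d(i_Y\eta-i_Z\xi)+i_Zi_YH$. A generalized complex structure is an endomorphism $J$ of $T_X\oplus T_X^*$ with $J^2=-1$, $\langle Ja,Jb\rangle=\langle a,b\rangle$, whose $+i$-eigenbundle $L$ is closed under the bracket. The dual $L^*$ is identified with $\overline L$ via $\langle\cdot,\cdot\rangle$. Clifford action on forms: $(Y+\xi)\cdot\sigma=i_Y\sigma+\xi\wedge\sigma$, so $a\cdot b\cdot\sigma+b\cdot a\cdot\sigma=\langle a,b\rangle\sigma$; elements of $\wedge^\bullet L^*$ and $\wedge^\bullet L$ act by products. Let $U^{-n}(X)=\{\rho\in\wedge^\bullet T_X^*: L\cdot\rho=0\}$ and $U^k(X)=\wedge^{k+n}L^*\cdot U^{-n}(X)$ for $-n\le k\le n$ (the same symbols denote smooth sections); then $\wedge^\bullet T_X^*\otimes\mathbb C=\bigoplus_{k=-n}^nU^k(X)$. Put $d\sigma:=d_{dR}\sigma-H\wedge\sigma$; then $d=\partial+\overline\partial$, where $\partial:U^k\to U^{k-1}$, $\overline\partial:U^k\to U^{k+1}$ are the projections of $d$. Generalized Hermitian: $X$ carries an endomorphism $G$ of $T_X\oplus T_X^*$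 with $G^2=1$, $GJ=JG$, $\langle G\cdot,\cdot\rangle$ symmetric positive definite. Deformations. $\epsilon\in\wedge^2L^*$ is viewed as a map $L\to L^*$: locally $\epsilon=\frac12\epsilon_{ij}l^i\cdot l^j$, $\epsilon_{ij}=-\epsilon_{ji}$, with $\{l_i\}$ a basis of $L$ and $\{l^i\}$ the dual basis of $L^*$, and $\epsilon(l_p)=\epsilon_{ip}l^i$; extend by $\epsilon(L^* )=0$. $X_\epsilon$ is $X$ with the generalized complex structure $J_\epsilon$ (with respect to the same $H$) whose $+i$-eigenbundle is $L_\epsilon=(1+\epsilon)(L)$; integrability means that $L_\epsilon$ is closed under the Courant bracket, equivalently $d_L\epsilon=\frac12[\epsilon,\epsilon]$ where $d_L$ is the Lie algebroid differential of $L$ and $[\cdot,\cdot]$ on $\wedge^2L^*$ satisfies $[a,b]\cdot\sigma=a\cdot d(b\cdot\sigma)+b\cdot d(a\cdot\sigma)-a\cdot b\cdot d\sigma-d(a\cdot b\cdot\sigma)$. The dual $L_\epsilon^*$ is identified with $\overline{L_\epsilon}$, and $\epsilon^*\in\wedge^2L$ is the element with $L_\epsilon^*=(1+\epsilon^* )(L^* )$ (so $\epsilon^*=\overline\epsilon$); $\epsilon^*=\frac12\epsilon^{ij}l_i\cdot l_j$, $\epsilon^*(l^p)=\epsilon^{ip}l_i$, $\epsilon^*(L)=0$. $U^\bullet(X_\epsilon)$ is defined from $J_\epsilon$ by $U^{-n}(X_\epsilon)=\{\rho\in\wedge^\bullet T_X^*: L_\epsilon\cdot\rho=0\}$ and $U^k(X_\epsilon)=\wedge^{k+n}L_\epsilon^*\cdot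 U^{-n}(X_\epsilon)$ for $-n\le k\le n$, and $\overline\partial_t:U^k(X_\epsilon)\to U^{k+1}(X_\epsilon)$ is the projection of $d$. $\|\epsilon\|_{L^\infty}$ is the supremum over $X$ of the pointwise operator norm of $\epsilon:L\to L^*=\overline L$ for the Hermitian metric induced by $\langle G\cdot,\cdot\rangle$. For $\sigma=\frac1{k!}\sigma_{i_1\cdots i_k}l^{i_1}\cdots l^{i_k}\cdot\rho_0\in U^{k-n}(X)$, $\rho_0\in U^{-n}(X)$, set $$\mathcal E(\sigma)=\tfrac1{k!}\sigma_{i_1\cdots i_k}(1+\epsilon^* )(l^{i_1})\cdots(1+\epsilon^* )(l^{i_k})\cdot(e^\epsilon\cdot\rho_0)\in U^{k-n}(X_\epsilon),\qquad e^\epsilon=\sum_{i\ge0}\tfrac1{i!}\epsilon^i,$$ $$(1-\epsilon\epsilon^* )(\sigma)=\tfrac1{k!}\sigma_{i_1\cdots i_k}(1-\epsilon\epsilon^* )(l^{i_1})\cdots(1-\epsilon\epsilon^* )(l^{i_k})\cdot\rho_0,$$ where $\epsilon\epsilon^*$ is the composition $L^*\to L\to L^*$. *)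

(* Defs.v *)
From HB Require Import structures.
From mathcomp Require Import all_boot all_order all_algebra.
From mathcomp Require Import complex.
From mathcomp Require Import all_classical all_reals all_analysis.

Set Implicit Arguments.
Unset Strict Implicit.
Unset Printing Implicit Defensive.

Import Order.TTheory GRing.Theory Num.Theory.
Import numFieldNormedType.Exports.

Local Open Scope classical_set_scope.
Local Open Scope ring_scope.
Local Open Scope complex_scope.

(* Vectors are row vectors and matrices act on them from the right, as in
   MathComp.  A tensor field on a manifold is the family of its expressions in
   the charts, with the usual transformation law on overlaps; only the values
   on the images of the charts are meaningful. *)

Section Smooth.
Variables (R : realType) (p : nat).
Implicit Types (U : set 'rV[R]_p) (k : nat).

Definition basis_vec (j : 'I_p) : 'rV[R]_p := delta_mx 0 j.

(* class C^k on an open set U *)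
Fixpoint Ck_on k U (f : 'rV[R]_p -> R) : Prop :=
  match k with
  | 0 => forall y, U y -> {for y, continuous f}
  | k'.+1 => forall j : 'I_p,
      (forall y, U y -> derivable f y (basis_vec j)) /\
      Ck_on k' U (fun y => 'D_(basis_vec j) f y)
  end.

Definition smooth_on U (f : 'rV[R]_p -> R) : Prop := forall k, Ck_on k U f.

Definition csmooth_on U (f : 'rV[R]_p -> R[i]) : Prop :=
  smooth_on U (fun y => complex.Re (f y)) /\
  smooth_on U (fun y => complex.Im (f y)).

Definition partial (j : 'I_p) (f : 'rV[R]_p -> R[i]) (y : 'rV[R]_p) : R[i] :=
  'D_(basis_vec j) (fun z => complex.Re (f z)) y +i*
  'D_(basis_vec j) (fun z => complex.Im (f z)) y.

(* derivative of f along the complex tangent vector v *)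
Definition cderiv (v : 'rV[R[i]]_p) (f : 'rV[R]_p -> R[i]) (y : 'rV[R]_p) :
    R[i] :=
  \sum_(j < p) v 0 j * partial j f y.

End Smooth.

Record manifold (R : realType) (m : nat) := Manifold {
  space :> topologicalType;
  chart_index : Type;
  chart_dom : chart_index -> set space;
  chart : chart_index -> space -> 'rV[R]_m;
  chart_inv : chart_index -> 'rV[R]_m -> space;
  space_hausdorff : hausdorff_space space;
  space_second_countable : @second_countable space;
  chart_dom_open : forall i, open (chart_dom i);
  chart_dom_cover : forall x, exists i, chart_dom i x;
  chart_img_open : forall i, open (chart i @` chart_dom i);
  chart_invK : forall i x, chart_dom i x -> chart_inv i (chart i x) = x;
  chart_continuous : forall i x,
    chart_dom i x -> {for x, continuous (chart i)};
  chart_inv_continuous : forall i y,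
    (chart i @` chart_dom i) y -> {for y, continuous (chart_inv i)};
  transition_smooth : forall i j (l : 'I_m),
    smooth_on (chart i @` (chart_dom i `&` chart_dom j))
              (fun y => chart j (chart_inv i y) 0 l)
}.

Definition chart_img (R : realType) (m : nat) (X : manifold R m)
    (i : chart_index X) : set 'rV[R]_m :=
  chart i @` chart_dom i.

Definition transition (R : realType) (m : nat) (X : manifold R m)
    (i j : chart_index X) (y : 'rV[R]_m) : 'rV[R]_m :=
  chart j (chart_inv i y).

(* A form at a point, with components of all degrees: its value on a list of
   p tangent vectors is the value of its component of degree p. *)
Notation dform R m := (seq 'rV[R[i]%C]_m -> R[i]%C).
(* T + T^* at a point, complexified; the left half is the vector part. *)
Notation gvec R m := 'rV[R[i]%C]_(m + m).

Definition field (R : realType) (m : nat) (X : manifold R m) (T : Type) : Type :=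
  chart_index X -> 'rV[R]_m -> T.

Section Pointwise.
Variables (R : realType) (m : nat).
Local Notation C := R[i].
Implicit Types (w : dform R m) (a : gvec R m) (s : seq 'rV[C]_m).

Definition conj_mx (p q : nat) (A : 'M[C]_(p, q)) : 'M[C]_(p, q) :=
  map_mx (@conjc R) A.

Definition cplx_mx (p q : nat) (A : 'M[R]_(p, q)) : 'M[C]_(p, q) :=
  map_mx (real_complex R) A.

Definition alternating w : Prop :=
  (forall s1 s2 (c : C) u v,
      w (s1 ++ (c *: u + v) :: s2) = c * w (s1 ++ u :: s2) + w (s1 ++ v :: s2))
  /\ (forall s, ~~ uniq s -> w s = 0).

Definition contract (v : 'rV[C]_m) w : dform R m := fun s => w (v :: s).

(* The sum over shuffles (without factorials), expanded along the first
   vector: i_v(w /\ w') = i_v w /\ w' + (-1)^deg(w) w /\ i_v w'. *)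
Fixpoint wedge w (w' : dform R m) s : C :=
  match s with
  | [::] => w [::] * w' [::]
  | v :: s' => wedge (contract v w) w' s' +
               wedge (fun u => (-1) ^+ size u * w u) (contract v w') s'
  end.

Definition one_form (xi : 'rV[C]_m) : dform R m :=
  fun s => if s is [:: v] then (xi *m v^T) 0 0 else 0.

Definition cliff a w : dform R m :=
  fun s => contract (lsubmx a) w s + wedge (one_form (rsubmx a)) w s.

(* <Y + xi, Z + eta> = xi(Z) + eta(Y), without the factor 1/2 *)
Definition gpair (K : comNzRingType) (a b : 'rV[K]_(m + m)) : K :=
  (rsubmx a *m (lsubmx b)^T + rsubmx b *m (lsubmx a)^T) 0 0.

(* Below, B stands for 1/2 \sum_(p, q) B_pq e_p e_q in wedge^2 (T + T^* ), with
   (e_p) the standard frame and B skew-symmetric. *)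
Definition gbasis (p : 'I_(m + m)) : gvec R m := delta_mx 0 p.

Definition bv_map (B : 'M[C]_(m + m)) (v : gvec R m) : gvec R m :=
  \sum_(p < m + m) \sum_(q < m + m) (B p q * gpair (gbasis q) v) *: gbasis p.

Definition bv_cliff (B : 'M[C]_(m + m)) w : dform R m :=
  fun s => 2^-1 * \sum_(p < m + m) \sum_(q < m + m)
    B p q * cliff (gbasis p) (cliff (gbasis q) w) s.

(* The exponential series is finite on the bivectors considered: B ^ k = 0 when
   B lies in the second exterior power of a space of dimension m and k > m. *)
Definition bv_exp (B : 'M[C]_(m + m)) w : dform R m :=
  fun s => \sum_(k < m.+1) (k`!%:R)^-1 * iter k (bv_cliff B) w s.

Definition bivector_in (P : set (gvec R m)) (B : 'M[C]_(m + m)) : Prop :=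
  B^T = - B /\ forall p, P (row p B).

Definition Lplus (J : 'M[R]_(m + m)) : set (gvec R m) :=
  [set a | a *m cplx_mx J = (0 +i* 1) *: a].

(* L^*, identified with the conjugate of L *)
Definition Lstar (J : 'M[R]_(m + m)) : set (gvec R m) :=
  [set a | Lplus J (conj_mx a)].

Definition pure_spinor (J : 'M[R]_(m + m)) (rho : dform R m) : Prop :=
  alternating rho /\ forall a, Lplus J a -> forall s, cliff a rho s = 0.

(* w = \sum_q a_q1 ... a_qk . rho_q with a_qj in L^* and rho_q in U^{-n} *)
Definition spin_repr (J : 'M[R]_(m + m)) (k N : nat)
    (a : 'I_N -> k.-tuple (gvec R m)) (rho : 'I_N -> dform R m) w : Prop :=
  [/\ forall q (j : 'I_k), Lstar J (tnth (a q) j),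
      forall q, pure_spinor J (rho q)
    & w = fun s => \sum_q foldr cliff (rho q) (a q) s].

(* Uspace J k is the fibre of U^{k - n}, where m = 2n. *)
Definition Uspace (J : 'M[R]_(m + m)) (k : nat) : set (dform R m) :=
  [set w | exists N (a : 'I_N -> k.-tuple (gvec R m))
                    (rho : 'I_N -> dform R m),
             spin_repr J a rho w].

(* The component in Uspace J k of a form, for the decomposition of the space of
   forms as the direct sum of the Uspace J j, 0 <= j <= m. *)
Definition Uproj (J : 'M[R]_(m + m)) (k : nat) w : dform R m :=
  xget (fun=> 0) [set u | exists c : nat -> dform R m,
    [/\ forall j, (j <= m)%N -> Uspace J j (c j),
        w = fun s => \sum_(j < m.+1) c j s
      & u = c k]].

(* a_1 ... a_k . rho |-> f(a_1) ... f(a_k) . g(rho), extended by linearity;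
   the value does not depend on the representation for the f and g used. *)
Definition spin_ext (J : 'M[R]_(m + m)) (f : gvec R m -> gvec R m)
    (g : dform R m -> dform R m) (k : nat) w : dform R m :=
  xget (fun=> 0) [set w' | exists N (a : 'I_N -> k.-tuple (gvec R m))
      (rho : 'I_N -> dform R m),
    spin_repr J a rho w /\
    w' = fun s => \sum_q foldr cliff (g (rho q)) (map f (a q)) s].

Definition hnorm (G : 'M[R]_(m + m)) a : R :=
  Num.sqrt (complex.Re (gpair (a *m cplx_mx G) (conj_mx a))).

Definition bv_opnorm (J G : 'M[R]_(m + m)) (B : 'M[C]_(m + m)) : \bar R :=
  ereal_sup [set (hnorm G (bv_map B a))%:E |
              a in [set a | Lplus J a /\ hnorm G a <= 1]].

(* action on T + T^* of a change of coordinates with Jacobian D *)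
Definition gtransition (K : fieldType) (D : 'M[K]_m) : 'M[K]_(m + m) :=
  block_mx D 0 0 (invmx D)^T.

End Pointwise.

Section Fields.
Variables (R : realType) (m : nat) (X : manifold R m).
Local Notation C := R[i].
Local Notation jac i j x := (jacobian (@transition R m X i j) (chart i x)).
Implicit Types (H sigma : field X (dform R m)) (J G : field X 'M[R]_(m + m)).
Implicit Types (eps : field X 'M[C]_(m + m)).

Definition is_form sigma : Prop :=
  [/\ forall i y, chart_img i y -> alternating (sigma i y),
      forall i s, csmooth_on (chart_img i) (fun y => sigma i y s)
    & forall i j x s, chart_dom i x -> chart_dom j x ->
        sigma i (chart i x) s =
        sigma j (chart j x) [seq v *m cplx_mx (jac i j x) | v <- s]].

Definition form_eq0 sigma : Prop :=
  forall i y, chart_img i y -> forall s, sigma i y s = 0.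

Definition is_endo J : Prop :=
  (forall i a b, smooth_on (chart_img i) (fun y => J i y a b)) /\
  (forall i j x, chart_dom i x -> chart_dom j x ->
     J i (chart i x) *m gtransition (jac i j x) =
     gtransition (jac i j x) *m J j (chart j x)).

Definition is_bivector eps : Prop :=
  (forall i a b, csmooth_on (chart_img i) (fun y => eps i y a b)) /\
  (forall i j x, chart_dom i x -> chart_dom j x ->
     let T := gtransition (cplx_mx (jac i j x)) in
     eps j (chart j x) = T^T *m eps i (chart i x) *m T).

Definition d_dR sigma : field X (dform R m) := fun i y s =>
  \sum_(k < size s) (-1) ^+ k *
    cderiv (nth 0 s k) (fun z => sigma i z (take k s ++ drop k.+1 s)) y.

Definition dH H sigma : field X (dform R m) := fun i y s =>
  d_dR sigma i y s - wedge (H i y) (sigma i y) s.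

Definition closed_real_3form H : Prop :=
  [/\ is_form H,
      forall i y s, chart_img i y -> size s != 3 -> H i y s = 0,
      forall i y s, chart_img i y ->
        H i y [seq conj_mx v | v <- s] = conjc (H i y s)
    & form_eq0 (d_dR H)].

Definition lie_bracket (Y Z : 'rV[R]_m -> 'rV[C]_m) (y : 'rV[R]_m) : 'rV[C]_m :=
  \row_k (cderiv (Y y) (fun z => Z z 0 k) y - cderiv (Z y) (fun z => Y z 0 k) y).

Definition lie_deriv (Y eta : 'rV[R]_m -> 'rV[C]_m) (y : 'rV[R]_m) :
    'rV[C]_m :=
  \row_k (cderiv (Y y) (fun z => eta z 0 k) y +
          \sum_j eta y 0 j * partial k (fun z => Y z 0 j) y).

(* Courant bracket of two sections over the domain of the chart i *)
Definition courant H (i : chart_index X) (a b : 'rV[R]_m -> gvec R m)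
    (y : 'rV[R]_m) : gvec R m :=
  let Y z := lsubmx (a z) in let xi z := rsubmx (a z) in
  let Z z := lsubmx (b z) in let eta z := rsubmx (b z) in
  row_mx (lie_bracket Y Z y)
    (lie_deriv Y eta y - lie_deriv Z xi y
     - 2^-1 *: (\row_k partial k
         (fun z => (eta z *m (Y z)^T) 0 0 - (xi z *m (Z z)^T) 0 0) y)
     + \row_k H i y [:: Y y; Z y; cplx_mx (basis_vec R k)]).

Definition smooth_section (i : chart_index X) (a : 'rV[R]_m -> gvec R m) :
    Prop :=
  forall l, csmooth_on (chart_img i) (fun y => a y 0 l).

Definition courant_closed H J : Prop :=
  forall i a b, smooth_section i a -> smooth_section i b ->
    (forall y, chart_img i y -> Lplus (J i y) (a y)) ->
    (forall y, chart_img i y -> Lplus (J i y) (b y)) ->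
    forall y, chart_img i y -> Lplus (J i y) (courant H i a b y).

Definition is_gcs H J : Prop :=
  [/\ is_endo J,
      forall i y, chart_img i y -> J i y *m J i y = - 1%:M,
      forall i y, chart_img i y -> forall a b : 'rV[R]_(m + m),
        gpair (a *m J i y) (b *m J i y) = gpair a b
    & courant_closed H J].

Definition is_gen_metric J G : Prop :=
  is_endo G /\
  forall i y, chart_img i y ->
    [/\ G i y *m G i y = 1%:M,
        G i y *m J i y = J i y *m G i y,
        forall a b : 'rV[R]_(m + m), gpair (a *m G i y) b = gpair (b *m G i y) a
      & forall a : 'rV[R]_(m + m), a != 0 -> 0 < gpair (a *m G i y) a].

Definition del H J sigma : field X (dform R m) := fun i y s =>
  \sum_(k < m) Uproj (J i y) k
    (dH H (fun i' y' => Uproj (J i' y') k.+1 (sigma i' y')) i y) s.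

Definition delbar H J sigma : field X (dform R m) := fun i y s =>
  \sum_(k < m) Uproj (J i y) k.+1
    (dH H (fun i' y' => Uproj (J i' y') k (sigma i' y')) i y) s.

Definition is_Usection J (k : nat) sigma : Prop :=
  is_form sigma /\ forall i y, chart_img i y -> Uspace (J i y) k (sigma i y).

(* A smooth family of generalized complex manifolds over Delta with central
   fibre (X, J), in a smooth trivialization X x Delta. *)
Definition pt (u : 'rV[R]_2) : C := u 0 0 +i* u 0 1.

Definition gcs_family H J (Delta : set C) (Jt : C -> field X 'M[R]_(m + m)) :
    Prop :=
  [/\ open [set u | Delta (pt u)] /\ Delta 0,
      forall t, Delta t -> is_gcs H (Jt t),
      forall i a b, smooth_on
        [set u : 'rV[R]_(m + 2) |
          chart_img i (lsubmx u) /\ Delta (pt (rsubmx u))]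
        (fun u => Jt (pt (rsubmx u)) i (lsubmx u) a b)
    & forall i y, chart_img i y -> Jt 0 i y = J i y].

(* eps in wedge^2 L^* with L' = (1 + eps)(L), where L, L' are the
   +i-eigenbundles of J, J' *)
Definition beltrami J J' eps : Prop :=
  is_bivector eps /\
  forall i y, chart_img i y ->
    bivector_in (Lstar (J i y)) (eps i y) /\
    Lplus (J' i y) = [set a + bv_map (eps i y) a | a in Lplus (J i y)].

(* eps' in wedge^2 L with L'^* = (1 + eps')(L^* ); necessarily the conjugate of
   the Beltrami differential *)
Definition beltrami_star J J' eps' : Prop :=
  is_bivector eps' /\
  forall i y, chart_img i y ->
    bivector_in (Lplus (J i y)) (eps' i y) /\
    Lstar (J' i y) = [set a + bv_map (eps' i y) a | a in Lstar (J i y)].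

Definition Linf_norm J G eps : \bar R :=
  ereal_sup [set bv_opnorm (J z.1 z.2) (G z.1 z.2) (eps z.1 z.2) |
              z in [set z : chart_index X * 'rV[R]_m | chart_img z.1 z.2]].

Definition bv_act eps sigma : field X (dform R m) :=
  fun i y => bv_cliff (eps i y) (sigma i y).

Definition calE J eps eps' (k : nat) sigma : field X (dform R m) := fun i y =>
  spin_ext (J i y) (fun a => a + bv_map (eps' i y) a) (bv_exp (eps i y)) k
    (sigma i y).

Definition one_sub_eps_epsstar J eps eps' (k : nat) sigma :
    field X (dform R m) := fun i y =>
  spin_ext (J i y) (fun a => a - bv_map (eps i y) (bv_map (eps' i y) a)) id k
    (sigma i y).

Definition comm_del_eps H J eps sigma : field X (dform R m) := fun i y s =>
  del H J (bv_act eps sigma) i y s - bv_act eps (del H J sigma) i y s.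

Definition form_add sigma (tau : field X (dform R m)) : field X (dform R m) :=
  fun i y s => sigma i y s + tau i y s.

End Fields.

(* Main.v *)
Require Import Defs.
From HB Require Import structures.
From mathcomp Require Import all_boot all_order all_algebra.
From mathcomp Require Import complex ring.
From mathcomp Require Import all_classical all_reals all_analysis.

(** Write [F_k] for the space of forms annihilated by any [k] elements of the
    [+i]-eigenbundle [L] of [J], and [F_k(eps)] for the one defined by the deformed
    structure.  Then [F_(k+1)] is the sum of the [U^{j - n}] with [j <= k], so that a
    form of [F_(k+2)] has no component in [U^{k+1-n}] exactly when it lies in
    [F_(k+1)].  Three facts give the theorem.

    First, the twisted differential maps sections of [F_k] to sections of [F_(k+1)]
    when the eigenbundle is closed under the Courant bracket ([fil_twisted_d]).  This
    is an induction on [k] from the derived bracket formula [derived_bracket], which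
    expresses [b . a . d w] by [d (a . b . w)], [a . d (b . w)], [b . d (a . w)] and
    [[a, b] . w].  Applied to the deformed structure, it says that
    [delbar_t (E sigma) = 0] means [d (E sigma)] in [F_(k+1)(eps)]; applied to the
    conjugate of [L] (the form [H] is real), it says that [d] also lowers the level by
    one at most.

    Second, [e^eps . a = (a + eps a) . e^eps] for every [a] in [T + T^*] ([bv_exp_cl]),
    so that [e^eps] maps [F_k] onto [F_k(eps)] ([fil_exp]).  It follows that
    [E sigma = e^eps (tau + h)] with [tau = (1 - eps eps^* )(sigma)] and [h] in [F_k]
    ([frame_ext_exp]): the shear by [eps^*] becomes [1 - eps eps^*] plus a term in [L],
    which lowers the filtration.  Since [d (e^eps h)] lies in [F_(k+1)(eps)], the
    condition becomes that [e^-eps d e^eps tau], which lies in [F_(k+2)], lies in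
    [F_(k+1)].

    Third, the component in [U^{k+1-n}] of [e^-eps d e^eps tau] is read off the
    expansion of the exponentials: [eps] raises the level by two and [d] lowers it by
    one at most, so that only [d tau], [d (eps tau)] and [- eps d tau] contribute, and
    their components are [delbar tau], [del (eps tau)] and [- eps (del tau)]
    ([lev_comp_exp_inv]).

    The levels are handled as eigenspaces of the number operator [num_op], built from
    the projector [(1 - i J) / 2] onto [L] and thus smooth without a choice of local
    frames.  For the same reason [E] and [1 - eps eps^*], which are defined by
    choosing representations as sums of products, are replaced by the explicit formula
    [frame_ext]; it shows that they are independent of the choices
    ([spin_ext_frame]) and yield differentiable families of forms. *)

Set Implicit Arguments.
Unset Strict Implicit.
Unset Printing Implicit Defensive.

Import Order.TTheory GRing.Theory Num.Theory.
Import numFieldNormedType.Exports.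

Local Open Scope classical_set_scope.
Local Open Scope ring_scope.
Local Open Scope complex_scope.

(** * Wedge products and alternating forms *)

Section Wedge.
Variables (R : realType) (m : nat).
Local Notation C := R[i].
Local Notation contract := Defs.contract.
Local Notation alternating := Defs.alternating.
Local Notation form := (seq 'rV[C]_m -> C).
Implicit Types (w h : form) (s : seq 'rV[C]_m) (u v : 'rV[C]_m).

(** The sign [(-1) ^ deg] by which a contraction anticommutes past a form. *)
Definition twist w : form := fun s => (-1) ^+ size s * w s.

Lemma twistK w : twist (twist w) = w.
Proof. by apply/funext => s; rewrite /twist mulrA -expr2 sqrr_sign mul1r. Qed.

Lemma contract_twist v w :
  contract v (twist w) = (fun s => - twist (contract v w) s).
Proof. by apply/funext => s; rewrite /contract /twist /= exprS mulN1r mulNr. Qed.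

Lemma wedge_cons w h v s :
  wedge w h (v :: s) = wedge (contract v w) h s + wedge (twist w) (contract v h) s.
Proof. by []. Qed.

Lemma contract_wedge w h v :
  contract v (wedge w h) =
  fun s => wedge (contract v w) h s + wedge (twist w) (contract v h) s.
Proof. by apply/funext => s. Qed.

Lemma wedge_linl c w1 w2 h s :
  wedge (fun t => c * w1 t + w2 t) h s = c * wedge w1 h s + wedge w2 h s.
Proof.
elim: s w1 w2 h => [|v s IHs] w1 w2 h /=; first by rewrite mulrDl mulrA.
rewrite [wedge (contract v _) h s](IHs (contract v w1) (contract v w2)).
rewrite -/(twist _) -/(twist w1) -/(twist w2).
have -> : twist (fun t => c * w1 t + w2 t) = fun t => c * twist w1 t + twist w2 t.
  by apply/funext => t; rewrite /twist; ring.
by rewrite IHs; ring.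
Qed.

Lemma wedge_linr c w h1 h2 s :
  wedge w (fun t => c * h1 t + h2 t) s = c * wedge w h1 s + wedge w h2 s.
Proof.
elim: s w h1 h2 => [|v s IHs] w h1 h2 /=; first by rewrite mulrDr; ring.
rewrite [wedge _ (contract v _) s](IHs _ (contract v h1) (contract v h2)) IHs.
by ring.
Qed.

Lemma wedge0l h s : wedge (fun=> 0) h s = 0.
Proof.
have := wedge_linl (-1) (fun=> 0) (fun=> 0) h s.
have -> : (fun t : seq 'rV[C]_m => -1 * 0 + 0) = (fun=> 0 : C).
  by apply/funext => t; rewrite mulr0 addr0.
by rewrite mulN1r addNr.
Qed.

Lemma wedge0r w s : wedge w (fun=> 0) s = 0.
Proof.
have := wedge_linr (-1) w (fun=> 0) (fun=> 0) s.
have -> : (fun t : seq 'rV[C]_m => -1 * 0 + 0) = (fun=> 0 : C).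
  by apply/funext => t; rewrite mulr0 addr0.
by rewrite mulN1r addNr.
Qed.

Lemma wedgeZl c w h s : wedge (fun t => c * w t) h s = c * wedge w h s.
Proof.
have := wedge_linl c w (fun=> 0) h s; rewrite wedge0l addr0 => <-.
by congr (wedge _ _ _); apply/funext => t; rewrite addr0.
Qed.

Lemma wedgeNl w h s : wedge (fun t => - w t) h s = - wedge w h s.
Proof.
rewrite -[RHS]mulN1r -wedgeZl.
by congr (wedge _ _ _); apply/funext => t; rewrite mulN1r.
Qed.

Lemma wedgeNr w h s : wedge w (fun t => - h t) s = - wedge w h s.
Proof.
have := wedge_linr (-1) w h (fun=> 0) s; rewrite wedge0r addr0 mulN1r => <-.
by congr (wedge _ _ _); apply/funext => t; rewrite addr0 mulN1r.
Qed.

Lemma wedgeDr w h1 h2 s :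
  wedge w (fun t => h1 t + h2 t) s = wedge w h1 s + wedge w h2 s.
Proof.
have := wedge_linr 1 w h1 h2 s; rewrite mul1r => <-.
by congr (wedge _ _ _); apply/funext => t; rewrite mul1r.
Qed.

Definition const_form (c : C) : form := fun s => if s is [::] then c else 0.

Lemma wedge_const c h s : wedge (const_form c) h s = c * h s.
Proof.
elim: s h => [|v s IHs] h //=.
have -> : contract v (const_form c) = fun=> 0 by [].
have -> : (fun u : seq 'rV[C]_m => (-1) ^+ size u * const_form c u) = const_form c.
  by apply/funext => -[|x t]; rewrite /const_form /= ?mul1r ?mulr0.
by rewrite wedge0l add0r IHs.
Qed.

Lemma contract_one_form v (xi : 'rV[C]_m) :
  contract v (one_form xi) = const_form ((xi *m v^T) 0 0).
Proof. by apply/funext => -[]. Qed.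

Lemma twist_one_form (xi : 'rV[C]_m) : twist (one_form xi) = fun s => - one_form xi s.
Proof.
by apply/funext => -[|v [|x s]]; rewrite /twist /= ?mulr0 ?oppr0 // expr1 mulN1r.
Qed.

Lemma one_wedge_cons (xi : 'rV[C]_m) h v s :
  wedge (one_form xi) h (v :: s) =
  (xi *m v^T) 0 0 * h s - wedge (one_form xi) (contract v h) s.
Proof. by rewrite wedge_cons contract_one_form wedge_const twist_one_form wedgeNl. Qed.

Lemma one_wedgeE (xi : 'rV[C]_m) h s :
  wedge (one_form xi) h s =
  \sum_(k < size s) (-1) ^+ k * (xi *m (nth 0 s k)^T) 0 0 * h (take k s ++ drop k.+1 s).
Proof.
elim: s h => [|v s IHs] h /=; first by rewrite big_ord0 mul0r.
rewrite -/(wedge _ h (v :: s)) one_wedge_cons IHs big_ord_recl /= expr0 mul1r.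
rewrite drop0 -sumrN; congr (_ + _); apply: eq_bigr => i _.
by rewrite /bump /= exprD expr1 mulN1r !mulNr.
Qed.

(** Graded commutation of a 1-form with an arbitrary form, in the shape that the
    recursive definition of the wedge product lends itself to. *)
Lemma one_wedge_comm (xi : 'rV[C]_m) w h s :
  wedge (one_form xi) (wedge w h) s = wedge (twist w) (wedge (one_form xi) h) s.
Proof.
elim: s w h => [|v s IHs] w h; first by rewrite /= !mul0r mulr0.
rewrite one_wedge_cons contract_wedge wedge_cons contract_twist wedgeNl.
rewrite twistK -IHs wedgeDr [X in _ - (_ + X)]IHs twistK.
have -> : contract v (wedge (one_form xi) h) =
    fun t => (xi *m v^T) 0 0 * h t + - wedge (one_form xi) (contract v h) t.
  by apply/funext => t; rewrite /contract one_wedge_cons.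
by rewrite wedge_linr wedgeNr opprD addrCA.
Qed.

Definition multilinear_form w := forall s1 s2 (c : C) u v,
  w (s1 ++ (c *: u + v) :: s2) = c * w (s1 ++ u :: s2) + w (s1 ++ v :: s2).

(** Vanishing on two equal neighbours is what the recursion defining [wedge]
    preserves; antisymmetry under adjacent swaps then brings any two equal
    arguments together. *)
Lemma alternating_adjacent w :
  multilinear_form w -> (forall s1 s2 u, w (s1 ++ u :: u :: s2) = 0) -> alternating w.
Proof.
move=> wlin wadj; split=> // s.
have linD s1 s2 u v : w (s1 ++ (u + v) :: s2) = w (s1 ++ u :: s2) + w (s1 ++ v :: s2).
  by rewrite -[u in u + v]scale1r wlin mul1r.
have swap s1 s2 u v : w (s1 ++ u :: v :: s2) = - w (s1 ++ v :: u :: s2).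
  apply/eqP; rewrite -addr_eq0; apply/eqP.
  have := wadj s1 s2 (u + v); rewrite linD.
  have linD2 x : w (s1 ++ x :: (u + v) :: s2) =
      w (s1 ++ x :: u :: s2) + w (s1 ++ x :: v :: s2).
    by have := linD (rcons s1 x) s2 u v; rewrite !cat_rcons.
  by rewrite !linD2 // !wadj add0r addr0.
have far s1 s2 s3 u : w (s1 ++ u :: s2 ++ u :: s3) = 0.
  elim: s2 s1 => [|x s2 IHs] s1; first exact: wadj.
  by rewrite /= swap -cat_rcons IHs oppr0.
suff H s1 : ~~ uniq s -> w (s1 ++ s) = 0 by apply: (H [::]).
elim: s s1 => //= x s IHs s1; rewrite negb_and negbK => /orP[xs|/IHs H].
  by case/splitPr: xs => s2 s3; exact: far.
by rewrite -cat_rcons H.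
Qed.

Lemma alternating_contract v w : alternating w -> alternating (contract v w).
Proof.
case=> wlin w0; split=> [s1 s2 c u x|s us]; first exact: (wlin (v :: s1)).
by apply: w0; rewrite /= (negbTE us) andbF.
Qed.

Lemma alternating_twist w : alternating w -> alternating (twist w).
Proof.
case=> wlin w0; split=> [s1 s2 c u x|s us]; last by rewrite /twist w0 ?mulr0.
by rewrite /twist !size_cat /= wlin; ring.
Qed.

Lemma contract_lin w c u v : alternating w ->
  contract (c *: u + v) w = fun s => c * contract u w s + contract v w s.
Proof. by case=> wlin _; apply/funext => s; exact: (wlin [::]). Qed.

Lemma contractC u v w s : alternating w ->
  contract u (contract v w) s = - contract v (contract u w) s.
Proof.
move=> -[wlin w0]; rewrite /contract.
have z x : w [:: x, x & s] = 0 by apply: w0; rewrite /= inE eqxx.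
have lr x : w [:: x, 1 *: u + v & s] = w [:: x, u & s] + w [:: x, v & s].
  by have := wlin [:: x] s 1 u v; rewrite /= mul1r.
have := z (1 *: u + v).
have -> : w [:: 1 *: u + v, 1 *: u + v & s] =
    w [:: u, 1 *: u + v & s] + w [:: v, 1 *: u + v & s].
  by have := wlin [::] (1 *: u + v :: s) 1 u v; rewrite /= mul1r.
by rewrite !lr !z add0r addr0 => /eqP; rewrite addrC addr_eq0 => /eqP.
Qed.

Lemma contract2 u w s : alternating w -> contract u (contract u w) s = 0.
Proof. by case=> _ w0; apply: w0; rewrite /= inE eqxx. Qed.

Lemma alternating_wedge w h : alternating w -> alternating h ->
  alternating (wedge w h).
Proof.
move=> aw ah; apply: alternating_adjacent.
  move=> s1; elim: s1 w h aw ah => [|x s1 IHs] w h aw ah s2 c u v.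
    rewrite /= -/(twist _) !contract_lin // wedge_linl wedge_linr; ring.
  rewrite !cat_cons !wedge_cons !IHs; first ring.
  - exact: alternating_twist.
  - exact: alternating_contract.
  - exact: alternating_contract.
  - by [].
move=> s1; elim: s1 w h aw ah => [|x s1 IHs] w h aw ah s2 u; last first.
  rewrite !cat_cons !wedge_cons !IHs ?addr0 //.
  - exact: alternating_twist.
  - exact: alternating_contract.
  - exact: alternating_contract.
rewrite cat0s wedge_cons !(wedge_cons _ _ u) contract_twist wedgeNl twistK.
have -> : contract u (contract u w) = fun=> 0.
  by apply/funext => s; exact: contract2.
have -> : contract u (contract u h) = fun=> 0.
  by apply/funext => s; exact: contract2.
by rewrite wedge0l wedge0r add0r addr0 addrN.
Qed.

Lemma alternating_one_form (xi : 'rV[C]_m) : alternating (one_form xi).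
Proof.
apply: alternating_adjacent => [s1 s2 c u v|[|x [|y s1]] s2 u //].
case: s1 => [|x s1] /=; last by case: s1 => [|y s1]; rewrite mulr0 addr0.
case: s2 => [|y s2]; last by rewrite mulr0 addr0.
by rewrite linearD linearZ /= mulmxDr -scalemxAr !mxE.
Qed.

Lemma alternating_lin c w h : alternating w -> alternating h ->
  alternating (fun s => c * w s + h s).
Proof.
case=> wlin w0 [hlin h0]; split=> [s1 s2 k u v|s us].
  by rewrite wlin hlin; ring.
by rewrite w0 // h0 // mulr0 addr0.
Qed.

Lemma alternating_zero : alternating ((fun=> 0) : form).
Proof. by split=> // *; rewrite mulr0 addr0. Qed.

Lemma alternating_cliff (a : gvec R m) w : alternating w -> alternating (cliff a w).
Proof.
move=> aw; have -> : cliff a w = fun s => 1 * contract (lsubmx a) w s + 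
    wedge (one_form (rsubmx a)) w s by apply/funext => s; rewrite mul1r.
apply: alternating_lin; first exact: alternating_contract.
by apply: alternating_wedge => //; exact: alternating_one_form.
Qed.

End Wedge.

(** * The pairing of vectors and covectors *)

Section Pairing.
Variables (K : comNzRingType) (m : nat).
Implicit Types (a b : 'rV[K]_(m + m)) (A : 'M[K]_(m + m)).

(** Gram matrix of the pairing in the standard frame; it is its own inverse, so
    that its rows form the dual frame. *)
Definition gram : 'M[K]_(m + m) := block_mx 0 1%:M 1%:M 0.

Lemma tr_gram : gram^T = gram.
Proof. by rewrite /gram tr_block_mx !trmx0 !trmx1. Qed.

Lemma gramK : gram *m gram = 1%:M.
Proof.
rewrite /gram mulmx_block !mul0mx !mulmx0 !mul1mx !addr0 !add0r.
by rewrite -scalar_mx_block.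
Qed.

Lemma gpairE a b : gpair a b = (a *m gram *m b^T) 0 0.
Proof.
rewrite /gpair; congr (_ 0 0).
rewrite -[in RHS](hsubmxK a) -[in RHS](hsubmxK b) /gram mul_row_block tr_row_mx.
rewrite !mulmx0 !mulmx1 add0r addr0 mul_row_col.
suff -> : rsubmx b *m (lsubmx a)^T = lsubmx a *m (rsubmx b)^T by [].
by rewrite -[LHS]trmxK trmx_mul trmxK; apply/matrixP => i j; rewrite !ord1 mxE.
Qed.

Lemma gpairC a b : gpair a b = gpair b a.
Proof. by rewrite /gpair addrC. Qed.

Lemma gpair0l b : gpair 0 b = 0.
Proof. by rewrite gpairE !mul0mx mxE. Qed.

Lemma gpair_row A (p : 'I_(m + m)) b :
  gpair (row p A) b = (A *m gram *m b^T) p 0.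
Proof. by rewrite gpairE -!row_mul mxE. Qed.

Lemma gpair_rows A (B : 'M[K]_(m + m)) (p q : 'I_(m + m)) :
  gpair (row p A) (row q B) = (A *m gram *m B^T) p q.
Proof. by rewrite gpair_row tr_row colE mulmxA -colE mxE. Qed.

(** Expansion of a vector in the frame of the rows of [B]; with [A] and [B] dual to
    each other, [gram *m A^T *m B] is a projector. *)
Lemma sum_gpair_row (A B : 'M[K]_(m + m)) b :
  \sum_p gpair (row p A) b *: row p B = b *m gram *m A^T *m B.
Proof.
apply/rowP => j; rewrite summxE.
have -> : b *m gram *m A^T *m B = (A *m gram *m b^T)^T *m B.
  by rewrite !trmx_mul trmxK tr_gram mulmxA.
rewrite [RHS]mxE; apply: eq_bigr => p _.
by rewrite gpair_row mxE [row p B _ _]mxE [X in _ = X * _]mxE.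
Qed.

End Pairing.

(** * The Clifford module of alternating forms *)

Section AltForm.
Variables (R : realType) (m : nat).
Local Notation C := R[i].
Local Notation contract := Defs.contract.
Local Notation alternating := Defs.alternating.

(** The Clifford relation and linearity in the vector argument only hold on
    alternating functions, hence a module of its own for these. *)
Record aform := AForm {
  aval :> seq 'rV[C]_m -> C;
  avalP : alternating aval }.

Lemma aval_inj : injective aval.
Proof.
move=> [w wP] [h hP] /= e; subst h; congr (AForm _); exact: Prop_irrelevance.
Qed.

Lemma aformP (w h : aform) : (forall s, w s = h s) <-> w = h.
Proof. by split=> [e|-> //]; apply/aval_inj/funext. Qed.

HB.instance Definition _ := gen_eqMixin aform.
HB.instance Definition _ := gen_choiceMixin aform.

Definition azero : aform := AForm (alternating_zero R m).

Definition alin (c : C) (w h : aform) : aform :=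
  AForm (alternating_lin c (avalP w) (avalP h)).

Definition aadd := alin 1.
Definition aopp (w : aform) := alin (-1) w azero.
Definition ascale (c : C) (w : aform) := alin c w azero.

Lemma aaddA : associative aadd.
Proof. by move=> u v w; apply/aformP => s /=; ring. Qed.
Lemma aaddC : commutative aadd.
Proof. by move=> u v; apply/aformP => s /=; ring. Qed.
Lemma aadd0 : left_id azero aadd.
Proof. by move=> u; apply/aformP => s /=; ring. Qed.
Lemma aaddN : left_inverse azero aopp aadd.
Proof. by move=> u; apply/aformP => s /=; ring. Qed.
HB.instance Definition _ := GRing.isZmodule.Build aform aaddA aaddC aadd0 aaddN.

Lemma ascaleA c k w : ascale c (ascale k w) = ascale (c * k) w.
Proof. by apply/aformP => s /=; ring. Qed.
Lemma ascale1 : left_id 1 ascale.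
Proof. by move=> u; apply/aformP => s /=; ring. Qed.
Lemma ascaleDr : right_distributive ascale +%R.
Proof. by move=> c u v; apply/aformP => s /=; ring. Qed.
Lemma ascaleDl w : {morph ascale^~ w : c k / c + k}.
Proof. by move=> c k; apply/aformP => s /=; ring. Qed.
HB.instance Definition _ :=
  GRing.Zmodule_isLmodule.Build C aform ascaleA ascale1 ascaleDr ascaleDl.

Lemma aval0 s : (0 : aform) s = 0.
Proof. by []. Qed.
Lemma avalD (w h : aform) s : (w + h) s = w s + h s.
Proof. by rewrite /= mul1r. Qed.
Lemma avalZ c (w : aform) s : (c *: w) s = c * w s.
Proof. by rewrite /= addr0. Qed.
Lemma avalN (w : aform) s : (- w) s = - w s.
Proof. by rewrite /= addr0 mulN1r. Qed.
Lemma avalB (w h : aform) s : (w - h) s = w s - h s.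
Proof. by rewrite avalD avalN. Qed.
Lemma aval_sum (I : Type) (r : seq I) (P : pred I) (F : I -> aform) s :
  (\sum_(i <- r | P i) F i) s = \sum_(i <- r | P i) F i s.
Proof. by elim/big_rec2: _ => [|i x y _ <-]; rewrite ?aval0 ?avalD. Qed.

Lemma aval_linear (w : aform) c u v s : w (c *: u + v :: s) = c * w (u :: s) + w (v :: s).
Proof. by have [h _] := avalP w; exact: (h [::]). Qed.

Lemma contract_linw v c (w h : aform) s :
  contract v (c *: w + h) s = c * contract v w s + contract v h s.
Proof. by rewrite /contract avalD avalZ. Qed.

Lemma wedge_avalr (x : seq 'rV[C]_m -> C) c (w h : aform) s :
  wedge x (c *: w + h) s = c * wedge x w s + wedge x h s.
Proof.
rewrite -wedge_linr; congr (wedge _ _ _).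
by apply/funext => t; rewrite avalD avalZ.
Qed.

Lemma one_form_lin c (x y : 'rV[C]_m) :
  one_form (c *: x + y) = fun s => c * one_form x s + one_form y s.
Proof.
apply/funext => -[|v [|u s]] /=; rewrite ?mulr0 ?addr0 //.
by rewrite mulmxDl -scalemxAl !mxE.
Qed.

Definition cl (a : gvec R m) (w : aform) : aform := AForm (alternating_cliff a (avalP w)).

Lemma cl_is_linear a : linear (cl a).
Proof.
move=> c w h; apply/aformP => s; rewrite avalD avalZ /= /cliff contract_linw.
by rewrite wedge_avalr; ring.
Qed.
HB.instance Definition _ a :=
  GRing.isLinear.Build C aform aform *:%R (cl a) (cl_is_linear a).

Lemma cl_linl c a b w : cl (c *: a + b) w = c *: cl a w + cl b w.
Proof.
apply/aformP => s; rewrite avalD avalZ /= /cliff !linearP /=.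
rewrite contract_lin; last exact: avalP.
by rewrite one_form_lin wedge_linl; ring.
Qed.

Lemma cl0l w : cl 0 w = 0.
Proof.
have := cl_linl (-1) 0 0 w; rewrite scaleN1r oppr0 addr0 scaleN1r addrC.
by rewrite addrN.
Qed.
Lemma clDl a b w : cl (a + b) w = cl a w + cl b w.
Proof. by have := cl_linl 1 a b w; rewrite !scale1r. Qed.
Lemma clZl c a w : cl (c *: a) w = c *: cl a w.
Proof. by have := cl_linl c a 0 w; rewrite cl0l !addr0. Qed.
Lemma clNl a w : cl (- a) w = - cl a w.
Proof. by rewrite -scaleN1r clZl scaleN1r. Qed.
Lemma clBl a b w : cl (a - b) w = cl a w - cl b w.
Proof. by rewrite clDl clNl. Qed.
Lemma cl_suml (I : Type) (r : seq I) (P : pred I) (F : I -> gvec R m) w :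
  cl (\sum_(i <- r | P i) F i) w = \sum_(i <- r | P i) cl (F i) w.
Proof. by elim/big_rec2: _ => [|i x y _ <-]; rewrite ?cl0l ?clDl. Qed.

Lemma contract_cliff v (a : gvec R m) (w : aform) s :
  contract v (cliff a w) s =
  contract v (contract (lsubmx a) w) s + (rsubmx a *m v^T) 0 0 * w s
  - wedge (one_form (rsubmx a)) (contract v w) s.
Proof. by rewrite {1}/contract /cliff one_wedge_cons addrA. Qed.

(** The Clifford relation: contractions anticommute, so do 1-forms, and the mixed
    terms give the pairing by the Leibniz rule of a contraction. *)
Lemma cl_anti a b w : cl a (cl b w) + cl b (cl a w) = gpair a b *: w.
Proof.
apply/aformP => s; rewrite avalD avalZ /= {1 3}/cliff !contract_cliff.
rewrite (contractC (lsubmx a) _ _ (avalP w)).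
have H x y : wedge (one_form x) (cliff y w) s =
    wedge (one_form x) (contract (lsubmx y) w) s +
    wedge (one_form x) (wedge (one_form (rsubmx y)) w) s.
  by rewrite -wedgeDr.
rewrite !H (one_wedge_comm (rsubmx a) (one_form _)) twist_one_form wedgeNl.
by rewrite /gpair [X in _ = X * _]mxE; ring.
Qed.

Lemma cl_swap a b w : cl a (cl b w) = gpair a b *: w - cl b (cl a w).
Proof. by rewrite -cl_anti addrK. Qed.

Lemma cl_sq a w : gpair a a = 0 -> cl a (cl a w) = 0.
Proof.
move=> a0; have := cl_anti a a w; rewrite a0 scale0r => /eqP.
by rewrite -mulr2n -scaler_nat scaler_eq0 pnatr_eq0 => /eqP.
Qed.

Definition to_aform (w : seq 'rV[C]_m -> C) : aform :=
  if pselect (alternating w) is left h then AForm h else 0.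

Lemma to_aformE w : alternating w -> aval (to_aform w) = w.
Proof. by rewrite /to_aform; case: pselect. Qed.

Lemma avalK (w : aform) : to_aform w = w.
Proof. by apply: aval_inj; rewrite to_aformE //; exact: avalP. Qed.

End AltForm.
Arguments cl {R m} a w.

(** * The filtration by annihilators *)

Section Filtration.
Variables (R : realType) (m : nat).
Local Notation C := R[i].
Local Notation E := (gvec R m).
Local Notation V := (aform R m).
Implicit Types (L : set E) (a b : E) (w h : V).

Definition isotropic L := forall a b, L a -> L b -> gpair a b = 0.

(** [fil L k] consists of the forms annihilated by any [k] elements of [L].  When
    [L] is the eigenbundle of a structure it is the sum of the spaces [U^{j - n}]
    with [j < k], but it only depends on [L], which makes it suitable for comparing
    two structures. *)
Fixpoint fil L (k : nat) w : Prop :=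
  if k is k'.+1 then forall a, L a -> fil L k' (cl a w) else w = 0.

Lemma fil_zero L k : fil L k 0.
Proof. by elim: k => //= k IHk a _; rewrite linear0. Qed.

Lemma fil_lin L k c w h : fil L k w -> fil L k h -> fil L k (c *: w + h).
Proof.
elim: k w h => /= [w h -> ->|k IHk w h wk hk a La]; first by rewrite scaler0 addr0.
by rewrite linearP /=; apply: IHk; [exact: wk|exact: hk].
Qed.

Lemma filD L k w h : fil L k w -> fil L k h -> fil L k (w + h).
Proof. by move=> wk hk; rewrite -[w]scale1r; exact: fil_lin. Qed.

Lemma filZ L k c w : fil L k w -> fil L k (c *: w).
Proof. by move=> wk; rewrite -[_ *: _]addr0; apply: fil_lin => //; exact: fil_zero. Qed.

Lemma filN L k w : fil L k w -> fil L k (- w).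
Proof. by move=> wk; rewrite -scaleN1r; exact: filZ. Qed.

Lemma filB L k w h : fil L k w -> fil L k h -> fil L k (w - h).
Proof. by move=> wk hk; apply: filD => //; exact: filN. Qed.

Lemma fil_sum L k (I : Type) (r : seq I) (Q : pred I) (F : I -> V) :
  (forall i, Q i -> fil L k (F i)) -> fil L k (\sum_(i <- r | Q i) F i).
Proof.
move=> FL; elim/big_rec: _ => [|i x Qi xk]; first exact: fil_zero.
by apply: filD => //; exact: FL.
Qed.

Lemma filS L k w : fil L k w -> fil L k.+1 w.
Proof.
elim: k w => [w -> a _|k IHk w wk a La]; first by rewrite /= linear0.
by apply: IHk; exact: wk.
Qed.

Lemma fil_leq L k l w : (k <= l)%N -> fil L k w -> fil L l w.
Proof.
by move=> /subnK <-; elim: (l - k)%N => // d IHd wk; rewrite addSn; apply: filS; exact: IHd.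
Qed.

Lemma fil_cl L k a w : L a -> fil L k w -> fil L k.-1 (cl a w).
Proof. by case: k => [|k] La /= wk; [rewrite wk linear0|exact: wk]. Qed.

(** The Clifford relation moves an element of [L] past [b] at the cost of a scalar. *)
Lemma fil_clS L k b w : fil L k w -> fil L k.+1 (cl b w).
Proof.
elim: k w => [w -> a _|k IHk w wk a La]; first by rewrite /= !linear0.
rewrite cl_swap; apply: (@filB L k.+1); first exact: filZ.
by apply: IHk; exact: wk.
Qed.

(** The elements of an isotropic family anticommute and square to 0, so that a
    repeated factor can be moved next to its copy. *)
Lemma cl_word_mem (I : eqType) (f : I -> E) (x : I) (s : seq I) w :
  (forall i j, gpair (f i) (f j) = 0) -> x \in s ->
  cl (f x) (foldr cl w [seq f i | i <- s]) = 0.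
Proof.
move=> f0; elim: s => //= y s IHs; rewrite inE.
case: eqVneq => [-> _|_ /= xs]; first exact: cl_sq.
by rewrite cl_swap f0 scale0r IHs // linear0 subr0.
Qed.

Lemma cl_word_uniq (I : eqType) (f : I -> E) (s : seq I) w :
  (forall i j, gpair (f i) (f j) = 0) -> ~~ uniq s ->
  foldr cl w [seq f i | i <- s] = 0.
Proof.
move=> f0; elim: s => //= x s IHs; rewrite negb_and negbK => /orP[xs|/IHs ->].
  exact: cl_word_mem.
exact: linear0.
Qed.

Lemma foldr_cl_lin (s : seq E) (I : Type) (r : seq I) (c : I -> C) (F : I -> V) :
  foldr cl (\sum_(i <- r) c i *: F i) s = \sum_(i <- r) c i *: foldr cl (F i) s.
Proof.
elim: s => //= a s ->; rewrite linear_sum; apply: eq_bigr => i _.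
by rewrite linearZ.
Qed.

(** By multilinearity it is enough to test the products of a generating family. *)
Lemma fil_words L r (B : 'M[C]_(r, m + m)) k w :
  (forall a, L a -> exists x : 'rV_r, a = x *m B) ->
  (forall s : seq 'I_r, size s = k -> foldr cl w [seq row i B | i <- s] = 0) ->
  fil L k w.
Proof.
move=> LB; elim: k w => [w|k IHk w] words; first exact: (words [::]).
move=> a /LB[x ->]; apply: IHk => s sk; rewrite mulmx_sum_row cl_suml.
under eq_bigr do rewrite clZl.
rewrite foldr_cl_lin big1 // => i _.
have := words (rcons s i); rewrite size_rcons sk map_rcons -cats1 foldr_cat /=.
by move=> -> //; rewrite scaler0.
Qed.

(** An isotropic subspace has dimension at most [m], and by the Clifford
    relation a product of its elements is alternating. *)
Lemma fil_full L (P : 'M[C]_(m + m)) w :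
  (forall a, L a -> a *m P = a) -> (forall a, L (a *m P)) -> isotropic L ->
  fil L m.+1 w.
Proof.
move=> LP PL Liso; have rowL p : L (row p P) by rewrite rowE; exact: PL.
have PgP : P *m (gram _ m *m P^T) = 0.
  apply/matrixP => p q; rewrite [RHS]mxE -[RHS](Liso _ _ (rowL p) (rowL q)).
  by rewrite gpair_rows mulmxA.
have gU : gram C m \in unitmx.
  by case: (mulmx1_unit (gramK C m)).
have rP : (\rank P <= m)%N.
  have := mulmx0_rank_max PgP.
  rewrite -[X in (_ + X)%N]mxrank_tr trmx_mul trmxK tr_gram mxrankMfree ?row_free_unit //.
  by move=> h; rewrite -leq_double -!addnn.
have baseP i : exists x, row i (row_base P) = x *m P.
  have : (row i (row_base P) <= P)%MS.
    by rewrite (submx_trans (row_sub _ _)) // eq_row_base.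
  by case/submxP => x ->; exists x.
apply: (@fil_words L _ (row_base P)) => [a La|s ss].
  have : (a <= row_base P)%MS by rewrite eq_row_base -(LP a La) submxMl.
  by case/submxP => x ->; exists x.
apply: cl_word_uniq => [i j|].
  by have [x ->] := baseP i; have [y ->] := baseP j; apply: Liso.
apply: contraTN rP => us; rewrite -ltnNge.
have := max_card (mem s); rewrite card_ord (card_uniqP us) ss.
exact.
Qed.

End Filtration.

(** * The number operator and its levels *)

Section Levels.
Variables (R : realType) (m : nat).
Local Notation C := R[i].
Local Notation E := (gvec R m).
Local Notation V := (aform R m).
Implicit Types (P : 'M[C]_(m + m)) (a b : E) (w h : V).

Definition im P : set E := [set a | a *m P = a].

(** [P] projects onto a Lagrangian subspace along another one: its adjoint for
    the pairing is [1 - P]. *)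
Definition polar P := P *m P = P /\ P *m gram C m = gram C m *m (1%:M - P)^T.

Lemma polarC P : polar P -> polar (1%:M - P).
Proof.
case=> PP Pg; split; first by rewrite mulmxBl !mulmxBr !mulmx1 !mul1mx PP subrr subr0.
have -> : 1%:M - (1%:M - P) = P by rewrite opprB addrC subrK.
by apply: trmx_inj; rewrite !trmx_mul trmxK tr_gram -Pg.
Qed.

Lemma gpair_im P a b : polar P -> gpair (a *m P) b = gpair a (b *m (1%:M - P)).
Proof. by case=> _ Pg; rewrite !gpairE -(mulmxA a) Pg trmx_mul !mulmxA. Qed.

Lemma im_isotropic P : polar P -> isotropic (im P).
Proof.
move=> pP a b <- <-; rewrite gpair_im // mulmxBr mulmx1 -mulmxA.
by case: pP => -> _; rewrite subrr gpairC gpair0l.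
Qed.

Lemma im_mul P a : polar P -> im P (a *m P).
Proof. by case=> PP _; rewrite /im /= -mulmxA PP. Qed.

Lemma im_row P (A : 'M[C]_(m + m)) (p : 'I_(m + m)) : polar P -> im P (row p (A *m P)).
Proof. by move=> pP; rewrite row_mul; exact: im_mul. Qed.

Lemma polar_trace P : polar P -> \tr P = m%:R.
Proof.
case=> _ Pg; have : \tr P = \tr (1%:M - P).
  rewrite -[LHS]mxtrace_tr -{1}[P]mulmx1 -(gramK C m) mulmxA Pg.
  by rewrite mxtrace_tr mxtrace_mulC mulmxA gramK mul1mx mxtrace_tr.
rewrite raddfB /= mxtrace1 => trE.
have : (\tr P - m%:R) *+ 2 == 0.
  by rewrite mulrnBl mulr2n {1}trE subrK natrD -mulr2n subrr.
by rewrite mulrn_eq0 /= subr_eq0 => /eqP.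
Qed.

(** The rows of [P] generate its range; the [coframe] is dual to them, in the sense
    that the two lemmas [sum_gpair_frame] and [sum_gpair_coframe] hold. *)
Definition frame P (p : 'I_(m + m)) : E := row p P.
Definition coframe P (p : 'I_(m + m)) : E := row p (gram C m *m (1%:M - P)).

Lemma im_frame P p : polar P -> im P (frame P p).
Proof. by move=> pP; rewrite /frame -[P in row p P]mul1mx; exact: im_row. Qed.

Lemma im_coframe P p : polar P -> im (1%:M - P) (coframe P p).
Proof. by move=> pP; apply: im_row; exact: polarC. Qed.

Lemma sum_gpair_frame P a : polar P -> im (1%:M - P) a ->
  \sum_p gpair (frame P p) a *: coframe P p = a.
Proof.
move=> pP aP; have [_ Pg] := polarC pP; rewrite sum_gpair_row.
have -> : a *m gram C m *m P^T = a *m (1%:M - P) *m gram C m.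
  rewrite -mulmxA -[RHS]mulmxA Pg; congr (_ *m (_ *m _^T)).
  by rewrite opprB addrC subrK.
by rewrite aP mulmxA -(mulmxA a) gramK mulmx1.
Qed.

Lemma sum_gpair_coframe P a : polar P -> im P a ->
  \sum_p gpair (coframe P p) a *: frame P p = a.
Proof.
move=> [PP Pg] aP; rewrite sum_gpair_row trmx_mul tr_gram mulmxA -(mulmxA a) -Pg.
by rewrite mulmxA -!mulmxA [gram _ _ *m (_ *m _)]mulmxA gramK mul1mx PP.
Qed.

(** The number operator [\sum_i l^i l_i], written with the redundant but smoothly
    varying frame of the rows of [P] rather than with a basis. *)
Definition num_op P w : V := \sum_p cl (coframe P p) (cl (frame P p) w).

Lemma num_op_is_linear P : linear (num_op P).
Proof.
move=> c w h; rewrite /num_op scaler_sumr -big_split; apply: eq_bigr => p _ /=.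
by rewrite !linearP.
Qed.
HB.instance Definition _ P :=
  GRing.isLinear.Build C V V *:%R (num_op P) (num_op_is_linear P).

(** Elements of the complementary subspace are creation operators and elements of
    the range of [P] are annihilation operators for [num_op]. *)
Lemma num_op_up P a w : polar P -> im (1%:M - P) a ->
  num_op P (cl a w) = cl a (num_op P w) + cl a w.
Proof.
move=> pP aP; rewrite /num_op -[X in _ = _ + cl X w](sum_gpair_frame pP aP).
rewrite linear_sum cl_suml -big_split; apply: eq_bigr => p _ /=.
rewrite [cl (frame P p) (cl a w)]cl_swap linearB linearZ /= clZl.
rewrite [cl a (cl (coframe P p) _)]cl_swap.
rewrite (im_isotropic (polarC pP) aP (im_coframe p pP)) scale0r sub0r addrC.
by [].
Qed.

Lemma num_op_down P a w : polar P -> im P a ->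
  cl a (num_op P w) = num_op P (cl a w) + cl a w.
Proof.
move=> pP aP; rewrite /num_op -[X in _ = _ + cl X w](sum_gpair_coframe pP aP).
rewrite linear_sum cl_suml -big_split; apply: eq_bigr => p _ /=.
rewrite cl_swap clZl [cl a (cl (frame P p) _)]cl_swap.
by rewrite (im_isotropic pP aP (im_frame p pP)) scale0r sub0r linearN opprK gpairC addrC.
Qed.

Lemma sum_cl_row (A X Y : 'M[C]_(m + m)) w :
  \sum_p cl (row p (A *m X)) (cl (row p Y) w) =
  \sum_p cl (row p X) (cl (row p (A^T *m Y)) w).
Proof.
under eq_bigr => p _.
  rewrite row_mul mulmx_sum_row cl_suml.
  under eq_bigr do rewrite clZl mxE.
  over.
rewrite exchange_big; apply: eq_bigr => q _ /=.
rewrite row_mul mulmx_sum_row cl_suml linear_sum; apply: eq_bigr => p _.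
by rewrite clZl linearZ /= !mxE.
Qed.

(** Exchanging the two subspaces reverses the order of the levels; the constant
    [m] is the trace of [P]. *)
Lemma num_opC P w : polar P -> num_op (1%:M - P) w = m%:R *: w - num_op P w.
Proof.
move=> pP; rewrite {1}/num_op /coframe.
have -> : 1%:M - (1%:M - P) = P by rewrite opprB addrC subrK.
rewrite sum_cl_row tr_gram.
under eq_bigr do rewrite cl_swap.
rewrite sumrB; congr (_ - _); rewrite -scaler_suml; congr (_ *: _).
rewrite -(polar_trace pP); apply: eq_bigr => p _.
rewrite gpair_rows trmx_mul tr_gram.
case: pP => PP Pg; rewrite -[P *m _ *m _]mulmxA [gram _ _ *m (_ *m _)]mulmxA -Pg.
by rewrite -mulmxA gramK mulmx1 PP.
Qed.

(** The fibre of [U^{j - n}], as an eigenspace of [num_op]: see [UspaceP]. *)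
Definition lev P (j : nat) w := num_op P w = j%:R *: w /\ fil (im P) j.+1 w.

Lemma lev_zero P j : lev P j 0.
Proof. by split; [rewrite linear0 scaler0|exact: fil_zero]. Qed.

Lemma lev_lin P j c w h : lev P j w -> lev P j h -> lev P j (c *: w + h).
Proof.
move=> [ew fw] [eh fh]; split; last exact: fil_lin.
by rewrite linearP /= ew eh scalerDr !scalerA mulrC.
Qed.

Lemma levZ P j c w : lev P j w -> lev P j (c *: w).
Proof. by move=> wj; rewrite -[_ *: _]addr0; apply: lev_lin => //; exact: lev_zero. Qed.

Lemma levB P j w h : lev P j w -> lev P j h -> lev P j (w - h).
Proof. by move=> wj hj; rewrite addrC -scaleN1r; exact: lev_lin. Qed.

Lemma lev_sum P j (I : Type) (r : seq I) (Q : pred I) (F : I -> V) :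
  (forall i, Q i -> lev P j (F i)) -> lev P j (\sum_(i <- r | Q i) F i).
Proof.
move=> FL; elim/big_rec: _ => [|i x Qi xk]; first exact: lev_zero.
by rewrite -[F i]scale1r; apply: lev_lin => //; exact: FL.
Qed.

Lemma fil_num_sub P k w : polar P -> fil (im P) k.+1 w ->
  fil (im P) k (num_op P w - k%:R *: w).
Proof.
move=> pP; elim: k w => [w wk|k IHk w wk a aP].
  rewrite /= scale0r subr0 /num_op big1 // => p _.
  by rewrite wk ?linear0 //; exact: im_frame.
rewrite linearB linearZ /= num_op_down // mulrSr scalerDl scale1r opprD addrACA subrr addr0.
by apply: IHk; exact: wk.
Qed.

(** On the step [k + 1] of the filtration, [num_op - k] lands in the step [k];
    applied to an eigenvector it only multiplies by a nonzero scalar. *)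
Lemma eig_fil0 P j k w : polar P -> num_op P w = j%:R *: w -> fil (im P) k w ->
  (k <= j)%N -> w = 0.
Proof.
move=> pP wj; elim: k => // k IHk wk kj; apply: IHk; last exact: ltnW.
have := fil_num_sub pP wk; rewrite wj -scalerBl => /(filZ (j%:R - k%:R)^-1).
rewrite scalerA mulVf ?scale1r //.
by rewrite subr_eq0 eqr_nat neq_ltn kj orbT.
Qed.

Lemma lev_up P j a w : polar P -> im (1%:M - P) a -> lev P j w -> lev P j.+1 (cl a w).
Proof.
move=> pP aP [ew fw]; split; last exact: fil_clS.
by rewrite num_op_up // ew linearZ /= mulrSr scalerDl scale1r.
Qed.

Lemma lev_down P j a w : polar P -> im P a -> lev P j.+1 w -> lev P j (cl a w).
Proof.
move=> pP aP [ew fw]; split; last exact: fw.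
have := num_op_down w pP aP; rewrite ew linearZ /= mulrSr scalerDl scale1r.
by move=> /addIr ->.
Qed.

Lemma im_full P w : polar P -> fil (im P) m.+1 w.
Proof.
move=> pP; apply: (@fil_full _ _ _ P) => // [a|]; first exact: im_mul.
exact: im_isotropic.
Qed.

Lemma lev_big P j w : polar P -> lev P j w -> (m < j)%N -> w = 0.
Proof. by move=> pP [ew _] mj; exact: (eig_fil0 pP ew (im_full w pP)). Qed.

(** Independence of eigenvectors: apply [num_op - k] to remove the last one. *)
Lemma sum_eig0 P k (c : nat -> V) :
  (forall j, num_op P (c j) = j%:R *: c j) -> \sum_(j < k) c j = 0 ->
  forall j, (j < k)%N -> c j = 0.
Proof.
elim: k c => // k IHk c ec sc.
have H j : (j < k)%N -> c j = 0.
  move=> jk; suff : (j%:R - k%:R) *: c j = 0.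
    move/eqP; rewrite scaler_eq0 subr_eq0 eqr_nat (ltn_eqF jk) /= => /eqP //.
  apply: (IHk (fun i => (i%:R - k%:R) *: c i)) jk => [i|].
    by rewrite linearZ /= ec !scalerA mulrC.
  have := congr1 (fun w => num_op P w - k%:R *: w) sc.
  rewrite /= linear0 scaler0 subr0 linear_sum scaler_sumr -sumrB big_ord_recr /=.
  rewrite ec subrr addr0 => h; rewrite -[RHS]h.
  by apply: eq_bigr => i _; rewrite ec scalerBl.
move=> j; rewrite ltnS leq_eqVlt => /predU1P[->|/H //].
by move: sc; rewrite big_ord_recr /= big1 ?add0r // => i _; exact: H.
Qed.

(** The eigenspace decomposition of the filtration: by [fil_num_sub] and induction,
    [num_op w - k w] is a sum of eigenvectors for the eigenvalues [j < k]; dividing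
    them by [j - k] and subtracting leaves an eigenvector for [k]. *)
Lemma fil_lev P k w : polar P -> fil (im P) k w ->
  exists c : nat -> V, (forall j, lev P j (c j)) /\ w = \sum_(j < k) c j.
Proof.
move=> pP; elim: k w => [w ->|k IHk w wk].
  by exists (fun=> 0); split=> [j|]; [exact: lev_zero|rewrite big_ord0].
have [c [cl0 uE]] := IHk _ (fil_num_sub pP wk).
pose f j := (j%:R - k%:R : C)^-1 *: c j.
have fl j : lev P j (f j) by apply: levZ.
pose z := w - \sum_(j < k) f j.
have zk : lev P k z.
  split; last first.
    apply: filB => //; apply: fil_sum => j _.
    by apply: (@fil_leq _ _ _ j.+1); [exact: ltnW (ltn_ord j)|case: (fl j)].
  apply/eqP; rewrite -subr_eq0 /z linearB scalerBr /= opprB addrA addrAC.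
  rewrite [_ - _ - _]addrAC uE (linear_sum (num_op P)) scaler_sumr -sumrB -big_split /=.
  rewrite big1 // => j _; have [-> _] := fl j.
  rewrite -addrA [- _ + _]addrC -opprB -scalerBl /f scalerA mulfV ?scale1r ?subrr //.
  by rewrite subr_eq0 eqr_nat neq_ltn ltn_ord.
exists (fun j => if (j < k)%N then f j else if j == k then z else 0); split.
  move=> j; case: ifP => _; first exact: fl.
  by case: eqP => [->|_] //; exact: lev_zero.
rewrite big_ord_recr /= ltnn eqxx [X in X + _](eq_bigr (fun j : 'I_k => f j)).
  by rewrite /z addrC subrK.
by move=> j _; rewrite ltn_ord.
Qed.

Definition lev_comp P w : nat -> V :=
  xget (fun=> 0) [set c | (forall j, lev P j (c j)) /\ w = \sum_(j < m.+1) c j].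

Lemma lev_compP P w : polar P ->
  (forall j, lev P j (lev_comp P w j)) /\ w = \sum_(j < m.+1) lev_comp P w j.
Proof.
move=> pP; have [c cP] := fil_lev pP (im_full w pP).
exact: (@xgetI _ (fun=> 0) [set c | (forall j, lev P j (c j)) /\ _] c cP).
Qed.

Lemma lev_comp_lev P w j : polar P -> lev P j (lev_comp P w j).
Proof. by move=> pP; case: (lev_compP w pP). Qed.

Lemma lev_comp_sum P w : polar P -> w = \sum_(j < m.+1) lev_comp P w j.
Proof. by move=> pP; case: (lev_compP w pP). Qed.

Lemma lev_comp_unique P (c : nat -> V) k w j : polar P ->
  (forall i, lev P i (c i)) -> w = \sum_(i < k) c i ->
  lev_comp P w j = if (j < k)%N then c j else 0.
Proof.
move=> pP cl wE; pose f i : V := if (i < k)%N then c i else 0.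
pose g i := lev_comp P w i - f i.
have fl i : lev P i (f i) by rewrite /f; case: ifP => _ //; exact: lev_zero.
suff : g j = 0 by move/eqP; rewrite subr_eq0 => /eqP.
apply: (@sum_eig0 P (k + m.+1 + j.+1)%N).
- by move=> i; have [] : lev P i (g i) by apply: levB => //; exact: lev_comp_lev.
- rewrite sumrB; apply/eqP; rewrite subr_eq0; apply/eqP; transitivity w.
    rewrite [RHS](lev_comp_sum w pP).
    rewrite (@big_ord_widen _ _ _ m.+1 (k + m.+1 + j.+1) (lev_comp P w)).
      rewrite [RHS]big_mkcond. apply: eq_bigr => i _; case: ltnP => // mi.
      by apply: (lev_big pP (lev_comp_lev w i pP)).
    by rewrite (leq_trans (leq_addl k _)) // leq_addr.
  rewrite wE (@big_ord_widen _ _ _ k (k + m.+1 + j.+1) c) ?big_mkcond //.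
  by rewrite -addnA leq_addr.
- by rewrite leq_addl.
Qed.

Lemma lev_comp_lin P c w h j : polar P ->
  lev_comp P (c *: w + h) j = c *: lev_comp P w j + lev_comp P h j.
Proof.
move=> pP.
rewrite (@lev_comp_unique P (fun i => c *: lev_comp P w i + lev_comp P h i) m.+1) //.
- case: ltnP => // mj.
  rewrite (lev_big pP (lev_comp_lev w j pP)) // (lev_big pP (lev_comp_lev h j pP)) //.
  by rewrite scaler0 addr0.
- by move=> i; apply: lev_lin; exact: lev_comp_lev.
- by rewrite {1}(lev_comp_sum w pP) {1}(lev_comp_sum h pP) scaler_sumr big_split.
Qed.

Lemma lev_comp0 P j : polar P -> lev_comp P 0 j = 0.
Proof.
move=> pP; rewrite (@lev_comp_unique P (fun=> 0) 0) //; first by move=> i; exact: lev_zero.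
by rewrite big_ord0.
Qed.

Lemma lev_compD P w h j : polar P -> lev_comp P (w + h) j = lev_comp P w j + lev_comp P h j.
Proof. by move=> pP; rewrite -[w]scale1r lev_comp_lin // !scale1r. Qed.

Lemma lev_compB P w h j : polar P -> lev_comp P (w - h) j = lev_comp P w j - lev_comp P h j.
Proof. by move=> pP; rewrite addrC -scaleN1r lev_comp_lin // scaleN1r addrC. Qed.

Lemma lev_compE P j w i : polar P -> lev P j w ->
  lev_comp P w i = if i == j then w else 0.
Proof.
move=> pP wj; pose c i : V := if i == j then w else 0.
rewrite (@lev_comp_unique P c j.+1) //.
- rewrite /c; case: eqP => [->|_]; first by rewrite ltnSn.
  by case: ifP.
- by move=> l; rewrite /c; case: eqP => [->|_] //; exact: lev_zero.
- rewrite big_ord_recr /= /c eqxx big1 ?add0r // => l _.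
  by rewrite ltn_eqF.
Qed.

Lemma fil_comp0 P k w j : polar P -> fil (im P) k w -> (k <= j)%N -> lev_comp P w j = 0.
Proof.
move=> pP wk kj; have [c [cP wE]] := fil_lev pP wk.
by rewrite (lev_comp_unique _ pP cP wE) ltnNge kj.
Qed.

(** The symbol of an element of [fil k.+1] is its component of level [k]. *)
Lemma fil_compP P k w : polar P -> fil (im P) k.+1 w ->
  (lev_comp P w k = 0 <-> fil (im P) k w).
Proof.
move=> pP wk; split=> [w0|fk]; last exact: (fil_comp0 pP fk).
have [c [cP wE]] := fil_lev pP wk.
have := lev_comp_unique k pP cP wE; rewrite ltnSn w0 => ck.
rewrite wE big_ord_recr /= -ck addr0; apply: fil_sum => j _.
by apply: (@fil_leq _ _ _ j.+1) => //; case: (cP j).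
Qed.

(** The opposite filtration: by [lev_cofil] and [cofil_comp0], [cofil P i] is the sum
    of the levels at least [i]. *)
Definition cofil P (i : nat) w := fil (im (1%:M - P)) (m.+1 - i) w.

Lemma cofilD P i w h : cofil P i w -> cofil P i h -> cofil P i (w + h).
Proof. exact: filD. Qed.
Lemma cofilB P i w h : cofil P i w -> cofil P i h -> cofil P i (w - h).
Proof. exact: filB. Qed.
Lemma cofilZ P i c w : cofil P i w -> cofil P i (c *: w).
Proof. exact: filZ. Qed.

Lemma cofil_leq P i j w : (i <= j)%N -> cofil P j w -> cofil P i w.
Proof. by move=> ij; apply: fil_leq; rewrite leq_sub2l. Qed.

Lemma cofil0 P w : polar P -> cofil P 0 w.
Proof. by move=> pP; apply: im_full; exact: polarC. Qed.

Lemma cofil_big P i w : cofil P i w -> (m < i)%N -> w = 0.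
Proof. by move=> + mi; rewrite /cofil (eqP mi). Qed.

Lemma cofil_up P i a w : im (1%:M - P) a -> cofil P i w -> cofil P i.+1 (cl a w).
Proof. by move=> aP wi; rewrite /cofil subnS; exact: fil_cl. Qed.

(** Each element of the complementary subspace raises the level by one, and there
    is no level above [m]. *)
Lemma lev_cofil P j w : polar P -> lev P j w -> cofil P j w.
Proof.
move=> pP; suff H d : forall i h, lev P i h -> (m.+1 - i <= d)%N -> fil (im (1%:M - P)) d h.
  by move=> wj; exact: (H _ _ _ wj).
elim: d => [i h hi|d IHd i h hi im a aP].
  by rewrite leqn0 subn_eq0 => mi; exact: (lev_big pP hi).
apply: IHd (lev_up pP aP hi) _.
by rewrite subnS -ltnS; case: (m.+1 - i)%N im.
Qed.

(** Decompose for the exchanged subspaces: their level [l] is the level [m - l]. *)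
Lemma cofil_comp0 P i w j : polar P -> cofil P i w -> (j < i)%N -> lev_comp P w j = 0.
Proof.
move=> pP wi ji; have pQ := polarC pP.
have QK : 1%:M - (1%:M - P) = P by rewrite opprB addrC subrK.
have [c [cP wE]] := fil_lev pQ wi.
pose f l : V := if (i <= l <= m)%N then c (m - l)%N else 0.
have fP l : lev P l (f l).
  rewrite /f; case: ifP => [/andP[il lm]|_]; last exact: lev_zero.
  have [ce cf] := cP (m - l)%N; split.
    have := num_opC (c (m - l)%N) pQ; rewrite QK ce => ->.
    by rewrite -scalerBl -natrB ?leq_subr // subKn.
  have := lev_cofil pQ (cP (m - l)%N).
  by rewrite /cofil QK subSn ?leq_subr // subKn.
rewrite (@lev_comp_unique P f m.+1) //.
  by rewrite /f [(i <= j)%N]leqNgt ji /=; case: ifP.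
rewrite wE (@big_ord_widen _ _ _ _ m.+1 c) ?leq_subr // big_mkcond.
rewrite [RHS](reindex_inj rev_ord_inj) /=; apply: eq_bigr => l _.
have lm : (l <= m)%N by rewrite -ltnS.
by rewrite /f subSS leq_subr andbT subKn // ltn_subRL leq_subRL // ltnS addnC.
Qed.

End Levels.

(** * Bivectors and their exponentials *)

Section Bivectors.
Variables (R : realType) (m : nat).
Local Notation C := R[i].
Local Notation E := (gvec R m).
Local Notation V := (aform R m).
Implicit Types (P B : 'M[C]_(m + m)) (a b : E) (w h : V).

(** The matrix of [bv_map B], which acts on row vectors from the right. *)
Definition bv_mx B : 'M[C]_(m + m) := gram C m *m B^T.

Lemma bv_mapE B a : bv_map B a = a *m bv_mx B.
Proof.
rewrite /bv_map /bv_mx mulmxA; apply/rowP => j; rewrite summxE.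
under eq_bigr => p _ do rewrite summxE.
rewrite (bigD1 j) //= [X in _ + X]big1 ?addr0; last first.
  move=> p pj; rewrite big1 // => q _; rewrite !mxE eqxx /=.
  by rewrite eq_sym (negbTE pj) mulr0.
have -> : (a *m gram C m *m B^T) 0 j = (B *m gram C m *m a^T) j 0.
  have -> : B *m gram C m *m a^T = (a *m gram C m *m B^T)^T.
    by rewrite !trmx_mul trmxK tr_gram mulmxA.
  by rewrite [RHS]mxE.
rewrite -mulmxA [RHS]mxE; apply: eq_bigr => q _.
have -> : (gram C m *m a^T) q 0 = gpair (gbasis R q) a.
  by rewrite gpairE /gbasis -mulmxA -rowE [RHS]mxE.
by rewrite !mxE !eqxx mulr1.
Qed.

Lemma scale_half_double (U : lmodType C) (v : U) : 2^-1 *: (v + v) = v.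
Proof.
by rewrite -{1 2}[v]scale1r -scalerDl scalerA mulVf ?scale1r // (pnatr_eq0 _ 2).
Qed.

Definition bv_act_alt B w : V := 2^-1 *: \sum_p cl (gbasis R p) (cl (row p B) w).

Lemma bv_act_altE B w s : bv_cliff B w s = bv_act_alt B w s.
Proof.
rewrite /bv_cliff /bv_act_alt avalZ aval_sum; congr (_ * _).
apply: eq_bigr => p _; rewrite [row p B]row_sum_delta cl_suml linear_sum aval_sum.
by apply: eq_bigr => q _; rewrite clZl linearZ avalZ /= mxE.
Qed.

Lemma bv_act_alt_is_linear B : linear (bv_act_alt B).
Proof.
move=> c w h; rewrite /bv_act_alt scalerA mulrC -scalerA -scalerDr; congr (_ *: _).
rewrite scaler_sumr -big_split; apply: eq_bigr => p _ /=.
by rewrite !linearP.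
Qed.
HB.instance Definition _ B :=
  GRing.isLinear.Build C V V *:%R (bv_act_alt B) (bv_act_alt_is_linear B).

Lemma sum_gpair_basis (A : 'M[C]_(m + m)) a :
  \sum_p gpair (gbasis R p) a *: row p A = a *m gram C m *m A.
Proof.
rewrite -[X in X *m A]mulmx1 -[X in _ *m X *m A]trmx1 -sum_gpair_row.
by apply: eq_bigr => p _; rewrite row1.
Qed.

(** Each of the two factors of a product [e_p . e_q] contributes one half of the
    commutator, by skewness. *)
Lemma bv_act_cl B a w : B^T = - B ->
  bv_act_alt B (cl a w) = cl a (bv_act_alt B w) + cl (a *m bv_mx B) w.
Proof.
move=> Bskew; rewrite /bv_act_alt [cl a (_ *: _)]linearZ /= [cl a (\sum_p _)]linear_sum.
rewrite -[cl (a *m bv_mx B) w]scale_half_double.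
rewrite -scalerDr; congr (_ *: _).
apply/eqP; rewrite [X in _ == X]addrC -subr_eq -sumrB; apply/eqP.
transitivity (\sum_p (- gpair (gbasis R p) a *: cl (row p B) w
                + gpair (row p B) a *: cl (gbasis R p) w)).
  apply: eq_bigr => p _; rewrite [cl (row p B) (cl a w)]cl_swap.
  rewrite linearB linearZ /= [cl a (cl (gbasis R p) _)]cl_swap (gpairC a).
  by rewrite opprB addrA subrK scaleNr addrC.
rewrite big_split /=; congr (_ + _).
  under eq_bigr do rewrite scaleNr -clZl; rewrite sumrN -cl_suml sum_gpair_basis.
  by rewrite -clNl -mulmxN -Bskew -mulmxA.
under eq_bigr do rewrite -clZl; rewrite -cl_suml; congr (cl _ _).
under eq_bigr => p _ do rewrite -[gbasis R p]row1.
by rewrite sum_gpair_row mulmx1 mulmxA.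
Qed.

(** A bivector in the second exterior power of the range of [1 - P]. *)
Definition bv_in P B := B^T = - B /\ B *m (1%:M - P) = B.

Lemma bv_mx_im P B a : bv_in P B -> im (1%:M - P) (a *m bv_mx B).
Proof.
by move=> [Bs BQ]; rewrite /im /= -!mulmxA /bv_mx Bs mulNmx BQ.
Qed.

Lemma bv_mx0 P B a : polar P -> bv_in P B -> im (1%:M - P) a -> a *m bv_mx B = 0.
Proof.
move=> pP [Bs BQ] aQ; apply/rowP => j; rewrite [RHS]mxE.
rewrite -[RHS](im_isotropic (polarC pP) aQ (b := row j B)); last first.
  by rewrite /im /= -row_mul BQ.
rewrite gpairE tr_row colE mulmxA -colE [RHS]mxE /bv_mx mulmxA.
by [].
Qed.

Lemma bv_in_row P B p : bv_in P B -> im (1%:M - P) (row p B).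
Proof. by move=> [_ BQ]; rewrite /im /= -row_mul BQ. Qed.

(** A bivector of the complementary subspace acts by products of elements of that
    subspace, although it is given in the standard frame. *)
Lemma bv_act_im P B w : bv_in P B ->
  bv_act_alt B w = 2^-1 *: \sum_p cl (row p (1%:M - P)) (cl (row p B) w).
Proof.
move=> [Bs BQ]; rewrite /bv_act_alt; congr (_ *: _).
have QB : (1%:M - P)^T *m B = B.
  by apply: oppr_inj; rewrite -mulmxN -Bs -trmx_mul BQ.
rewrite -[in RHS](mulmx1 (1%:M - P)) sum_cl_row QB.
by apply: eq_bigr => p _; rewrite row1.
Qed.

Lemma cofil_bv P B i w : polar P -> bv_in P B -> cofil P i w ->
  cofil P i.+2 (bv_act_alt B w).
Proof.
move=> pP BP wi; rewrite (bv_act_im _ BP); apply: cofilZ; apply: fil_sum => p _.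
have pQ := polarC pP.
apply: cofil_up; first exact: (im_frame p pQ).
by apply: cofil_up => //; exact: bv_in_row.
Qed.

Lemma lev_bv P B j w : polar P -> bv_in P B -> lev P j w ->
  lev P j.+2 (bv_act_alt B w).
Proof.
move=> pP BP wi; rewrite (bv_act_im _ BP); apply: levZ; apply: lev_sum => p _.
have pQ := polarC pP.
apply: lev_up => //; first exact: (im_frame p pQ).
by apply: lev_up => //; exact: bv_in_row.
Qed.

Lemma lev_comp_bv P B j w : polar P -> bv_in P B ->
  lev_comp P (bv_act_alt B w) j.+2 = bv_act_alt B (lev_comp P w j).
Proof.
move=> pP BP.
pose c l : V := if l is l'.+2 then bv_act_alt B (lev_comp P w l') else 0.
rewrite (@lev_comp_unique _ _ P c m.+3) //.
- case: ltnP => // mj; have /lev_big -> // := lev_comp_lev w j pP.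
  by rewrite linear0.
- move=> [|[|l]] /=; [exact: lev_zero|exact: lev_zero|].
  by apply: lev_bv => //; exact: lev_comp_lev.
- rewrite {1}(lev_comp_sum w pP) linear_sum.
  rewrite [RHS]big_ord_recl [X in _ + X]big_ord_recl !add0r.
  by apply: eq_bigr.
Qed.

Definition bv_exp_alt B w : V :=
  \sum_(k < m.+1) (k`!%:R)^-1 *: iter k (bv_act_alt B) w.

Lemma bv_exp_altE B w s : bv_exp B w s = bv_exp_alt B w s.
Proof.
rewrite /bv_exp /bv_exp_alt aval_sum; apply: eq_bigr => k _.
rewrite avalZ; congr (_ * _).
suff -> : iter k (bv_cliff B) w = iter k (bv_act_alt B) w by [].
elim: (nat_of_ord k) => //= l ->; apply/funext => t; exact: bv_act_altE.
Qed.

Lemma iter_linear (f : {linear V -> V}) k c w h :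
  iter k f (c *: w + h) = c *: iter k f w + iter k f h.
Proof. by elim: k => //= k ->; rewrite linearP. Qed.

Lemma bv_exp_alt_is_linear B : linear (bv_exp_alt B).
Proof.
move=> c w h; rewrite /bv_exp_alt scaler_sumr -big_split; apply: eq_bigr => k _ /=.
by rewrite iter_linear scalerDr !scalerA mulrC.
Qed.
HB.instance Definition _ B :=
  GRing.isLinear.Build C V V *:%R (bv_exp_alt B) (bv_exp_alt_is_linear B).

Lemma cofil_iter P B k i w : polar P -> bv_in P B -> cofil P i w ->
  cofil P (i + k.*2) (iter k (bv_act_alt B) w).
Proof.
move=> pP BP wi; elim: k => [|k IHk]; first by rewrite addn0.
by rewrite doubleS !addnS; exact: cofil_bv.
Qed.

(** The commutator [b] of [bv_act_alt B] with [a] commutes with [bv_act_alt B]; hence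
    the exponential conjugates [a] into [a + b]. *)
Lemma bv_exp_cl P B a w : polar P -> bv_in P B ->
  bv_exp_alt B (cl a w) = cl (a + a *m bv_mx B) (bv_exp_alt B w).
Proof.
move=> pP BP; set b := a *m bv_mx B.
have bQ : im (1%:M - P) b by exact: bv_mx_im.
have bb h : bv_act_alt B (cl b h) = cl b (bv_act_alt B h).
  by rewrite bv_act_cl ?(proj1 BP) // (bv_mx0 pP) // cl0l addr0.
have it k : iter k (bv_act_alt B) (cl a w) =
    cl a (iter k (bv_act_alt B) w) + k%:R *: cl b (iter k.-1 (bv_act_alt B) w).
  elim: k => [|k IHk]; first by rewrite scale0r addr0.
  rewrite iterS IHk linearD linearZ /= bv_act_cl ?(proj1 BP) // -addrA; congr (_ + _).
  rewrite bb mulrSr scalerDl scale1r addrC; congr (_ + _).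
  by case: k {IHk} => [|k] //=; rewrite !scale0r.
rewrite clDl {1}/bv_exp_alt; under eq_bigr do rewrite it scalerDr.
rewrite big_split /=; congr (_ + _).
  by rewrite linear_sum; apply: eq_bigr => k _; rewrite linearZ.
rewrite big_ord_recl scale0r scaler0 add0r /bv_exp_alt big_ord_recr /= linearD.
rewrite [X in _ = _ + X](_ : _ = 0) ?addr0; last first.
  rewrite linearZ /=; suff -> : cl b (iter m (bv_act_alt B) w) = 0 by rewrite scaler0.
  apply: (@cofil_big _ _ P m.*2.+1); last by rewrite ltnS -addnn leq_addr.
  by apply: cofil_up => //; rewrite -[m.*2]add0n; apply: cofil_iter => //; exact: cofil0.
rewrite linear_sum; apply: eq_bigr => k _; rewrite scalerA linearZ /=; congr (_ *: _).
rewrite /bump /= add1n factS natrM invfM mulrAC mulVf ?mul1r //.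
Qed.

(** The next two lemmas isolate the terms of degree 0 and 1 of the exponential: the
    other ones raise the level by 2 and 4 at least. *)
Lemma cofil_exp1 P B i w : polar P -> bv_in P B -> cofil P i w ->
  cofil P i.+2 (bv_exp_alt B w - w).
Proof.
move=> pP BP wi; rewrite /bv_exp_alt big_ord_recl fact0 invr1 scale1r /= addrAC subrr add0r.
apply: fil_sum => k _; apply: filZ.
apply: (@cofil_leq _ _ _ _ (i + k.+1.*2)); last exact: (@cofil_iter _ _ k.+1).
by rewrite doubleS !addnS !ltnS leq_addr.
Qed.

Lemma cofil_exp2 P B i w : polar P -> bv_in P B -> cofil P i w ->
  cofil P i.+4 (bv_exp_alt B w - w - bv_act_alt B w).
Proof.
move=> pP BP wi; rewrite /bv_exp_alt big_ord_recl fact0 invr1 scale1r /=.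
rewrite [w + _ - w]addrAC subrr add0r.
(* For m = 0 the truncated series has no linear term, but then B acts by 0. *)
have [m0|m0] := posnP m.
  have -> : bv_act_alt B w = 0.
    by apply: (cofil_big (cofil_bv pP BP wi)); rewrite m0.
  rewrite subr0 big1 => [|k _]; first exact: fil_zero.
  by have := ltn_ord k; rewrite {2}m0.
pose F k := ((bump 0 k)`!%:R)^-1 *: bv_act_alt B (iter k (bv_act_alt B) w).
rewrite (eq_bigr (fun k : 'I_m => F k)) //.
have -> : \sum_(k < m) F k = F 0 + \sum_(1 <= k < m) F k.
  by rewrite -(big_mkord xpredT F) big_ltn.
have -> : F 0 = bv_act_alt B w.
  by rewrite /F (_ : (bump 0 0)`! = 1%N) // invr1 scale1r.
rewrite addrAC subrr add0r.
rewrite big_nat; apply: fil_sum => k /andP[k1 _]; apply: filZ.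
apply: (@cofil_leq _ _ _ _ (i + k.+1.*2)); last exact: (@cofil_iter _ _ k.+1).
by case: k k1 => // k _; rewrite !doubleS !addnS !ltnS leq_addr.
Qed.

(** The exponential is unipotent: by [cofil_exp1] its kernel lies in all the steps
    of the finite filtration [cofil]. *)
Lemma bv_exp_inj P B w : polar P -> bv_in P B -> bv_exp_alt B w = 0 -> w = 0.
Proof.
move=> pP BP w0; apply: (@cofil_big _ _ P m.+1) => //.
elim: m.+1 => [|k IHk]; first exact: cofil0.
apply: (@cofil_leq _ _ _ _ k.+2) => //; have := cofil_exp1 pP BP IHk.
by rewrite w0 sub0r => /filN; rewrite opprK.
Qed.

(** Successive approximation along the finite filtration [cofil]. *)
Lemma bv_exp_surj P B i w : polar P -> bv_in P B -> cofil P i w ->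
  exists2 u, cofil P i u & bv_exp_alt B u = w.
Proof.
move=> pP BP; move: {2}(m.+1 - i)%N (leqnn (m.+1 - i)) => d.
elim: d i w => [|d IHd] i w.
  rewrite leqn0 subn_eq0 => mi wi; have w0 := cofil_big wi mi.
  by exists 0; rewrite ?linear0 //; exact: fil_zero.
move=> id wi; have [||u ui uE] := IHd i.+1 (bv_exp_alt B w - w).
- by move: id; rewrite subnS; case: (m.+1 - i)%N.
- by apply: (@cofil_leq _ _ _ _ i.+2) => //; exact: cofil_exp1.
exists (w - u); first by apply: cofilB => //; exact: cofil_leq ui.
by rewrite linearB /= uE opprB addrC subrK.
Qed.

(** The exponential intertwines the Clifford actions of the subspace [L] and of its
    shear [L'], hence identifies the two filtrations. *)
Lemma fil_exp P B (L L' : set E) k w : polar P -> bv_in P B ->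
  (forall a, L' a <-> exists2 b, L b & b + b *m bv_mx B = a) ->
  fil L k w <-> fil L' k (bv_exp_alt B w).
Proof.
move=> pP BP LL'; elim: k w => [|k IHk] w /=.
  by split=> [->|]; [rewrite linear0|exact: (bv_exp_inj pP BP)].
split=> [H a /LL'[b Lb <-]|H b Lb].
  by rewrite -(bv_exp_cl _ _ pP) //; apply/IHk; exact: H.
by apply/IHk; rewrite (bv_exp_cl _ _ pP) //; apply: H; apply/LL'; exists b.
Qed.

End Bivectors.

(** * Generalized complex structures at a point *)

Section Structures.
Variables (R : realType) (m : nat).
Local Notation C := R[i].
Local Notation E := (gvec R m).
Local Notation V := (aform R m).
Local Notation alternating := Defs.alternating.
Local Notation I := (0 +i* 1 : C).
Implicit Types (P B : 'M[C]_(m + m)) (J : 'M[R]_(m + m)) (a b : E) (w h : V).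

(** The projector onto the [+i]-eigenspace along the [-i]-eigenspace. *)
Definition proj_gcs J : 'M[C]_(m + m) := 2^-1 *: (1%:M - I *: cplx_mx J).

Definition gcs_at J := J *m J = - 1%:M /\
  forall a b : 'rV[R]_(m + m), gpair (a *m J) (b *m J) = gpair a b.

Lemma sqrI : I * I = -1.
Proof.
by apply/eqP; rewrite eq_complex /= !mul0r !mulr1 !mul1r sub0r addr0 oppr0 !eqxx.
Qed.

Lemma cplx_sqr J : J *m J = - 1%:M -> cplx_mx J *m cplx_mx J = - 1%:M.
Proof. by move=> JJ; rewrite -map_mxM JJ map_mxN map_mx1. Qed.

Lemma cplx_gram : cplx_mx (gram R m) = gram C m.
Proof. by rewrite /cplx_mx map_block_mx !map_mx0 !map_mx1. Qed.

Lemma gcs_skew J : gcs_at J -> cplx_mx J *m gram C m = - (gram C m *m (cplx_mx J)^T).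
Proof.
move=> [JJ Jp].
have JgJ : J *m gram R m *m J^T = gram R m.
  apply/matrixP => p q; rewrite -gpair_rows !rowE Jp -!row1 gpair_rows.
  by rewrite trmx1 mulmx1 mul1mx.
have cJgJ : cplx_mx J *m gram C m *m (cplx_mx J)^T = gram C m.
  by rewrite -cplx_gram /cplx_mx matrix.map_trmx -!map_mxM JgJ.
rewrite -{1}cJgJ !mulmxA cplx_sqr // -!mulmxA mulNmx mul1mx.
by [].
Qed.

Lemma polar_gcs J : gcs_at J -> polar (proj_gcs J).
Proof.
move=> gJ; have cJJ := cplx_sqr (proj1 gJ); have cJg := gcs_skew gJ.
have half2 : 2^-1 * 2^-1 + 2^-1 * 2^-1 = 2^-1 :> C by rewrite [RHS]splitr.
rewrite /proj_gcs; split.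
  rewrite scalerBr scalerA mulmxBl !mulmxBr -!scalemxAl -!scalemxAr cJJ.
  rewrite !mul1mx mulmx1 !scalerA scalerN -scaleNr.
  have -> : - (2^-1 * I * (2^-1 * I)) = 2^-1 * 2^-1 by rewrite mulrACA sqrI mulrN1 opprK.
  rewrite opprB addrACA -scalerDl half2 -opprD -scalerDl.
  by rewrite mulrA [2^-1 * I * _]mulrAC -mulrDl half2.
rewrite -scalemxAl mulmxBl mul1mx -scalemxAl cJg.
have -> : 1%:M - 2^-1 *: (1%:M - I *: cplx_mx J) = 2^-1 *: (1%:M + I *: cplx_mx J).
  apply: (addIr (2^-1 *: (1%:M - I *: cplx_mx J))).
  rewrite subrK -scalerDr addrACA subrr addr0.
  by rewrite scale_half_double.
have -> : (2^-1 *: (1%:M + I *: cplx_mx J))^T = 2^-1 *: (1%:M + I *: (cplx_mx J)^T).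
  by apply/matrixP => p q; rewrite !mxE [q == p]eq_sym.
by rewrite -scalemxAr mulmxDr mulmx1 scalerN opprK -scalemxAr.
Qed.

Lemma Lplus_im J : Lplus J = im (proj_gcs J).
Proof.
apply/seteqP; split=> a; rewrite /Lplus /im /proj_gcs /=;
  rewrite -scalemxAr mulmxBr mulmx1 -scalemxAr.
  move=> ->; rewrite scalerA sqrI scaleN1r opprK.
  by rewrite scale_half_double.
move=> /(congr1 (fun v => 2%:R *: v)); rewrite scalerA mulfV ?pnatr_eq0 // scale1r.
move=> /(congr1 (fun v => I *: v)); rewrite scalerBr !scalerA sqrI scaleN1r opprK.
by rewrite addrC mulr_natr mulr2n scalerDl => /addIr.
Qed.

Lemma Lstar_im J : Lstar J = im (1%:M - proj_gcs J).
Proof.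
have LstarE a : Lstar J a <-> a *m cplx_mx J = - (I *: a).
  rewrite /Lstar /Lplus /=.
  have cc (A : 'M[R]_(m + m)) b : conj_mx (b *m cplx_mx A) = conj_mx b *m cplx_mx A.
    rewrite /conj_mx map_mxM; congr (_ *m _); apply/matrixP => p q; rewrite !mxE.
    exact: conjc_real.
  have cI b : conj_mx (I *: b) = - (I *: conj_mx b).
    apply/rowP => p; rewrite !mxE rmorphM /= -mulNr; congr (_ * _).
    by apply/eqP; rewrite eq_complex /= oppr0 !eqxx.
  have cK b : conj_mx (conj_mx b) = b by apply/rowP => p; rewrite !mxE conjcK.
  have cN b : conj_mx (- b) = - conj_mx b by rewrite /conj_mx map_mxN.
  rewrite -cc; split => [/(congr1 (@conj_mx _ _ _))|->]; first by rewrite cK cI cK.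
  by rewrite cN cI opprK.
apply/seteqP; split=> a; rewrite LstarE /im /proj_gcs /=;
  rewrite mulmxBr mulmx1 -scalemxAr mulmxBr mulmx1 -scalemxAr.
  move=> ->; rewrite scalerN scalerA sqrI scaleN1r !opprK subrr scaler0 subr0.
  by [].
move/eqP; rewrite subr_eq addrC -subr_eq subrr eq_sym scaler_eq0 invr_eq0 pnatr_eq0 /=.
rewrite subr_eq0 => /eqP {2}->; rewrite scalerA sqrI scaleN1r opprK.
by [].
Qed.

Lemma foldr_cliff (r : V) (s : seq E) :
  foldr (@cliff R m) r s = foldr cl r s :> (seq 'rV[C]_m -> C).
Proof. by elim: s => //= a s ->. Qed.

Lemma lev0P P w : polar P -> (forall a, im P a -> cl a w = 0) <-> lev P 0 w.
Proof.
move=> pP; split=> [w0|[_ w1] a aP]; last exact: w1.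
split; last by move=> a /w0.
by rewrite scale0r /num_op big1 // => p _; rewrite w0 ?linear0 //; exact: im_frame.
Qed.

Lemma pure_spinorP J (r : seq 'rV[C]_m -> C) : gcs_at J ->
  pure_spinor J r <-> exists2 h : V, lev (proj_gcs J) 0 h & r = h.
Proof.
move=> gJ; have pP := polar_gcs gJ; split=> [[ar r0]|[h /(lev0P _ pP) h0 ->]].
  exists (AForm ar) => //; apply/lev0P => // a aP; apply/aformP => s.
  by apply: r0; rewrite Lplus_im.
split=> [|a]; first exact: avalP.
by rewrite Lplus_im => /h0 e s; rewrite -[LHS]/(cl a h s) e.
Qed.

(** The analogue of [spin_repr] for alternating forms. *)
Definition word_sum P k (N : nat) (a : 'I_N -> k.-tuple E) (r : 'I_N -> V) w :=
  [/\ forall q j, im (1%:M - P) (tnth (a q) j), forall q, lev P 0 (r q)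
    & w = \sum_q foldr cl (r q) (a q)].

Lemma spin_reprP J k N (a : 'I_N -> k.-tuple E) (rho : 'I_N -> seq 'rV[C]_m -> C)
    (w : seq 'rV[C]_m -> C) : gcs_at J ->
  spin_repr J a rho w <-> exists r h,
    [/\ word_sum (proj_gcs J) a r h, forall q, rho q = r q & w = h].
Proof.
move=> gJ; split=> [[aJ rJ ->]|[r [h [[aP rP ->] rE ->]]]]; last first.
  split=> [q j|q|].
  - by rewrite Lstar_im.
  - by apply/pure_spinorP => //; exists (r q).
  - apply/funext => s; rewrite aval_sum; apply: eq_bigr => q _.
    by rewrite rE foldr_cliff.
have rE q : rho q = to_aform (rho q) by rewrite to_aformE //; case: (rJ q).
exists (fun q => to_aform (rho q)), (\sum_q foldr cl (to_aform (rho q)) (a q)).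
split=> //; last first.
  apply/funext => s; rewrite aval_sum; apply: eq_bigr => q _.
  by rewrite {1}rE foldr_cliff.
split=> // q; first by move=> j; have := aJ q j; rewrite Lstar_im.
by have /(pure_spinorP _ gJ)[h h0 ->] := rJ q; rewrite avalK.
Qed.

Lemma lev_word P r (s : seq E) : polar P -> lev P 0 r ->
  (forall a, a \in s -> im (1%:M - P) a) -> lev P (size s) (foldr cl r s).
Proof.
move=> pP r0; elim: s => //= a s IHs sP; apply: lev_up => //.
  by apply: sP; rewrite mem_head.
by apply: IHs => b bs; apply: sP; rewrite inE bs orbT.
Qed.

Lemma word_sum_lev P k N (a : 'I_N -> k.-tuple E) (r : 'I_N -> V) w : polar P ->
  word_sum P a r w -> lev P k w.
Proof.
move=> pP [aP rP ->]; apply: lev_sum => q _; rewrite -[k in lev _ k](size_tuple (a q)).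
apply: lev_word => // b /tnthP[j ->]; exact: aP.
Qed.

(** An eigenvector of eigenvalue [k + 1] is [(k + 1)^-1] times its image by
    [num_op], which expresses it by eigenvectors of eigenvalue [k]. *)
Lemma lev_word_sum P k w : polar P -> lev P k w ->
  exists N (a : 'I_N -> k.-tuple E) (r : 'I_N -> V), word_sum P a r w.
Proof.
move=> pP; elim: k w => [|k IHk] w wk.
  exists 1%N, (fun=> [tuple]), (fun=> w); split=> //; first by move=> q [].
  by rewrite big_ord1.
pose rep x := exists N (a : 'I_N -> k.+1.-tuple E) (r : 'I_N -> V), word_sum P a r x.
have : forall x : V, rep x -> rep (k.+1%:R^-1 *: x).
  move=> x [N [a [r [aP rP ->]]]]; exists N, a, (fun q => k.+1%:R^-1 *: r q); split=> //.
    by move=> q; apply: levZ.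
  rewrite scaler_sumr; apply: eq_bigr => q _.
  by elim: (tval (a q)) => //= b s <-; rewrite linearZ.
have -> : w = k.+1%:R^-1 *: \sum_p cl (coframe P p) (cl (frame P p) w).
  by rewrite -/(num_op P w) (proj1 wk) scalerA mulVf ?scale1r // pnatr_eq0.
apply; apply: (big_ind rep).
- exists 0, (fun=> [tuple of nseq k.+1 0]), (fun=> 0); split=> [[]//|[]//|].
  by rewrite big_ord0.
- move=> x y [N1 [a1 [r1 [a1P r1P ->]]]] [N2 [a2 [r2 [a2P r2P ->]]]].
  exists (N1 + N2)%N,
    (fun q => match fintype.split q with inl i => a1 i | inr i => a2 i end),
    (fun q => match fintype.split q with inl i => r1 i | inr i => r2 i end).
  split=> [q j|q|]; [by case: fintype.split|by case: fintype.split|].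
  rewrite big_split_ord; congr (_ + _); apply: eq_bigr => q _.
    by rewrite (unsplitK (inl q)).
  by rewrite (unsplitK (inr q)).
- move=> p _; have [N [a [r [aP rP wE]]]] := IHk _ (lev_down pP (im_frame p pP) wk).
  exists N, (fun q => [tuple of coframe P p :: a q]), r; split=> // [q j|].
    by case: (unliftP ord0 j) => [i|] ->; rewrite ?tnthS ?tnth0 //; exact: im_coframe.
  by rewrite wE linear_sum.
Qed.

Lemma UspaceP J k (w : seq 'rV[C]_m -> C) : gcs_at J ->
  Uspace J k w <-> exists2 h : V, lev (proj_gcs J) k h & w = h.
Proof.
move=> gJ; have pP := polar_gcs gJ; split.
  move=> [N [a [rho /(spin_reprP _ _ _ gJ) [r [h [wh _ ->]]]]]].
  by exists h => //; exact: word_sum_lev wh.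
move=> [h /(lev_word_sum pP)[N [a [r wr]]] ->].
by exists N, a, (fun q => r q); apply/spin_reprP => //; exists r, h.
Qed.

Lemma Uproj_lev_comp J k w : gcs_at J -> (k <= m)%N ->
  Uproj J k w = lev_comp (proj_gcs J) w k :> (seq 'rV[C]_m -> C).
Proof.
move=> gJ km; have pP := polar_gcs gJ; apply: xget_subset1.
  exists (fun j => lev_comp (proj_gcs J) w j); split=> // [j _|].
    by apply/UspaceP => //; exists (lev_comp (proj_gcs J) w j) => //; exact: lev_comp_lev.
  by apply/funext => s; rewrite {1}(lev_comp_sum w pP) aval_sum.
suff H u : (exists c : nat -> seq 'rV[C]_m -> C,
    [/\ forall j, (j <= m)%N -> Uspace J j (c j),
        aval w = fun s => \sum_(j < m.+1) c j s & u = c k]) ->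
    u = lev_comp (proj_gcs J) w k.
  by move=> u v /H -> /H ->.
move=> [c [cU wE ->]].
pose d j : V := if (j <= m)%N then to_aform (c j) else 0.
have dE j : (j <= m)%N -> c j = d j.
  by move=> jm; rewrite /d jm; have /(UspaceP _ _ gJ)[h _ ->] := cU j jm; rewrite avalK.
rewrite (@lev_comp_unique _ _ _ d m.+1) ?ltnS ?km ?dE //.
  move=> j; rewrite /d; case: ifP => [jm|_]; last exact: lev_zero.
  by have /(UspaceP _ _ gJ)[h hj ->] := cU j jm; rewrite avalK.
apply/aformP => s; rewrite wE aval_sum; apply: eq_bigr => j _.
by rewrite dE // -ltnS.
Qed.

(** A closed formula for the extension of [a |-> a *m F] and [g] to products
    [a_1 ... a_k . rho].  It involves no choice of a representation, so that it is
    visibly differentiable in [P], [F], [g] and [w]. *)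
Fixpoint frame_ext P F (g : V -> V) (k : nat) w : V :=
  if k is k'.+1 then
    k%:R^-1 *: \sum_p cl (coframe P p *m F) (frame_ext P F g k' (cl (frame P p) w))
  else g w.

Arguments frame_ext : simpl never.

Lemma frame_extS P F (g : V -> V) k w : frame_ext P F g k.+1 w =
  k.+1%:R^-1 *: \sum_p cl (coframe P p *m F) (frame_ext P F g k (cl (frame P p) w)).
Proof. by []. Qed.

Lemma frame_ext_lin P (F : 'M[C]_(m + m)) (g : {linear V -> V}) k c w h :
  frame_ext P F g k (c *: w + h) = c *: frame_ext P F g k w + frame_ext P F g k h.
Proof.
elim: k w h => [|k IHk] w h; first exact: linearP.
rewrite !frame_extS scalerA mulrC -scalerA -scalerDr; congr (_ *: _).
rewrite scaler_sumr -big_split; apply: eq_bigr => p _ /=.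
by rewrite linearP IHk linearP.
Qed.

Lemma frame_ext0 P (F : 'M[C]_(m + m)) (g : {linear V -> V}) k : frame_ext P F g k 0 = 0.
Proof.
have := frame_ext_lin P F g k (-1) 0 0.
by rewrite scaler0 addr0 scaleN1r addNr.
Qed.

(** Moving [a] through the annihilation operators [frame P p] produces [a *m F] once
    by duality, and [k] more times by induction, because the images under [F]
    anticommute. *)
Lemma frame_ext_cl P (F : 'M[C]_(m + m)) (g : {linear V -> V}) k a w : polar P ->
  (forall b c, im (1%:M - P) b -> im (1%:M - P) c -> gpair (b *m F) (c *m F) = 0) ->
  im (1%:M - P) a -> lev P k w ->
  frame_ext P F g k.+1 (cl a w) = cl (a *m F) (frame_ext P F g k w).
Proof.
move=> pP Fiso aQ; elim: k w => [|k IHk] w wk.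
  rewrite frame_extS invr1 scale1r -[in RHS](sum_gpair_frame pP aQ) mulmx_suml cl_suml.
  apply: eq_bigr => p _; rewrite cl_swap.
  have -> : cl (frame P p) w = 0 by apply: (proj2 (lev0P w pP)) => //; exact: im_frame.
  by rewrite linear0 subr0 -scalemxAl clZl /frame_ext !linearZ.
have FEl x y z : frame_ext P F g k.+1 (x *: y - z) =
    x *: frame_ext P F g k.+1 y - frame_ext P F g k.+1 z.
  rewrite frame_ext_lin -[- z]addr0 -(scaleN1r z) frame_ext_lin frame_ext0.
  by rewrite addr0 scaleN1r.
rewrite frame_extS.
under eq_bigr => p _.
  rewrite cl_swap FEl (IHk _ (lev_down pP (im_frame p pP) wk)).
  rewrite linearB linearZ /= [X in _ - X]cl_swap Fiso //; last exact: im_coframe.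
  rewrite scale0r sub0r opprK -clZl scalemxAl; over.
rewrite big_split /= -cl_suml -mulmx_suml (sum_gpair_frame pP aQ) -linear_sum.
set S := (X in _ + cl _ X); have SE : S = k.+1%:R *: frame_ext P F g k.+1 w.
  by rewrite frame_extS scalerA mulfV ?scale1r // pnatr_eq0.
rewrite SE; set z := frame_ext P F g k.+1 w.
have -> : cl (a *m F) (k.+1%:R *: z) = k.+1%:R *: cl (a *m F) z by exact: linearZ.
rewrite -[X in X + _]scale1r -scalerDl nat1r.
by rewrite scalerA mulVf ?scale1r // pnatr_eq0.
Qed.

Lemma frame_ext_word P (F : 'M[C]_(m + m)) (g : {linear V -> V}) r (s : seq E) : polar P ->
  (forall b c, im (1%:M - P) b -> im (1%:M - P) c -> gpair (b *m F) (c *m F) = 0) ->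
  (forall a, a \in s -> im (1%:M - P) a) -> lev P 0 r ->
  frame_ext P F g (size s) (foldr cl r s) = foldr cl (g r) [seq a *m F | a <- s].
Proof.
move=> pP Fiso + r0; elim: s => //= a s IHs sP.
have sQ b : b \in s -> im (1%:M - P) b by move=> bs; apply: sP; rewrite inE bs orbT.
rewrite -[LHS]/(frame_ext P F g (size s).+1 (cl a _)) frame_ext_cl ?IHs //.
  by apply: sP; rewrite mem_head.
exact: lev_word.
Qed.

(** By [frame_ext_word] all representations give the same value, so the choice made
    by [spin_ext] does not matter. *)
Lemma spin_ext_frame J (F : 'M[C]_(m + m)) (f : E -> E)
    (g : (seq 'rV[C]_m -> C) -> seq 'rV[C]_m -> C) (g' : {linear V -> V}) k w :
  gcs_at J -> (forall a, f a = a *m F) -> (forall h : V, g h = g' h) ->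
  (forall b c, Lstar J b -> Lstar J c -> gpair (b *m F) (c *m F) = 0) ->
  lev (proj_gcs J) k w ->
  spin_ext J f g k w = frame_ext (proj_gcs J) F g' k w :> (seq 'rV[C]_m -> C).
Proof.
move=> gJ fE gE; rewrite Lstar_im => Fiso wk; have pP := polar_gcs gJ.
have val N (a : 'I_N -> k.-tuple E) (r : 'I_N -> V) :
    word_sum (proj_gcs J) a r w ->
    (fun s => \sum_q foldr (@cliff R m) (g (r q)) [seq f b | b <- a q] s) =
    frame_ext (proj_gcs J) F g' k w.
  move=> [aP rP wE]; apply/funext => s.
  have FEs (I' : Type) (t : seq I') (h : I' -> V) :
      frame_ext (proj_gcs J) F g' k (\sum_(i <- t) h i) =
      \sum_(i <- t) frame_ext (proj_gcs J) F g' k (h i).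
    elim: t => [|i t IHt]; first by rewrite !big_nil frame_ext0.
    by rewrite !big_cons -[h i]scale1r frame_ext_lin IHt !scale1r.
  rewrite wE FEs aval_sum; apply: eq_bigr => q _.
  rewrite gE (eq_map fE) foldr_cliff -(frame_ext_word g' pP Fiso) ?size_tuple //.
  by move=> b /tnthP[j ->]; exact: aP.
apply: xget_subset1.
  have [N [a [r wr]]] := lev_word_sum pP wk.
  exists N, a, (fun q => r q); split; last by rewrite val.
  by apply/spin_reprP => //; exists r, w.
suff H u : (exists N (a : 'I_N -> k.-tuple E) (rho : 'I_N -> seq 'rV[C]_m -> C),
    spin_repr J a rho w /\
    u = fun s => \sum_q foldr (@cliff R m) (g (rho q)) [seq f b | b <- a q] s) ->
    u = frame_ext (proj_gcs J) F g' k w.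
  by move=> u v /H -> /H ->.
move=> [N [a [rho [/(spin_reprP _ _ _ gJ)[r [h [wr rE /aval_inj whE]]] ->]]]].
rewrite -whE in wr; rewrite -(val _ _ _ wr); apply/funext => s.
by apply: eq_bigr => q _; rewrite rE.
Qed.

End Structures.

(** * Conjugation by the exponential up to lower order *)

Section Graded.
Variables (R : realType) (m : nat).
Local Notation C := R[i].
Local Notation E := (gvec R m).
Local Notation V := (aform R m).
Implicit Types (P B : 'M[C]_(m + m)) (a b : E) (w h : V).

Lemma frame_ext_lev P P' (F : 'M[C]_(m + m)) (g : V -> V) k w : polar P -> polar P' ->
  (forall a, im (1%:M - P) a -> im (1%:M - P') (a *m F)) ->
  (forall h, lev P 0 h -> lev P' 0 (g h)) ->
  lev P k w -> lev P' k (frame_ext P F g k w).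
Proof.
move=> pP pP' FQ g0; elim: k w => [|k IHk] w wk; first exact: g0.
rewrite frame_extS; apply: levZ; apply: lev_sum => p _; apply: lev_up => //.
  by apply: FQ; exact: im_coframe.
by apply: IHk; apply: lev_down => //; exact: im_frame.
Qed.

(** Conjugating by the exponential turns the shear of [L^*] by [epsstar] into
    [1 - eps epsstar] plus a term in [L], and [L] lowers the filtration. *)
Lemma frame_ext_exp P B Bs k w : polar P -> bv_in P B -> bv_in (1%:M - P) Bs ->
  lev P k w ->
  exists2 h, fil (im P) k h &
    frame_ext P (1%:M + bv_mx Bs) (bv_exp_alt B) k w =
    bv_exp_alt B (frame_ext P (1%:M - bv_mx Bs *m bv_mx B) idfun k w + h).
Proof.
move=> pP BP BsP.
have QK : 1%:M - (1%:M - P) = P by rewrite opprB addrC subrK.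
have BsL a : im P (a *m bv_mx Bs) by rewrite -{1}QK; exact: bv_mx_im.
have BQ a : im (1%:M - P) (a *m bv_mx B) by exact: bv_mx_im.
have FQ a : im (1%:M - P) a -> im (1%:M - P) (a *m (1%:M - bv_mx Bs *m bv_mx B)).
  move=> aQ; rewrite mulmxBr mulmx1 mulmxA /im /= mulmxBl.
  by congr (_ - _); [exact: aQ|exact: BQ].
elim: k w => [|k IHk] w wk.
  by exists 0; [exact: fil_zero|rewrite addr0].
have /choice[h hP] p : exists h, fil (im P) k h /\
    frame_ext P (1%:M + bv_mx Bs) (bv_exp_alt B) k (cl (frame P p) w) =
    bv_exp_alt B (frame_ext P (1%:M - bv_mx Bs *m bv_mx B) idfun k (cl (frame P p) w) + h).
  by have [h ? ?] := IHk _ (lev_down pP (im_frame p pP) wk); exists h.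
pose T p := frame_ext P (1%:M - bv_mx Bs *m bv_mx B) idfun k (cl (frame P p) w).
exists (k.+1%:R^-1 *: \sum_p (cl (coframe P p *m bv_mx Bs) (T p + h p) +
     cl (coframe P p *m (1%:M - bv_mx Bs *m bv_mx B)) (h p))).
  apply: filZ; apply: fil_sum => p _; apply: filD; last by apply: fil_clS; case: (hP p).
  apply: filS; have Tp : lev P k (T p).
    apply: (frame_ext_lev (g := idfun) pP pP) => //.
    by apply: lev_down => //; exact: im_frame.
  have : fil (im P) k.+1 (T p + h p).
    by apply: filD; [exact: (proj2 Tp)|apply: filS; case: (hP p)].
  by apply; exact: BsL.
rewrite !frame_extS -scalerDr [bv_exp_alt B (_ *: _)]linearZ /= -big_split.
rewrite [bv_exp_alt B (\sum_p _)]linear_sum; congr (_ *: _).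
apply: eq_bigr => p _; have [_ ->] := hP p; rewrite -/(T p) /=.
set b := coframe P p; have bQ : im (1%:M - P) b by exact: im_coframe.
have -> : cl (b *m (1%:M - bv_mx Bs *m bv_mx B)) (T p) +
    (cl (b *m bv_mx Bs) (T p + h p) + cl (b *m (1%:M - bv_mx Bs *m bv_mx B)) (h p)) =
    cl (b *m (1%:M - bv_mx Bs *m bv_mx B) + b *m bv_mx Bs) (T p + h p).
  by rewrite clDl [X in _ = X + _]linearD -addrA; congr (_ + _); rewrite addrC.
rewrite (bv_exp_cl _ _ pP BP); congr (cl _ _).
have z : b *m (1%:M - bv_mx Bs *m bv_mx B) *m bv_mx B = 0.
  by apply: (bv_mx0 pP BP); exact: FQ.
rewrite mulmxDl z add0r mulmxDr mulmx1 mulmxBr mulmx1 mulmxA.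
by rewrite !mulmxA [RHS]addrAC subrK.
Qed.

(** Stands for the computation of the component of level [k + 1] of
    [e^-B d e^B tau], where [x], [y] and [z] are the differentials of [tau], [B tau]
    and of the rest of [e^B tau]: all the products of higher order raise the level
    too much to contribute. *)
Lemma lev_comp_exp_inv P B k (x y z : V) : polar P -> bv_in P B ->
  cofil P k.-1 x -> cofil P k.+1 y -> cofil P k.+3 z ->
  exists2 u, bv_exp_alt B u = x + y + z &
    lev_comp P u k.+1 = lev_comp P (x + y) k.+1 - lev_comp P (bv_act_alt B x) k.+1.
Proof.
move=> pP BP xk yk zk.
have wk : cofil P k.-1 (x + y + z).
  apply: cofilD; [apply: cofilD => //|]; [apply: cofil_leq yk|apply: cofil_leq zk];
  by rewrite (leq_trans (leq_pred _)) // leqW // leqW // leqW.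
have [u uk uE] := bv_exp_surj pP BP wk; exists u => //.
have lz h : cofil P k.+2 h -> lev_comp P h k.+1 = 0.
  by move=> hk; apply: (cofil_comp0 pP hk).
have k4 : (k.+2 <= k.-1.+4)%N by case: k {xk yk zk wk uk lz}.
have e1 : lev_comp P (bv_exp_alt B u - u - bv_act_alt B u) k.+1 = 0.
  by apply: lz; apply: cofil_leq (cofil_exp2 pP BP uk).
have e2 : lev_comp P (bv_act_alt B (bv_exp_alt B u - u)) k.+1 = 0.
  by apply: lz; apply: cofil_leq (cofil_bv pP BP (cofil_exp1 pP BP uk)).
have e3 : lev_comp P (bv_act_alt B (y + z)) k.+1 = 0.
  apply: lz; apply: (@cofil_leq _ _ _ _ k.+3) => //; apply: cofil_bv => //.
  by apply: cofilD => //; apply: cofil_leq zk; do 2 apply: leqW.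
have e4 : lev_comp P z k.+1 = 0 by apply: lz; apply: cofil_leq zk.
move: e1 e2 e3; rewrite uE !lev_compB // !linearB !linearD /=.
rewrite !lev_compB // !lev_compD // e4 addr0.
set a := lev_comp P u _; set b := lev_comp P x _; set c := lev_comp P y _.
set d := lev_comp P (bv_act_alt B u) _; set e := lev_comp P (bv_act_alt B x) _.
move=> /eqP; rewrite subr_eq0 => /eqP e1; rewrite -[e + _ + _]addrA.
move=> + e3; rewrite e3 addr0 => /eqP; rewrite subr_eq0 => /eqP ->.
by rewrite -e1 opprB addrC subrK.
Qed.

End Graded.

(** * Partial derivatives of complex functions *)

Section Derivations.
Variables (R : realType) (m : nat).
Local Notation C := R[i].
Implicit Types (f g : 'rV[R]_m -> C) (y : 'rV[R]_m) (U : set 'rV[R]_m).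

(** Existence of the partial derivatives, which is all that the first-order
    computations below use. *)
Definition cdiff f y := forall j : 'I_m,
  derivable (fun z => complex.Re (f z)) y (basis_vec R j) /\
  derivable (fun z => complex.Im (f z)) y (basis_vec R j).

Let ReD (x y : C) : complex.Re (x + y) = complex.Re x + complex.Re y.
Proof. by case: x y => [a b] [c d]. Qed.
Let ImD (x y : C) : complex.Im (x + y) = complex.Im x + complex.Im y.
Proof. by case: x y => [a b] [c d]. Qed.
Let ReM (x y : C) : complex.Re (x * y) =
  complex.Re x * complex.Re y - complex.Im x * complex.Im y.
Proof. by case: x y => [a b] [c d]. Qed.
Let ImM (x y : C) : complex.Im (x * y) =
  complex.Re x * complex.Im y + complex.Im x * complex.Re y.
Proof. by case: x y => [a b] [c d]. Qed.

Lemma derivable_funD (p q : 'rV[R]_m -> R) y v : derivable p y v ->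
  derivable q y v -> derivable (fun z => p z + q z) y v.
Proof. exact: derivableD. Qed.
Lemma derivable_funB (p q : 'rV[R]_m -> R) y v : derivable p y v ->
  derivable q y v -> derivable (fun z => p z - q z) y v.
Proof. exact: derivableB. Qed.
Lemma derivable_funM (p q : 'rV[R]_m -> R) y v : derivable p y v ->
  derivable q y v -> derivable (fun z => p z * q z) y v.
Proof. exact: derivableM. Qed.
Lemma derive_funD (p q : 'rV[R]_m -> R) y v : derivable p y v ->
  derivable q y v -> 'D_v (fun z => p z + q z) y = 'D_v p y + 'D_v q y.
Proof. exact: deriveD. Qed.
Lemma derive_funB (p q : 'rV[R]_m -> R) y v : derivable p y v ->
  derivable q y v -> 'D_v (fun z => p z - q z) y = 'D_v p y - 'D_v q y.
Proof. exact: deriveB. Qed.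
Lemma derive_funM (p q : 'rV[R]_m -> R) y v : derivable p y v ->
  derivable q y v -> 'D_v (fun z => p z * q z) y = p y * 'D_v q y + q y * 'D_v p y.
Proof. exact: deriveM. Qed.

Lemma cdiff_cst (c : C) y : cdiff (fun=> c) y.
Proof. by move=> j; split; exact: derivable_cst. Qed.

Lemma partial_cst j (c : C) y : partial j (fun=> c) y = 0.
Proof. by rewrite /partial !derive_cst. Qed.

Lemma cdiffD f g y : cdiff f y -> cdiff g y -> cdiff (fun z => f z + g z) y.
Proof.
move=> df dg j; have [a b] := df j; have [c d] := dg j.
split; [under eq_fun do rewrite ReD|under eq_fun do rewrite ImD]; exact: derivable_funD.
Qed.

Lemma partialD j f g y : cdiff f y -> cdiff g y ->
  partial j (fun z => f z + g z) y = partial j f y + partial j g y.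
Proof.
move=> df dg; have [a b] := df j; have [c d] := dg j; rewrite /partial.
have -> : (fun z => complex.Re (f z + g z)) = fun z => complex.Re (f z) + complex.Re (g z).
  by apply/funext => z; rewrite ReD.
have -> : (fun z => complex.Im (f z + g z)) = fun z => complex.Im (f z) + complex.Im (g z).
  by apply/funext => z; rewrite ImD.
by rewrite !derive_funD.
Qed.

Lemma cdiffM f g y : cdiff f y -> cdiff g y -> cdiff (fun z => f z * g z) y.
Proof.
move=> df dg j; have [a b] := df j; have [c d] := dg j.
split; [under eq_fun do rewrite ReM|under eq_fun do rewrite ImM].
  by apply: derivable_funB; exact: derivable_funM.
by apply: derivable_funD; exact: derivable_funM.
Qed.

Lemma partialM j f g y : cdiff f y -> cdiff g y ->
  partial j (fun z => f z * g z) y = partial j f y * g y + f y * partial j g y.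
Proof.
move=> df dg; have [a b] := df j; have [c d] := dg j; rewrite /partial.
have -> : (fun z => complex.Re (f z * g z)) = fun z => complex.Re (f z) * complex.Re (g z)
    - complex.Im (f z) * complex.Im (g z) by apply/funext => z; rewrite ReM.
have -> : (fun z => complex.Im (f z * g z)) = fun z => complex.Re (f z) * complex.Im (g z)
    + complex.Im (f z) * complex.Re (g z) by apply/funext => z; rewrite ImM.
rewrite derive_funB; try exact: derivable_funM.
rewrite derive_funD; try exact: derivable_funM.
rewrite !derive_funM //.
case: (f y) (g y) => [p q] [r s] /=.
apply/eqP; rewrite eq_complex /=; apply/andP; split; apply/eqP; ring.
Qed.

Lemma cdiffZ (c : C) f y : cdiff f y -> cdiff (fun z => c * f z) y.
Proof. by move=> df; exact: (cdiffM (cdiff_cst c y) df). Qed.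

Lemma partialZ j (c : C) f y : cdiff f y ->
  partial j (fun z => c * f z) y = c * partial j f y.
Proof.
by move=> df; rewrite (partialM j (cdiff_cst c y) df) partial_cst mul0r add0r.
Qed.

Lemma cdiff_sum (I : Type) (r : seq I) (F : I -> 'rV[R]_m -> C) y :
  (forall i, cdiff (F i) y) -> cdiff (fun z => \sum_(i <- r) F i z) y.
Proof.
move=> dF; elim: r => [|i r IHr].
  by under eq_fun do rewrite big_nil; exact: cdiff_cst.
by under eq_fun do rewrite big_cons; exact: (cdiffD (dF i) IHr).
Qed.

Lemma partial_sum (I : Type) j (r : seq I) (F : I -> 'rV[R]_m -> C) y :
  (forall i, cdiff (F i) y) ->
  partial j (fun z => \sum_(i <- r) F i z) y = \sum_(i <- r) partial j (F i) y.
Proof.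
move=> dF; elim: r => [|i r IHr].
  by under eq_fun do rewrite big_nil; rewrite partial_cst big_nil.
under eq_fun do rewrite big_cons.
by rewrite (partialD j (dF i) (cdiff_sum r dF)) IHr big_cons.
Qed.

Lemma eq_cdiff U f g y : open U -> U y -> (forall z, U z -> f z = g z) ->
  cdiff f y -> cdiff g y.
Proof.
move=> Uo Uy fg df j; have [a b] := df j; split.
  by apply: near_eq_derivable a; near=> z; rewrite fg //; near: z; exact: open_nbhs_nbhs.
by apply: near_eq_derivable b; near=> z; rewrite fg //; near: z; exact: open_nbhs_nbhs.
Unshelve. all: by end_near. Qed.

Lemma eq_partial U j f g y : open U -> U y -> (forall z, U z -> f z = g z) ->
  partial j f y = partial j g y.
Proof.
move=> Uo Uy fg; rewrite /partial; congr (_ +i* _); apply: near_eq_derive;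
  near=> z; rewrite fg //; near: z; exact: open_nbhs_nbhs.
Unshelve. all: by end_near. Qed.

Lemma partial_conj j f y : cdiff f y ->
  partial j (fun z => conjc (f z)) y = conjc (partial j f y).
Proof.
move=> df; have [a b] := df j; rewrite /partial /=.
have -> : (fun z => complex.Re (conjc (f z))) = fun z => complex.Re (f z).
  by apply/funext => z; case: (f z).
have -> : (fun z => complex.Im (conjc (f z))) = - (fun z => complex.Im (f z)).
  by apply/funext => z; rewrite fctE; case: (f z).
by rewrite deriveN.
Qed.

End Derivations.

(** * Differentiable families of forms and the twisted differential *)

Section FormSections.
Variables (R : realType) (m : nat).
Local Notation C := R[i].
Local Notation E := (gvec R m).
Local Notation V := (aform R m).
Local Notation alternating := Defs.alternating.
Local Notation contract := Defs.contract.
Implicit Types (W : 'rV[R]_m -> V) (y : 'rV[R]_m) (U : set 'rV[R]_m).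
Implicit Types (a b : 'rV[R]_m -> E) (w : V).

Definition vdiff W y := forall s, cdiff (fun z => W z s) y.

Definition vpart (j : 'I_m) W y : V := to_aform (fun s => partial j (fun z => W z s) y).

Lemma vpartE j W y s : vdiff W y -> vpart j W y s = partial j (fun z => W z s) y.
Proof.
move=> dW; rewrite /vpart to_aformE //; split=> [s1 s2 c u v|t tu].
  have -> : (fun z => W z (s1 ++ c *: u + v :: s2)) =
      (fun z => c * W z (s1 ++ u :: s2) + W z (s1 ++ v :: s2)).
    by apply/funext => z; have [l _] := avalP (W z); exact: l.
  by rewrite partialD // ?partialZ //; exact: cdiffZ.
have -> : (fun z => W z t) = fun=> 0; last exact: partial_cst.
by apply/funext => z; have [_ l] := avalP (W z); exact: l.
Qed.

Lemma eq_vdiff U W W' y : open U -> U y -> (forall z, U z -> W z = W' z) ->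
  vdiff W y -> vdiff W' y.
Proof.
move=> Uo Uy WW dW s; apply: (eq_cdiff Uo Uy) (dW s) => z Uz.
by rewrite WW.
Qed.

Lemma eq_vpart U j W W' y : open U -> U y -> (forall z, U z -> W z = W' z) ->
  vpart j W y = vpart j W' y.
Proof.
move=> Uo Uy WW; congr (to_aform _); apply/funext => s.
by apply: (eq_partial _ Uo Uy) => z Uz; rewrite WW.
Qed.

Lemma vdiff_cst w y : vdiff (fun=> w) y.
Proof. by move=> s; exact: cdiff_cst. Qed.

Lemma vpart_cst j w y : vpart j (fun=> w) y = 0.
Proof. by apply/aformP => s; rewrite (vpartE _ _ (vdiff_cst w y)) partial_cst. Qed.

Lemma vdiffD W W' y : vdiff W y -> vdiff W' y -> vdiff (fun z => W z + W' z) y.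
Proof.
move=> dW dW' s.
have -> : (fun z => (W z + W' z) s) = fun z => W z s + W' z s.
  by apply/funext => z; rewrite avalD.
exact: (cdiffD (dW s) (dW' s)).
Qed.

Lemma vpartD j W W' y : vdiff W y -> vdiff W' y ->
  vpart j (fun z => W z + W' z) y = vpart j W y + vpart j W' y.
Proof.
move=> dW dW'; apply/aformP => s.
rewrite avalD (vpartE _ _ dW) (vpartE _ _ dW') (vpartE _ _ (vdiffD dW dW')).
have -> : (fun z => (W z + W' z) s) = fun z => W z s + W' z s.
  by apply/funext => z; rewrite avalD.
exact: (partialD j (dW s) (dW' s)).
Qed.

Lemma vdiffZ f W y : cdiff f y -> vdiff W y -> vdiff (fun z => f z *: W z) y.
Proof.
move=> df dW s.
have -> : (fun z => (f z *: W z) s) = fun z => f z * W z s.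
  by apply/funext => z; rewrite avalZ.
exact: (cdiffM df (dW s)).
Qed.

Lemma vpartZ j f W y : cdiff f y -> vdiff W y ->
  vpart j (fun z => f z *: W z) y = partial j f y *: W y + f y *: vpart j W y.
Proof.
move=> df dW; apply/aformP => s.
rewrite avalD !avalZ (vpartE _ _ dW) (vpartE _ _ (vdiffZ df dW)).
have -> : (fun z => (f z *: W z) s) = fun z => f z * W z s.
  by apply/funext => z; rewrite avalZ.
exact: (partialM j df (dW s)).
Qed.

Lemma vdiff_sum (I : Type) (r : seq I) (F : I -> 'rV[R]_m -> V) y :
  (forall i, vdiff (F i) y) -> vdiff (fun z => \sum_(i <- r) F i z) y.
Proof.
move=> dF; elim: r => [|i r IHr].
  by under eq_fun do rewrite big_nil; exact: vdiff_cst.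
by under eq_fun do rewrite big_cons; exact: (vdiffD (dF i) IHr).
Qed.

Lemma vpart_sum (I : Type) j (r : seq I) (F : I -> 'rV[R]_m -> V) y :
  (forall i, vdiff (F i) y) ->
  vpart j (fun z => \sum_(i <- r) F i z) y = \sum_(i <- r) vpart j (F i) y.
Proof.
move=> dF; elim: r => [|i r IHr].
  by under eq_fun do rewrite big_nil; rewrite vpart_cst big_nil.
under eq_fun do rewrite big_cons.
by rewrite (vpartD j (dF i) (vdiff_sum r dF)) IHr big_cons.
Qed.

Lemma cl_eval (e : E) w s : cl e w s = w (lsubmx e :: s) +
  \sum_(k < size s)
    (-1) ^+ k * (rsubmx e *m (nth 0 s k)^T) 0 0 * w (take k s ++ drop k.+1 s).
Proof. by rewrite /= /cliff one_wedgeE. Qed.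

Lemma vdiff_clc (e : E) W y : vdiff W y -> vdiff (fun z => cl e (W z)) y.
Proof.
move=> dW s; under eq_fun do rewrite cl_eval.
by apply: cdiffD => //; apply: cdiff_sum => k; exact: cdiffZ.
Qed.

Lemma vpart_clc j (e : E) W y : vdiff W y ->
  vpart j (fun z => cl e (W z)) y = cl e (vpart j W y).
Proof.
move=> dW; apply/aformP => s; rewrite vpartE; last exact: vdiff_clc.
under eq_fun do rewrite cl_eval.
rewrite partialD //; last by apply: cdiff_sum => k; exact: cdiffZ.
rewrite partial_sum; last by move=> k; exact: cdiffZ.
rewrite cl_eval !vpartE //; congr (_ + _); apply: eq_bigr => k _.
by rewrite vpartE // partialZ.
Qed.

Definition ediff a y := forall l, cdiff (fun z => a z 0 l) y.
Definition epart (j : 'I_m) a y : E := \row_l partial j (fun z => a z 0 l) y.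

(** Reduces the Leibniz rule for a variable vector to constant vectors and scalar
    coefficients. *)
Lemma cl_coord (e : E) w : cl e w = \sum_l e 0 l *: cl (gbasis R l) w.
Proof. by rewrite {1}[e]row_sum_delta cl_suml; under eq_bigr do rewrite clZl. Qed.

Lemma vdiff_cl a W y : ediff a y -> vdiff W y -> vdiff (fun z => cl (a z) (W z)) y.
Proof.
move=> da dW; under eq_fun do rewrite cl_coord.
by apply: vdiff_sum => l; exact: (vdiffZ (da l) (vdiff_clc _ dW)).
Qed.

Lemma vpart_cl j a W y : ediff a y -> vdiff W y ->
  vpart j (fun z => cl (a z) (W z)) y =
  cl (epart j a y) (W y) + cl (a y) (vpart j W y).
Proof.
move=> da dW; under eq_fun do rewrite cl_coord.
rewrite vpart_sum => [|l]; last exact: (vdiffZ (da l) (vdiff_clc _ dW)).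
rewrite !(cl_coord _ (W y)) (cl_coord (a y)) -big_split; apply: eq_bigr => l _ /=.
by rewrite (vpartZ j (da l) (vdiff_clc _ dW)) (vpart_clc j _ dW) mxE.
Qed.

Definition dx (j : 'I_m) : E := row_mx 0 (delta_mx 0 j).

Definition ext_d W y : V := \sum_j cl (dx j) (vpart j W y).

Lemma aval_vec0 w s : w (0 :: s) = 0.
Proof.
have := aval_linear w (-1) 0 0 s.
by rewrite scaler0 addr0 mulN1r addNr.
Qed.

Lemma cl_dx (j : 'I_m) w s : cl (dx j) w s =
  \sum_(k < size s) (-1) ^+ k * (nth 0 s k) 0 j * w (take k s ++ drop k.+1 s).
Proof.
rewrite cl_eval row_mxKl row_mxKr aval_vec0 add0r; apply: eq_bigr => k _.
by congr (_ * _ * _); rewrite -rowE !mxE.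
Qed.

(** [d = \sum_j dx_j /\ partial_j], so that the exterior derivative of a family of
    alternating forms is again alternating. *)
Lemma d_dRE (X : manifold R m) (sigma : Defs.field X (dform R m)) i y s :
  open (chart_img i) -> chart_img i y ->
  (forall z, chart_img i z -> alternating (sigma i z)) ->
  vdiff (fun z => to_aform (sigma i z)) y ->
  d_dR sigma i y s = ext_d (fun z => to_aform (sigma i z)) y s.
Proof.
move=> Uo Uy aS dS; rewrite /d_dR /ext_d aval_sum.
under [RHS]eq_bigr do rewrite cl_dx.
rewrite exchange_big; apply: eq_bigr => k _ /=.
rewrite /cderiv mulr_sumr; apply: eq_bigr => j _.
rewrite vpartE // mulrA; congr (_ * _).
by apply: (eq_partial _ Uo Uy) => z Uz; rewrite to_aformE //; exact: aS.
Qed.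

Definition wedge_op (x : seq 'rV[C]_m -> C) w : V := to_aform (wedge x w).

Lemma wedge_opE x w s : alternating x -> wedge_op x w s = wedge x w s.
Proof.
by move=> ax; rewrite /wedge_op to_aformE //; apply: alternating_wedge => //; exact: avalP.
Qed.

Lemma wedge_op_lin x c w w' : alternating x ->
  wedge_op x (c *: w + w') = c *: wedge_op x w + wedge_op x w'.
Proof.
move=> ax; apply/aformP => s; rewrite avalD avalZ !wedge_opE //.
exact: wedge_avalr.
Qed.

(** The commutation of [x /\ _] with Clifford multiplication is the contraction of
    [x], as 1-forms anticommute or commute with [x] according to the parity. *)
Lemma wedge_op_cl_odd x (e : E) w : alternating x -> twist x = (fun s => - x s) ->
  wedge_op x (cl e w) = wedge_op (contract (lsubmx e) x) w - cl e (wedge_op x w).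
Proof.
move=> ax xodd; have acx := alternating_contract (lsubmx e) ax.
apply/aformP => s; rewrite avalB !wedge_opE //= /cliff.
rewrite /wedge_op to_aformE; last by apply: alternating_wedge => //; exact: avalP.
rewrite contract_wedge one_wedge_comm xodd !wedgeNl [LHS]wedgeDr.
by ring.
Qed.

Lemma wedge_op_cl_even x (e : E) w : alternating x -> twist x = x ->
  wedge_op x (cl e w) = cl e (wedge_op x w) - wedge_op (contract (lsubmx e) x) w.
Proof.
move=> ax xev; have acx := alternating_contract (lsubmx e) ax.
apply/aformP => s; rewrite avalB !wedge_opE //= /cliff.
rewrite /wedge_op to_aformE; last by apply: alternating_wedge => //; exact: avalP.
rewrite contract_wedge one_wedge_comm xev [LHS]wedgeDr.
by ring.
Qed.

Definition twisted_d x W y : V := ext_d W y - wedge_op x (W y).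

(** The bracket [Y b - Z a + <d a, b> + i_Z i_Y x], where [Y] and [Z] are the vector
    parts of [a] and [b]; it differs from the Courant bracket by half the
    differential of [<a, b>], hence not at all on isotropic families. *)
Definition dorfman x a b y : E :=
  \sum_j (gpair (epart j a y) (b y) *: dx j - gpair (dx j) (b y) *: epart j a y
         + gpair (dx j) (a y) *: epart j b y)
  + row_mx 0 (\row_k x [:: lsubmx (a y); lsubmx (b y); delta_mx 0 k]).

Lemma wedge_op_one_form x (u v : 'rV[C]_m) w : alternating x ->
  (forall s, size s != 3 -> x s = 0) ->
  wedge_op (contract v (contract u x)) w =
  cl (row_mx 0 (\row_k x [:: u; v; delta_mx 0 k])) w.
Proof.
move=> ax x3; have acx := alternating_contract v (alternating_contract u ax).
apply/aformP => s; rewrite wedge_opE // cl_eval row_mxKl aval_vec0 add0r.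
rewrite -one_wedgeE row_mxKr.
have hop1 t : x [:: u; v; t] = ((\row_k x [:: u; v; delta_mx 0 k]) *m t^T) 0 0.
  rewrite mxE {1}[t]row_sum_delta.
  have xlin c (p q : 'rV[C]_m) :
      x [:: u; v; c *: p + q] = c * x [:: u; v; p] + x [:: u; v; q].
    by have [l _] := ax; exact: (l [:: u; v] [::]).
  have x0 : x [:: u; v; 0] = 0.
    by have := xlin (-1) 0 0; rewrite scaler0 addr0 mulN1r addNr.
  have xsum (r : seq 'I_m) (c : 'I_m -> C) :
      x [:: u; v; \sum_(k <- r) c k *: delta_mx 0 k] =
      \sum_(k <- r) c k * x [:: u; v; delta_mx 0 k].
    by elim: r => [|k r IHr]; rewrite ?big_nil // !big_cons xlin IHr.
  rewrite [LHS](xsum _ (fun k => t 0 k)); apply: eq_bigr => k _.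
  by rewrite !mxE mulrC.
congr (wedge _ _ _); apply/funext => -[|t [|t' s']] /=; rewrite /contract.
- exact: x3.
- exact: hop1.
- exact: x3.
Qed.
(** The contribution of a 3-form [x] to the derived bracket: the inner commutator
    replaces [x] by the 2-form [i_Y x], and the outer one by the 1-form
    [i_Z i_Y x]. *)
Lemma wedge_op_bracket x (e f : E) w : alternating x ->
  (forall s, size s != 3 -> x s = 0) ->
  cl f (cl e (wedge_op x w)) + cl f (wedge_op x (cl e w)) - cl e (wedge_op x (cl f w))
    - wedge_op x (cl e (cl f w)) =
  cl (row_mx 0 (\row_k x [:: lsubmx e; lsubmx f; delta_mx 0 k])) w.
Proof.
move=> ax x3.
have xodd : twist x = fun s => - x s.
  apply/funext => s; rewrite /twist; have [->|/x3 ->] := eqVneq (size s) 3.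
    by rewrite -signr_odd expr1 mulN1r.
  by rewrite mulr0 oppr0.
have acx := alternating_contract (lsubmx e) ax.
have cxev : twist (contract (lsubmx e) x) = contract (lsubmx e) x.
  apply/funext => s; apply: oppr_inj; have := contract_twist (lsubmx e) x.
  by rewrite xodd => /(congr1 (fun h => h s)) <-.
have e1 : wedge_op x (cl e w) = wedge_op (contract (lsubmx e) x) w - cl e (wedge_op x w).
  exact: wedge_op_cl_odd.
have e2 : wedge_op x (cl e (cl f w)) =
    wedge_op (contract (lsubmx e) x) (cl f w) - cl e (wedge_op x (cl f w)).
  exact: wedge_op_cl_odd.
have e3 : wedge_op (contract (lsubmx e) x) (cl f w) =
    cl f (wedge_op (contract (lsubmx e) x) w)
    - wedge_op (contract (lsubmx f) (contract (lsubmx e) x)) w.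
  exact: wedge_op_cl_even.
have e4 : cl f (wedge_op (contract (lsubmx e) x) w - cl e (wedge_op x w)) =
    cl f (wedge_op (contract (lsubmx e) x) w) - cl f (cl e (wedge_op x w)).
  exact: linearB.
rewrite e2 e1 e3 wedge_op_one_form // e4.
set p := cl f (cl e (wedge_op x w)); set q := cl f (wedge_op _ w).
set r := cl e (wedge_op _ _).
by rewrite [p + _]addrC subrK opprB addrA subrK opprB addrC subrK.
Qed.

End FormSections.

(** * The derived bracket *)

Section DerivedBracket.
Variables (R : realType) (m : nat).
Local Notation C := R[i].
Local Notation E := (gvec R m).
Local Notation V := (aform R m).
Local Notation alternating := Defs.alternating.
Implicit Types (W : 'rV[R]_m -> V) (y : 'rV[R]_m) (U : set 'rV[R]_m).
Implicit Types (a b : 'rV[R]_m -> E) (w : V).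

Lemma leibniz_cancel (K : comNzRingType) (a b d f p q r t : K) :
  a - (b - p) + (d - q + (f - r)) + (q + r) - (p + (f - t)) - t = a - b + d.
Proof. by ring. Qed.

Lemma bracket_cancel (K : comNzRingType) (e1 e2 e3 e4 h1 h2 h3 h4 : K) :
  e4 - h1 = e1 - h4 + (e2 - h3) - (e3 - h2) - (e1 + e2 - e3 - e4 + (h1 + h2 - h3 - h4)).
Proof. by ring. Qed.

(** The contribution of one coordinate direction [x] to the derived bracket: [e'],
    [f'] and [w'] stand for the derivatives of [e], [f] and [w] in this direction.
    The terms in [w'] cancel, which makes the bracket a zeroth-order operator. *)
Lemma cl_leibniz_term (x e f e' f' : E) w w' :
  cl x (cl e' (cl f w) + cl e (cl f' w + cl f w')) + cl e (cl x (cl f' w + cl f w'))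
  - cl f (cl x (cl e' w + cl e w')) - cl f (cl e (cl x w')) =
  cl (gpair e' f *: x - gpair x f *: e' + gpair x e *: f') w.
Proof.
have L g p q : cl g (p + q) = cl g p + cl g q by exact: linearD.
have Z g c p q : cl g (c *: p - q) = c *: cl g p - cl g q.
  by rewrite linearB linearZ.
have s1 : cl x (cl e' (cl f w)) =
    gpair e' f *: cl x w - (gpair x f *: cl e' w - cl f (cl x (cl e' w))).
  by rewrite [cl e' (cl f w)]cl_swap Z; congr (_ - _); rewrite cl_swap.
have s2 : cl x (cl e (cl f' w)) = gpair x e *: cl f' w - cl e (cl x (cl f' w)).
  by rewrite cl_swap.
have s3 : cl x (cl e (cl f w')) = gpair x e *: cl f w' - cl e (cl x (cl f w')).
  by rewrite cl_swap.
have s4 : cl f (cl x (cl e w')) = gpair x e *: cl f w' - cl f (cl e (cl x w')).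
  by rewrite [cl x (cl e w')]cl_swap Z.
rewrite !L s1 s2 s3 s4 clDl clBl !clZl.
apply/aformP => s; rewrite !(avalD, avalN, avalZ).
exact: leibniz_cancel.
Qed.

(** The derived bracket formula.  The exterior derivative contributes one term
    [cl_leibniz_term] for each coordinate direction, and the 3-form contributes
    [wedge_op_bracket]. *)
Lemma derived_bracket x a b W y : alternating x -> (forall s, size s != 3 -> x s = 0) ->
  ediff a y -> ediff b y -> vdiff W y ->
  cl (b y) (cl (a y) (twisted_d x W y)) =
  twisted_d x (fun z => cl (a z) (cl (b z) (W z))) y
  + cl (a y) (twisted_d x (fun z => cl (b z) (W z)) y)
  - cl (b y) (twisted_d x (fun z => cl (a z) (W z)) y)
  - cl (dorfman x a b y) (W y).
Proof.
move=> ax x3 da db dW.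
have dbW := vdiff_cl db dW.
have eA : ext_d (fun z => cl (a z) (cl (b z) (W z))) y
    + cl (a y) (ext_d (fun z => cl (b z) (W z)) y)
    - cl (b y) (ext_d (fun z => cl (a z) (W z)) y) - cl (b y) (cl (a y) (ext_d W y)) =
    cl (\sum_j (gpair (epart j a y) (b y) *: dx R j - gpair (dx R j) (b y) *: epart j a y
         + gpair (dx R j) (a y) *: epart j b y)) (W y).
  rewrite /ext_d cl_suml ![cl _ (\sum_j _)]linear_sum /= -big_split -!sumrB.
  apply: eq_bigr => j _; rewrite (@vpart_cl _ _ j _ _ _ da dbW) !vpart_cl //.
  exact: cl_leibniz_term.
have eB := wedge_op_bracket (a y) (b y) (W y) ax x3.
rewrite /dorfman clDl -eA -eB /twisted_d.
have S g p q : cl g (p - q) = cl g p - cl g q by exact: linearB.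
rewrite !S.
by apply/aformP => s; rewrite !(avalD, avalN); exact: bracket_cancel.
Qed.

Lemma twisted_d0 U x W y : open U -> U y -> alternating x ->
  (forall z, U z -> W z = 0) -> twisted_d x W y = 0.
Proof.
move=> Uo Uy ax W0; rewrite /twisted_d /ext_d big1 => [|j _].
  have := wedge_op_lin (-1) 0 0 ax.
  by rewrite scaler0 addr0 scaleN1r addNr W0 // => ->; rewrite subr0.
by rewrite (@eq_vpart _ _ U j W (fun=> 0)) // vpart_cst linear0.
Qed.

Lemma eq_twisted_d U x W W' y : open U -> U y -> (forall z, U z -> W z = W' z) ->
  twisted_d x W y = twisted_d x W' y.
Proof.
move=> Uo Uy WW; rewrite /twisted_d (WW _ Uy) /ext_d.
by under eq_bigr do rewrite (eq_vpart _ Uo Uy WW).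
Qed.

Lemma twisted_dD x W W' y : alternating x -> vdiff W y -> vdiff W' y ->
  twisted_d x (fun z => W z + W' z) y = twisted_d x W y + twisted_d x W' y.
Proof.
move=> ax dW dW'; rewrite /twisted_d -[W y]scale1r wedge_op_lin // !scale1r opprD addrACA.
congr (_ + _); rewrite /ext_d -big_split; apply: eq_bigr => j _ /=.
by rewrite vpartD // linearD.
Qed.

(** The analytic heart: for a family of subspaces closed under the bracket, the
    twisted differential raises the filtration by one only.  By [derived_bracket],
    [b . a . d W] is a combination of [d (a . b . W)], [a . d (b . W)],
    [b . d (a . W)] and [[a, b] . W], to which the induction hypothesis applies. *)
Theorem fil_twisted_d U (x : 'rV[R]_m -> seq 'rV[C]_m -> C) (L : 'rV[R]_m -> set E)
    (S : set ('rV[R]_m -> E)) :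
  open U ->
  (forall y, U y -> alternating (x y) /\ forall s, size s != 3 -> x y s = 0) ->
  (forall a y, S a -> U y -> L y (a y) /\ ediff a y) ->
  (forall y e, U y -> L y e -> exists2 a, S a & a y = e) ->
  (forall a b y, S a -> S b -> U y -> L y (dorfman (x y) a b y)) ->
  forall k W, (forall y, U y -> vdiff W y) -> (forall y, U y -> fil (L y) k (W y)) ->
  forall y, U y -> fil (L y) k.+1 (twisted_d (x y) W y).
Proof.
move=> Uo xP SP Sext Scl; elim/ltn_ind => -[|k] IHk W dW fW y Uy.
  by rewrite (twisted_d0 Uo Uy (proj1 (xP _ Uy)) fW); exact: fil_zero.
move=> e Le f Lf; have [ax x3] := xP _ Uy.
have [a Sa ae] := Sext _ _ Uy Le; have [b Sb bf] := Sext _ _ Uy Lf.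
have dcl c X : S c -> (forall z, U z -> vdiff X z) ->
    forall z, U z -> vdiff (fun z => cl (c z) (X z)) z.
  by move=> Sc dX z Uz; apply: vdiff_cl; [case: (SP c z Sc Uz)|exact: dX].
have fcl c : S c -> forall z, U z -> fil (L z) k (cl (c z) (W z)).
  by move=> Sc z Uz; apply: (fW z Uz); case: (SP c z Sc Uz).
rewrite -ae -bf (derived_bracket ax x3); last exact: dW.
- apply: filB; last by apply: (fW y Uy); exact: Scl.
  apply: filB; last first.
    by apply: (IHk k _ _ (dcl _ _ Sa dW) (fcl _ Sa)) => //; rewrite bf.
  apply: filD; last first.
    by apply: (IHk k _ _ (dcl _ _ Sb dW) (fcl _ Sb)) => //; rewrite ae.
  case: k IHk fW fcl => [|k] IHk fW fcl.
    by apply: (twisted_d0 Uo Uy ax) => z Uz; rewrite (fcl _ Sb z Uz) linear0.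
  apply: (IHk k _ _ (dcl _ _ Sa (dcl _ _ Sb dW)) _ _ Uy); first by rewrite ltnS ltnW.
  by move=> z Uz; apply: (fcl _ Sb z Uz); case: (SP a z Sa Uz).
- by case: (SP a y Sa Uy).
- by case: (SP b y Sb Uy).
Qed.

End DerivedBracket.

(** * Smooth functions *)

Section Smoothness.
Variables (R : realType) (p : nat).
Local Notation C := R[i].
Implicit Types (U : set 'rV[R]_p) (f g : 'rV[R]_p -> R).

Lemma eq_Ck U k f g : open U -> (forall y, U y -> f y = g y) ->
  Ck_on k U f -> Ck_on k U g.
Proof.
move=> Uo; elim: k f g => [|k IHk] f g fg /=.
  move=> fC y Uy; rewrite /prop_for /continuous_at -(fg _ Uy).
  apply: cvg_trans (fC y Uy); apply: (@near_eq_cvg _ _ (nbhs y)); near=> z.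
  by rewrite fg //; near: z; exact: open_nbhs_nbhs.
move=> fC j; have [df Cf] := fC j; split.
  move=> y Uy; apply: near_eq_derivable (df y Uy); near=> z.
  by rewrite fg //; near: z; exact: open_nbhs_nbhs.
apply: IHk Cf => y Uy; apply: near_eq_derive; near=> z.
by rewrite fg //; near: z; exact: open_nbhs_nbhs.
Unshelve. all: by end_near. Qed.

Lemma Ck_cst U k (c : R) : Ck_on k U (fun=> c).
Proof.
elim: k c => [|k IHk] c /=; first by move=> y _; exact: cst_continuous.
move=> j; split=> [y _|]; first exact: derivable_cst.
by under eq_fun do rewrite derive_cst.
Qed.

Lemma CkD U k f g : open U -> Ck_on k U f -> Ck_on k U g ->
  Ck_on k U (fun y => f y + g y).
Proof.
move=> Uo; elim: k f g => [|k IHk] f g /=.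
  by move=> fC gC y Uy; exact: (continuousD (fC y Uy) (gC y Uy)).
move=> fC gC j; have [df Cf] := fC j; have [dg Cg] := gC j; split.
  by move=> y Uy; apply: derivable_funD; [exact: df|exact: dg].
apply: eq_Ck (IHk _ _ Cf Cg) => // y Uy.
by rewrite derive_funD //; [exact: df|exact: dg].
Qed.

Lemma CkZ U k (c : R) f : open U -> Ck_on k U f -> Ck_on k U (fun y => c * f y).
Proof.
move=> Uo; elim: k f => [|k IHk] f /=.
  move=> fC y Uy.
  have c1 : {for y, continuous (fun _ : 'rV[R]_p => c)} by exact: cst_continuous.
  have fy : {for y, continuous f} by exact: fC.
  exact: (continuousM c1 fy).
move=> fC j; have [df Cf] := fC j; split.
  by move=> y Uy; apply: derivable_funM; [exact: derivable_cst|exact: df].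
apply: eq_Ck (IHk _ Cf) => // y Uy.
have dc : derivable (fun _ : 'rV[R]_p => c) y (basis_vec R j) by exact: derivable_cst.
have c0 : 'D_(basis_vec R j) (fun _ : 'rV[R]_p => c) y = 0 by exact: derive_cst.
by rewrite (derive_funM dc (df y Uy)) c0 mulr0 addr0.
Qed.

Lemma csmooth_cst U (c : C) : csmooth_on U (fun=> c).
Proof. by split=> k; exact: Ck_cst. Qed.

Lemma csmooth_real U f : smooth_on U f -> csmooth_on U (fun y => (f y)%:C).
Proof. by move=> sf; split=> k; [exact: sf|exact: Ck_cst]. Qed.

Lemma csmoothD U (f g : 'rV[R]_p -> C) : open U -> csmooth_on U f ->
  csmooth_on U g -> csmooth_on U (fun y => f y + g y).
Proof.
move=> Uo [f1 f2] [g1 g2]; split=> k.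
  by apply: eq_Ck (CkD Uo (f1 k) (g1 k)) => // y _; case: (f y) (g y) => [? ?] [? ?].
by apply: eq_Ck (CkD Uo (f2 k) (g2 k)) => // y _; case: (f y) (g y) => [? ?] [? ?].
Qed.

Lemma csmoothZ U (c : C) (f : 'rV[R]_p -> C) : open U -> csmooth_on U f ->
  csmooth_on U (fun y => c * f y).
Proof.
case: c => c d Uo [f1 f2]; split=> k.
  apply: eq_Ck (CkD Uo (CkZ c Uo (f1 k)) (CkZ (- d) Uo (f2 k))) => // y _.
  by case: (f y) => [? ?] /=; rewrite mulNr.
apply: eq_Ck (CkD Uo (CkZ c Uo (f2 k)) (CkZ d Uo (f1 k))) => // y _.
by case: (f y) => [? ?].
Qed.

Lemma csmooth_sum (I : Type) (r : seq I) U (F : I -> 'rV[R]_p -> C) : open U ->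
  (forall i, csmooth_on U (F i)) -> csmooth_on U (fun y => \sum_(i <- r) F i y).
Proof.
move=> Uo sF; elim: r => [|i r IHr].
  by under eq_fun do rewrite big_nil; exact: csmooth_cst.
by under eq_fun do rewrite big_cons; exact: csmoothD.
Qed.

Lemma csmooth_conj U (f : 'rV[R]_p -> C) : open U -> csmooth_on U f ->
  csmooth_on U (fun y => conjc (f y)).
Proof.
move=> Uo [f1 f2]; split=> k.
  by apply: eq_Ck (f1 k) => // y _; case: (f y).
apply: eq_Ck (CkZ (-1) Uo (f2 k)) => // y _.
by rewrite mulN1r; case: (f y).
Qed.

Lemma csmooth_cdiff U (f : 'rV[R]_p -> C) y : csmooth_on U f -> U y -> cdiff f y.
Proof.
by move=> [f1 f2] Uy j; split; [case: (f1 1%N j) => + _|case: (f2 1%N j) => + _]; apply.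
Qed.

End Smoothness.

(** * The Courant bracket in a chart *)

Section Courant.
Variables (R : realType) (m : nat).
Local Notation C := R[i].
Local Notation E := (gvec R m).
Implicit Types (y : 'rV[R]_m) (a b : 'rV[R]_m -> E).

Lemma gpair_coord (e f : E) : gpair e f =
  \sum_j (e 0 (rshift m j) * f 0 (lshift m j) + f 0 (rshift m j) * e 0 (lshift m j)).
Proof.
by rewrite /gpair !mxE big_split /=; congr (_ + _); apply: eq_bigr => j _; rewrite !mxE.
Qed.

Lemma gpair_dx (j : 'I_m) (e : E) : gpair (dx R j) e = e 0 (lshift m j).
Proof.
rewrite /gpair row_mxKl row_mxKr linear0 mulmx0 addr0 -rowE !mxE.
by [].
Qed.

Lemma dorfmanE x a b y l : dorfman x a b y 0 l =
  \sum_j (gpair (epart j a y) (b y) * dx R j 0 l - b y 0 (lshift m j) * epart j a y 0 l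
     + a y 0 (lshift m j) * epart j b y 0 l)
  + row_mx 0 (\row_k x [:: lsubmx (a y); lsubmx (b y); delta_mx 0 k]) 0 l.
Proof.
rewrite /dorfman mxE summxE; congr (_ + _); apply: eq_bigr => j _.
rewrite !gpair_dx [LHS]mxE [X in X + _]mxE [X in _ + X]mxE.
by rewrite [X in X + _ + _]mxE [X in _ + X + _]mxE [X in _ - X + _]mxE.
Qed.

(** The difference of the two brackets is half the differential of the pairing. *)
Lemma courant_dorfman (X : manifold R m) (H : Defs.field X (dform R m)) i U a b y :
  open U -> U y -> (forall z, U z -> gpair (a z) (b z) = 0) ->
  ediff a y -> ediff b y -> courant H i a b y = dorfman (H i y) a b y.
Proof.
move=> Uo Uy ab0 da db.
have eL (k : 'I_m) (c : 'rV[R]_m -> E) :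
    (fun z => lsubmx (c z) 0 k) = (fun z => c z 0 (lshift m k) : C).
  by apply/funext => z; rewrite mxE.
have eR (k : 'I_m) (c : 'rV[R]_m -> E) :
    (fun z => rsubmx (c z) 0 k) = (fun z => c z 0 (rshift m k) : C).
  by apply/funext => z; rewrite mxE.
rewrite /courant -[RHS]hsubmxK; congr row_mx; apply/rowP => k.
  rewrite [RHS]mxE dorfmanE [LHS]mxE row_mxEl [X in _ = _ + X]mxE addr0 /cderiv !eL -sumrB.
  apply: eq_bigr => j _; rewrite row_mxEl !mxE mulr0 sub0r addrC.
  by [].
have dsum (c d : 'rV[R]_m -> E) : ediff c y -> ediff d y ->
    forall j, cdiff (fun z => c z 0 (rshift m j) * d z 0 (lshift m j)) y.
  by move=> dc dd j; apply: cdiffM; [exact: dc|exact: dd].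
(* The two halves of the derivative of the function xi(Z) in the direction k. *)
pose Q (c d : 'rV[R]_m -> E) :=
  \sum_j (partial k (fun z => c z 0 (rshift m j)) y * d y 0 (lshift m j) : C).
pose Q' (c d : 'rV[R]_m -> E) :=
  \sum_j (c y 0 (rshift m j) * partial k (fun z => d z 0 (lshift m j)) y : C).
have dmul (c d : 'rV[R]_m -> E) : ediff c y -> ediff d y ->
    partial k (fun z => (rsubmx (c z) *m (lsubmx (d z))^T) 0 0) y = Q c d + Q' c d /\
    cdiff (fun z => (rsubmx (c z) *m (lsubmx (d z))^T) 0 0) y.
  move=> dc dd.
  have -> : (fun z => (rsubmx (c z) *m (lsubmx (d z))^T) 0 0) =
      (fun z => \sum_j (c z 0 (rshift m j) * d z 0 (lshift m j))).
    by apply/funext => z; rewrite mxE; apply: eq_bigr => j _; rewrite !mxE.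
  split; last by apply: cdiff_sum => j; exact: dsum.
  rewrite partial_sum; last by move=> j; exact: dsum.
  rewrite /Q /Q' -big_split; apply: eq_bigr => j _ /=.
  by rewrite partialM.
have [pab cab] := dmul _ _ da db; have [pba cba] := dmul _ _ db da.
have zero : Q a b + Q' a b + (Q b a + Q' b a) = 0.
  rewrite -pab -pba -partialD // -(partial_cst k 0 y).
  apply: (eq_partial _ Uo Uy) => z Uz; rewrite -[RHS](ab0 _ Uz) /gpair [RHS]mxE.
  by [].
rewrite [RHS]mxE dorfmanE row_mxEr.
have -> : \sum_j (gpair (epart j a y) (b y) * dx R j 0 (rshift m k)
    - b y 0 (lshift m j) * epart j a y 0 (rshift m k)
    + a y 0 (lshift m j) * epart j b y 0 (rshift m k)) =
    Q a b + Q' b a - \sum_j (b y 0 (lshift m j) * partial j (fun z => a z 0 (rshift m k)) y)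
    + \sum_j (a y 0 (lshift m j) * partial j (fun z => b z 0 (rshift m k)) y).
  rewrite !big_split /= sumrN; congr (_ + _ + _).
  - rewrite (bigD1 k) //= big1 ?addr0 => [|j jk]; last first.
      by rewrite row_mxEr mxE eq_sym (negbTE jk) andbF mulr0.
    rewrite row_mxEr mxE !eqxx mulr1 gpair_coord big_split; congr (_ + _).
      by apply: eq_bigr => j _; rewrite mxE.
    by apply: eq_bigr => j _; rewrite [epart _ _ _ _ _]mxE.
  - by congr (- _); apply: eq_bigr => j _; rewrite mxE.
  - by apply: eq_bigr => j _; rewrite mxE.
have cb l : cplx_mx (basis_vec R l) = delta_mx 0 l.
  by apply/rowP => q; rewrite !mxE; case: (_ && _).
rewrite [LHS]mxE; congr (_ + _); last by rewrite !mxE cb.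
rewrite !mxE.
rewrite /cderiv !eR.
have -> : (fun z => (rsubmx (b z) *m (lsubmx (a z))^T) 0 0
      - (rsubmx (a z) *m (lsubmx (b z))^T) 0 0) =
    (fun z => (rsubmx (b z) *m (lsubmx (a z))^T) 0 0
      + -1 * (rsubmx (a z) *m (lsubmx (b z))^T) 0 0).
  by apply/funext => z; rewrite mulN1r.
rewrite (partialD k cba (cdiffZ (-1) cab)) (partialZ k (-1) cab).
rewrite pab pba.
have -> : \sum_j rsubmx (b y) 0 j * partial k (fun z => lsubmx (a z) 0 j) y = Q' b a.
  by apply: eq_bigr => j _; rewrite eL mxE.
have -> : \sum_j rsubmx (a y) 0 j * partial k (fun z => lsubmx (b z) 0 j) y = Q' a b.
  by apply: eq_bigr => j _; rewrite eL mxE.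
have -> : \sum_(j < m) lsubmx (a y) 0 j * partial j (fun z => b z 0 (rshift m k)) y =
    \sum_j (a y 0 (lshift m j) * partial j (fun z => b z 0 (rshift m k)) y).
  by apply: eq_bigr => j _; rewrite mxE.
have -> : \sum_(j < m) lsubmx (b y) 0 j * partial j (fun z => a z 0 (rshift m k)) y =
    \sum_j (b y 0 (lshift m j) * partial j (fun z => a z 0 (rshift m k)) y).
  by apply: eq_bigr => j _; rewrite mxE.
have half : 2^-1 * (Q b a + Q' b a + -1 * (Q a b + Q' a b)) = - (Q a b + Q' a b).
  move/eqP: zero; rewrite addrC addr_eq0 => /eqP ->.
  rewrite mulN1r -opprD mulrN; congr (- _).
  by rewrite [RHS]splitr -mulrDl mulrC.
by rewrite half; ring.
Qed.

End Courant.

(** * Differentiable families of matrices *)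

Section MatrixDiff.
Variables (R : realType) (m : nat).
Local Notation C := R[i].
Local Notation V := (aform R m).
Implicit Types (y : 'rV[R]_m) (W : 'rV[R]_m -> V).

Definition mdiff p q (A : 'rV[R]_m -> 'M[C]_(p, q)) y :=
  forall r s, cdiff (fun z => A z r s) y.

Lemma mdiff_cst p q (A : 'M[C]_(p, q)) y : mdiff (fun=> A) y.
Proof. by move=> r s; exact: cdiff_cst. Qed.

Lemma mdiffD p q (A B : 'rV[R]_m -> 'M[C]_(p, q)) y : mdiff A y -> mdiff B y ->
  mdiff (fun z => A z + B z) y.
Proof.
move=> dA dB r s.
have -> : (fun z => (A z + B z) r s) = (fun z => A z r s + B z r s).
  by apply/funext => z; rewrite mxE.
exact: cdiffD.
Qed.

Lemma mdiffM p q l (A : 'rV[R]_m -> 'M[C]_(p, q)) (B : 'rV[R]_m -> 'M[C]_(q, l)) y :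
  mdiff A y -> mdiff B y -> mdiff (fun z => A z *m B z) y.
Proof.
move=> dA dB r s.
have -> : (fun z => (A z *m B z) r s) = (fun z => \sum_j A z r j * B z j s).
  by apply/funext => z; rewrite mxE.
by apply: cdiff_sum => j; exact: cdiffM.
Qed.

Lemma mdiffN p q (A : 'rV[R]_m -> 'M[C]_(p, q)) y : mdiff A y -> mdiff (fun z => - A z) y.
Proof.
move=> dA r s.
have -> : (fun z => (- A z) r s) = (fun z => -1 * A z r s).
  by apply/funext => z; rewrite mxE mulN1r.
exact: cdiffZ.
Qed.

Lemma mdiff_tr p q (A : 'rV[R]_m -> 'M[C]_(p, q)) y : mdiff A y ->
  mdiff (fun z => (A z)^T) y.
Proof.
move=> dA r s.
have -> : (fun z => (A z)^T r s) = (fun z => A z s r) by apply/funext => z; rewrite mxE.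
exact: dA.
Qed.

Lemma ediff_row p (A : 'rV[R]_m -> 'M[C]_(p, m + m)) r y : mdiff A y ->
  ediff (fun z => row r (A z)) y.
Proof.
move=> dA l.
have -> : (fun z => row r (A z) 0 l) = (fun z => A z r l) by apply/funext => z; rewrite mxE.
exact: dA.
Qed.

Lemma mdiff_bv_mx (B : 'rV[R]_m -> 'M[C]_(m + m)) y : mdiff B y ->
  mdiff (fun z => bv_mx (B z)) y.
Proof. by move=> dB; apply: mdiffM; [exact: mdiff_cst|exact: mdiff_tr]. Qed.

Lemma vdiff_bv_act (B : 'rV[R]_m -> 'M[C]_(m + m)) W y : mdiff B y -> vdiff W y ->
  vdiff (fun z => bv_act_alt (B z) (W z)) y.
Proof.
move=> dB dW; apply: vdiffZ; first exact: cdiff_cst.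
apply: vdiff_sum => p; apply: vdiff_clc; apply: vdiff_cl => //.
exact: ediff_row.
Qed.

Lemma vdiff_bv_exp (B : 'rV[R]_m -> 'M[C]_(m + m)) W y : mdiff B y -> vdiff W y ->
  vdiff (fun z => bv_exp_alt (B z) (W z)) y.
Proof.
move=> dB dW; apply: vdiff_sum => k; apply: vdiffZ; first exact: cdiff_cst.
by elim: (nat_of_ord k) => [|l IHl]; [exact: dW|exact: (vdiff_bv_act dB IHl)].
Qed.

Lemma vdiff_frame_ext (P F : 'rV[R]_m -> 'M[C]_(m + m)) (g : 'rV[R]_m -> V -> V) k W y :
  mdiff P y -> mdiff F y ->
  (forall W', vdiff W' y -> vdiff (fun z => g z (W' z)) y) ->
  vdiff W y -> vdiff (fun z => frame_ext (P z) (F z) (g z) k (W z)) y.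
Proof.
move=> dP dF dg; elim: k W => [|k IHk] W dW; first exact: dg.
apply: vdiffZ; first exact: cdiff_cst.
apply: vdiff_sum => p; apply: vdiff_cl; last first.
  by apply: IHk; apply: vdiff_cl => //; exact: ediff_row.
have -> : (fun z => coframe (P z) p *m F z) =
    (fun z => row p (gram C m *m (1%:M - P z) *m F z)).
  by apply/funext => z; rewrite /coframe -row_mul.
apply: ediff_row; apply: (mdiffM _ dF).
exact: (mdiffM (mdiff_cst _ y) (mdiffD (mdiff_cst _ y) (mdiffN dP))).
Qed.

End MatrixDiff.

(** * The twisted differential of an integrable structure *)

Section Integrability.
Variables (R : realType) (m : nat) (X : manifold R m).
Variables (H : Defs.field X (dform R m)) (J : Defs.field X 'M[R]_(m + m)).
Hypotheses (H_3form : closed_real_3form H) (J_gcs : is_gcs H J).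
Variable i : chart_index X.
Local Notation C := R[i].
Local Notation E := (gvec R m).
Local Notation V := (aform R m).
Local Notation alternating := Defs.alternating.
Local Notation U := (chart_img i).
Local Notation P := (fun y => proj_gcs (J i y)).
Implicit Types (y : 'rV[R]_m) (W : 'rV[R]_m -> V).

Lemma gcs_at_chart y : U y -> gcs_at (J i y).
Proof. by move=> Uy; case: J_gcs => _ JJ Jp _; split; [exact: JJ|exact: Jp]. Qed.

Lemma polar_chart y : U y -> polar (P y).
Proof. by move=> Uy; apply: polar_gcs; exact: gcs_at_chart. Qed.

Lemma open_chart : open U.
Proof. exact: chart_img_open. Qed.

Lemma csmooth_proj p q : csmooth_on U (fun y => P y p q).
Proof.
have Uo := open_chart.
have -> : (fun y => P y p q) =
    (fun y => 2^-1 * ((p == q)%:R + - (0 +i* 1) * (J i y p q)%:C)).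
  by apply/funext => y; rewrite !mxE mulNr.
apply: csmoothZ => //; apply: csmoothD => //; first exact: csmooth_cst.
apply: csmoothZ => //; apply: csmooth_real.
by case: J_gcs => [[sJ _] _ _ _]; exact: sJ.
Qed.

Lemma mdiff_proj y : U y -> mdiff P y.
Proof. by move=> Uy p q; apply: csmooth_cdiff Uy; exact: csmooth_proj. Qed.

Lemma smooth_section_mul (e : E) (A : 'rV[R]_m -> 'M[C]_(m + m)) :
  (forall p q, csmooth_on U (fun y => A y p q)) -> smooth_section i (fun y => e *m A y).
Proof.
have Uo := open_chart; move=> sA l.
have -> : (fun y => (e *m A y) 0 l) = (fun y => \sum_q e 0 q * A y q l).
  by apply/funext => y; rewrite mxE.
by apply: csmooth_sum => // q; exact: csmoothZ.
Qed.

Lemma H_alternating y : U y -> alternating (H i y) /\ forall s, size s != 3 -> H i y s = 0.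
Proof.
move=> Uy; case: H_3form => [[aH _ _] H3 _ _]; split; first exact: aH.
by move=> s s3; exact: H3.
Qed.

Lemma section_ediff (a : 'rV[R]_m -> E) y : smooth_section i a -> U y -> ediff a y.
Proof. by move=> sa Uy l; apply: csmooth_cdiff Uy. Qed.

Lemma Lplus_isotropic y (e f : E) : U y -> Lplus (J i y) e -> Lplus (J i y) f ->
  gpair e f = 0.
Proof. by move=> Uy; rewrite Lplus_im; apply: im_isotropic; exact: polar_chart. Qed.

(** A vector of the eigenspace at a point extends to the section obtained by
    projecting a constant one. *)
Lemma fil_d_im k W : (forall y, U y -> vdiff W y) ->
  (forall y, U y -> fil (im (P y)) k (W y)) ->
  forall y, U y -> fil (im (P y)) k.+1 (twisted_d (H i y) W y).
Proof.
apply: (@fil_twisted_d _ _ U (H i) (fun y => im (P y))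
  [set a | smooth_section i a /\ forall y, U y -> Lplus (J i y) (a y)]).
- exact: open_chart.
- exact: H_alternating.
- move=> a y [sa La] Uy; split; last exact: section_ediff.
  by rewrite -Lplus_im; exact: La.
- move=> y e Uy eL; exists (fun z => e *m P z); last exact: eL.
  split; first by apply: smooth_section_mul => p q; exact: csmooth_proj.
  by move=> z Uz; rewrite Lplus_im; apply: im_mul; exact: polar_chart.
- move=> a b y [sa La] [sb Lb] Uy; rewrite -Lplus_im.
  rewrite -(@courant_dorfman _ _ X H i U) //; try exact: section_ediff.
  + by case: J_gcs => _ _ _; apply.
  + exact: open_chart.
  + by move=> z Uz; apply: (@Lplus_isotropic z) => //; [exact: La|exact: Lb].
Qed.

Lemma gpair_conj (e f : E) : gpair (conj_mx e) (conj_mx f) = conjc (gpair e f).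
Proof.
rewrite !gpair_coord rmorph_sum; apply: eq_bigr => j _ /=.
by rewrite !mxE rmorphD !rmorphM.
Qed.

(** Transfers the involutivity of [L] to its conjugate; the realness of [H] enters
    here. *)
Lemma dorfman_conj (a b : 'rV[R]_m -> E) y : U y -> ediff a y -> ediff b y ->
  dorfman (H i y) (fun z => conj_mx (a z)) (fun z => conj_mx (b z)) y =
  conj_mx (dorfman (H i y) a b y).
Proof.
move=> Uy da db.
have ec (c : 'rV[R]_m -> E) : ediff c y -> forall j,
    epart j (fun z => conj_mx (c z)) y = conj_mx (epart j c y).
  move=> dc j; apply/rowP => l; rewrite !mxE -partial_conj; last exact: dc.
  by under eq_fun do rewrite mxE.
have dxc j : conj_mx (dx R j) = dx R j.
  apply/rowP => l; rewrite /dx !mxE; case: fintype.split => k; rewrite !mxE ?rmorph0 //.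
  by rewrite rmorph_nat.
have conjD (u v : E) : conj_mx (u + v) = conj_mx u + conj_mx v by exact: map_mxD.
have conjN (u : E) : conj_mx (- u) = - conj_mx u by exact: map_mxN.
have conjZ c (u : E) : conj_mx (c *: u) = conjc c *: conj_mx u by exact: map_mxZ.
rewrite /dorfman conjD; congr (_ + _).
  have conj0 : conj_mx (0 : E) = 0 by exact: map_mx0.
  rewrite (big_morph (@conj_mx R 1 (m + m)) conjD conj0); apply: eq_bigr => j _.
  have g1 (e : E) : gpair (dx R j) (conj_mx e) = conjc (gpair (dx R j) e).
    by rewrite -{1}[dx R j]dxc gpair_conj.
  by rewrite !conjD conjN !conjZ !ec // !g1 gpair_conj dxc.
rewrite /conj_mx map_row_mx map_mx0; congr row_mx; apply/rowP => k; rewrite !mxE.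
case: H_3form => _ _ Hr _; rewrite -Hr //=.
congr (H i y [:: _; _; _]); rewrite /conj_mx.
- by rewrite map_lsubmx.
- by rewrite map_lsubmx.
- by apply/rowP => l; rewrite !mxE rmorph_nat.
Qed.

(** The conjugate eigenbundle is involutive as well; this bounds the twisted
    differential from below. *)
Lemma fil_d_coim k W : (forall y, U y -> vdiff W y) ->
  (forall y, U y -> fil (im (1%:M - P y)) k (W y)) ->
  forall y, U y -> fil (im (1%:M - P y)) k.+1 (twisted_d (H i y) W y).
Proof.
have Uo := open_chart.
apply: (@fil_twisted_d _ _ U (H i) (fun y => im (1%:M - P y))
  [set a | smooth_section i a /\ forall y, U y -> Lstar (J i y) (a y)]).
- exact: open_chart.
- exact: H_alternating.
- move=> a y [sa La] Uy; split; last exact: section_ediff.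
  by rewrite -Lstar_im; exact: La.
- move=> y e Uy eL; exists (fun z => e *m (1%:M - P z)); last exact: eL.
  split; last first.
    by move=> z Uz; rewrite Lstar_im; apply: im_mul; apply: polarC; exact: polar_chart.
  apply: smooth_section_mul => p q.
  have -> : (fun y => (1%:M - P y) p q) = (fun y => (1%:M : 'M[C]__) p q + -1 * P y p q).
    by apply/funext => z; rewrite [LHS]mxE [X in _ + X]mxE mulN1r.
  apply: csmoothD => //; first exact: csmooth_cst.
  by apply: csmoothZ => //; exact: csmooth_proj.
- move=> a b y [sa La] [sb Lb] Uy; rewrite -Lstar_im /Lstar /=.
  rewrite -dorfman_conj //; try exact: section_ediff.
  have sc c : smooth_section i c -> smooth_section i (fun z => conj_mx (c z)).
    move=> sc' l.
    have -> : (fun z => conj_mx (c z) 0 l) = (fun z => conjc (c z 0 l)).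
      by apply/funext => z; rewrite mxE.
    by apply: csmooth_conj => //; exact: sc'.
  rewrite -(@courant_dorfman _ _ X H i U) //; try by apply: section_ediff => //; exact: sc.
  + case: J_gcs => _ _ _; apply => //; exact: sc.
  + by move=> z Uz; apply: (@Lplus_isotropic z) => //; [exact: La|exact: Lb].
Qed.

End Integrability.

(** * The components of the twisted differential *)

Section Components.
Variables (R : realType) (m : nat) (X : manifold R m).
Variables (H : Defs.field X (dform R m)) (J : Defs.field X 'M[R]_(m + m)).
Hypotheses (H_3form : closed_real_3form H) (J_gcs : is_gcs H J).
Variable i : chart_index X.
Local Notation C := R[i].
Local Notation V := (aform R m).
Local Notation alternating := Defs.alternating.
Local Notation U := (chart_img i).
Local Notation P := (fun y => proj_gcs (J i y)).
Local Notation form := (seq 'rV[C]_m -> C).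
Implicit Types (y : 'rV[R]_m) (W : 'rV[R]_m -> V) (sg : Defs.field X (dform R m)).

Let Uo : open U.
Proof. exact: open_chart. Qed.

Lemma dH_twisted sg W y : U y -> (forall z, U z -> sg i z = W z :> form) ->
  (forall z, U z -> vdiff W z) -> dH H sg i y = twisted_d (H i y) W y :> form.
Proof.
move=> Uy sW dW; apply/funext => s.
have [aH _] := H_alternating H_3form Uy.
have SW z : U z -> W z = to_aform (sg i z) by move=> Uz; rewrite sW // avalK.
rewrite /dH d_dRE //.
- rewrite /twisted_d avalB (wedge_opE _ _ aH) (sW _ Uy); congr (_ - _).
  rewrite /ext_d !aval_sum; apply: eq_bigr => j _.
  by rewrite (@eq_vpart _ _ U j W (fun z => to_aform (sg i z))).
- by move=> z Uz; rewrite sW //; exact: avalP.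
- by apply: (eq_vdiff Uo Uy SW); exact: dW.
Qed.

(** [fil_d_coim], indexed by levels. *)
Lemma cofil_d j W : (forall y, U y -> vdiff W y) ->
  (forall y, U y -> cofil (P y) j (W y)) ->
  forall y, U y -> cofil (P y) j.-1 (twisted_d (H i y) W y).
Proof.
move=> dW Wj y Uy; have pP := polar_chart J_gcs Uy.
case: j Wj => [|j] Wj; first exact: cofil0.
have [jm|mj] := ltnP j m.+1.
  rewrite /cofil /= -subnSK //.
  by apply: (fil_d_coim H_3form J_gcs).
have [aH _] := H_alternating H_3form Uy.
rewrite (twisted_d0 Uo Uy aH) => [|z Uz]; first exact: fil_zero.
by apply: (cofil_big (Wj z Uz)); exact: leqW mj.
Qed.

Lemma Uproj_section k l W z : U z -> lev (P z) k (W z) -> (l <= m)%N ->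
  Uproj (J i z) l (W z) = ((if l == k then W z else 0) : V) :> form.
Proof.
move=> Uz Wk lm; rewrite Uproj_lev_comp //; last exact: (gcs_at_chart J_gcs).
by rewrite (lev_compE _ (polar_chart J_gcs Uz) Wk).
Qed.

Lemma dH_component k l sg W y : U y -> (forall z, U z -> sg i z = W z :> form) ->
  (forall z, U z -> lev (P z) k (W z)) -> (forall z, U z -> vdiff W z) -> (l <= m)%N ->
  dH H (fun i' y' => Uproj (J i' y') l (sg i' y')) i y =
  ((if l == k then twisted_d (H i y) W y else 0) : V) :> form.
Proof.
move=> Uy sW Wk dW lm; have [aH _] := H_alternating H_3form Uy.
rewrite (@dH_twisted _ (fun z => if l == k then W z else 0)) //.
- case: eqP => // _; congr aval.
  by apply: (twisted_d0 Uo Uy aH).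
- by move=> z Uz; rewrite sW // (@Uproj_section k) //; exact: Wk.
- by move=> z Uz; case: eqP => _; [exact: dW|exact: vdiff_cst].
Qed.

(** In the next two lemmas only one term of the sum defining the operator survives,
    because the section has a single component. *)
Lemma delbar_section k sg W y : U y -> (forall z, U z -> sg i z = W z :> form) ->
  (forall z, U z -> lev (P z) k (W z)) -> (forall z, U z -> vdiff W z) ->
  delbar H J sg i y = lev_comp (P y) (twisted_d (H i y) W y) k.+1 :> form.
Proof.
move=> Uy sW Wk dW; have pP := polar_chart J_gcs Uy; have gJ := gcs_at_chart J_gcs Uy.
apply/funext => s; rewrite /delbar.
have term (j : 'I_m) : Uproj (J i y) j.+1
    (dH H (fun i' y' => Uproj (J i' y') j (sg i' y')) i y) s =
    if j == k :> nat then lev_comp (P y) (twisted_d (H i y) W y) k.+1 s else 0.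
  rewrite (dH_component Uy sW Wk dW) ?(ltnW (ltn_ord j)) // Uproj_lev_comp //.
  by case: eqP => [->|_] //; rewrite lev_comp0.
under eq_bigr do rewrite term.
have [km|mk] := ltnP k m.
  rewrite (bigD1 (Ordinal km)) //= eqxx big1 ?addr0 // => j.
  by rewrite -val_eqE /= => /negbTE ->.
rewrite (lev_big pP (lev_comp_lev _ k.+1 pP)) // big1 // => j _.
by rewrite ltn_eqF // (leq_trans (ltn_ord j)).
Qed.

Lemma del_section k sg W y : U y -> (forall z, U z -> sg i z = W z :> form) ->
  (forall z, U z -> lev (P z) k (W z)) -> (forall z, U z -> vdiff W z) ->
  del H J sg i y =
  ((if k is k'.+1 then lev_comp (P y) (twisted_d (H i y) W y) k' else 0) : V) :> form.
Proof.
move=> Uy sW Wk dW; have pP := polar_chart J_gcs Uy; have gJ := gcs_at_chart J_gcs Uy.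
have [aH _] := H_alternating H_3form Uy.
apply/funext => s; rewrite /del.
have term (j : 'I_m) : Uproj (J i y) j
    (dH H (fun i' y' => Uproj (J i' y') j.+1 (sg i' y')) i y) s =
    if j.+1 == k :> nat then lev_comp (P y) (twisted_d (H i y) W y) j s else 0.
  rewrite (dH_component Uy sW Wk dW) // Uproj_lev_comp ?(ltnW (ltn_ord j)) //.
  by case: eqP => [_|_] //; rewrite lev_comp0.
under eq_bigr do rewrite term.
case: k Wk {term} => [|k] Wk; first by rewrite big1.
have [km|mk] := ltnP k m.
  rewrite (bigD1 (Ordinal km)) //= eqxx big1 ?addr0 // => j.
  by rewrite -val_eqE /= eqSS => /negbTE ->.
rewrite (twisted_d0 Uo Uy aH) => [|z Uz]; last first.
  by apply: (lev_big (polar_chart J_gcs Uz) (Wk z Uz)).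
rewrite lev_comp0 // big1 // => j _.
by rewrite eqSS ltn_eqF // (leq_trans (ltn_ord j)).
Qed.

Lemma bivector_in_bv (Q : 'M[C]_(m + m)) (B : 'M[C]_(m + m)) :
  bivector_in (im (1%:M - Q)) B -> bv_in Q B.
Proof.
move=> [Bs BQ]; split=> //; apply/row_matrixP => p; rewrite row_mul.
exact: BQ.
Qed.

Lemma form_section k sg : is_Usection J k sg -> exists W,
  [/\ forall z, U z -> sg i z = W z :> form,
      forall z, U z -> lev (P z) k (W z) & forall z, U z -> vdiff W z].
Proof.
move=> [[aS sS _] US]; exists (fun z => to_aform (sg i z)); split=> z Uz.
- by rewrite to_aformE //; exact: aS.
- have /(UspaceP _ _ (gcs_at_chart J_gcs Uz))[h hk ->] := US i z Uz.
  by rewrite avalK.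
- move=> s; apply: (eq_cdiff Uo Uz) (csmooth_cdiff (sS i s) Uz) => y Uy.
  by rewrite to_aformE //; exact: aS.
Qed.

End Components.

(** * The deformed structure *)

Section Deformation.
Variables (R : realType) (m : nat) (X : manifold R m).
Variables (H : Defs.field X (dform R m)) (J J' : Defs.field X 'M[R]_(m + m)).
Variables (eps epsstar : Defs.field X 'M[R[i]]_(m + m)).
Hypotheses (H_3form : closed_real_3form H) (J_gcs : is_gcs H J) (J'_gcs : is_gcs H J').
Hypotheses (epsP : beltrami J J' eps) (epsstarP : beltrami_star J J' epsstar).
Variables (k : nat) (sigma : Defs.field X (dform R m)).
Hypothesis sigma_U : is_Usection J k sigma.
Variable i : chart_index X.
Local Notation C := R[i].
Local Notation E := (gvec R m).
Local Notation V := (aform R m).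
Local Notation U := (chart_img i).
Local Notation P := (fun y => proj_gcs (J i y)).
Local Notation P' := (fun y => proj_gcs (J' i y)).
Local Notation B := (eps i).
Local Notation Bs := (epsstar i).
Local Notation form := (seq 'rV[C]_m -> C).
Implicit Types (y : 'rV[R]_m) (W : 'rV[R]_m -> V).

(* Without this, unification unfolds these operators down to matrix entries. *)
Local Opaque proj_gcs bv_mx bv_exp_alt bv_act_alt frame_ext twisted_d lev_comp cl num_op.

Let Uo : open U.
Proof. exact: open_chart. Qed.

Lemma eps_bv y : U y -> bv_in (P y) (B y).
Proof.
by move=> Uy; apply: bivector_in_bv; rewrite -Lstar_im; case: (proj2 epsP i y Uy).
Qed.

Lemma epsstar_bv y : U y -> bv_in (1%:M - P y) (Bs y).
Proof.
move=> Uy; apply: bivector_in_bv; have -> : 1%:M - (1%:M - P y) = P y.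
  by rewrite opprB addrC subrK.
by rewrite -Lplus_im; case: (proj2 epsstarP i y Uy).
Qed.

Lemma Lplus_shear y (a : E) : U y ->
  im (P' y) a <-> exists2 b, im (P y) b & b + b *m bv_mx (B y) = a.
Proof.
move=> Uy; have [_] := proj2 epsP i y Uy; rewrite eqEsubset => -[sub sup].
have LE (K : 'M[R]_(m + m)) (c : E) : Lplus K c <-> im (proj_gcs K) c by rewrite Lplus_im.
split=> [/LE/sub[b /LE bL <-]|[b /LE bL <-]]; first by exists b; rewrite // bv_mapE.
by apply/LE; apply: sup; exists b; rewrite // bv_mapE.
Qed.

Lemma Lstar_shear y (b : E) : U y -> im (1%:M - P y) b ->
  im (1%:M - P' y) (b *m (1%:M + bv_mx (Bs y))).
Proof.
move=> Uy; have [_] := proj2 epsstarP i y Uy; rewrite eqEsubset => -[_ sup].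
have LE (K : 'M[R]_(m + m)) (c : E) : Lstar K c <-> im (1%:M - proj_gcs K) c.
  by rewrite Lstar_im.
move=> /LE bL; apply/LE; apply: sup; exists b => //.
by rewrite bv_mapE mulmxDr mulmx1.
Qed.

Lemma Lstar_shrink y (b : E) : U y -> im (1%:M - P y) b ->
  im (1%:M - P y) (b *m (1%:M - bv_mx (Bs y) *m bv_mx (B y))).
Proof.
move=> Uy bQ; rewrite mulmxBr mulmx1 mulmxA /im /= mulmxBl.
by congr (_ - _); [exact: bQ|exact: (bv_mx_im _ (eps_bv Uy))].
Qed.

Lemma exp_lev0 y w : U y -> lev (P y) 0 w -> lev (P' y) 0 (bv_exp_alt (B y) w).
Proof.
move=> Uy [_ w1].
have [f _] := fil_exp 1 w (polar_chart J_gcs Uy) (eps_bv Uy) (fun a => Lplus_shear a Uy).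
by apply/lev0P; [exact: (polar_chart J'_gcs)|exact: (f w1)].
Qed.

Lemma mdiff_eps y : U y -> mdiff B y.
Proof. by move=> Uy p q; apply: csmooth_cdiff Uy; case: (proj1 epsP) => s _; exact: s. Qed.

Lemma mdiff_epsstar y : U y -> mdiff Bs y.
Proof.
by move=> Uy p q; apply: csmooth_cdiff Uy; case: (proj1 epsstarP) => s _; exact: s.
Qed.

(** Both conditions say that the component of level [k + 1] vanishes for
    [e^-eps d e^eps tau].  On the left this is the symbol of [d (E sigma)] for the
    deformed structure, transported by the exponential; on the right it is computed
    by [lev_comp_exp_inv]. *)
Lemma delbar_calE_iff y : U y ->
  (forall s, delbar H J' (calE J eps epsstar k sigma) i y s = 0) <->
  let tau := one_sub_eps_epsstar J eps epsstar k sigma in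
  (forall s, form_add (comm_del_eps H J eps tau) (delbar H J tau) i y s = 0).
Proof.
move=> Uy; have [S [sS Sk dS]] := form_section J_gcs i sigma_U.
have pP z : U z -> polar (P z) by exact: (polar_chart J_gcs).
have pP' z : U z -> polar (P' z) by exact: (polar_chart J'_gcs).
pose T z := frame_ext (P z) (1%:M - bv_mx (Bs z) *m bv_mx (B z)) idfun k (S z).
pose Et z := frame_ext (P z) (1%:M + bv_mx (Bs z)) (bv_exp_alt (B z)) k (S z).
have Tk z : U z -> lev (P z) k (T z).
  move=> Uz; apply: (frame_ext_lev (g := idfun) (pP z Uz) (pP z Uz) _ _ (Sk z Uz)).
  - by move=> a; exact: Lstar_shrink.
  - by [].
have Ek z : U z -> lev (P' z) k (Et z).
  move=> Uz; apply: (frame_ext_lev (pP z Uz) (pP' z Uz) _ _ (Sk z Uz)).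
  - by move=> a; exact: Lstar_shear.
  - by move=> h; exact: exp_lev0.
have dT z : U z -> vdiff T z.
  move=> Uz; apply: (@vdiff_frame_ext _ _ (fun z => P z)
    (fun z => 1%:M - bv_mx (Bs z) *m bv_mx (B z)) (fun=> idfun) _ _ _ _ _ _ (dS z Uz)).
  - exact: (mdiff_proj J_gcs).
  - apply: mdiffD; first exact: mdiff_cst.
    apply: mdiffN; apply: mdiffM; apply: mdiff_bv_mx; first exact: mdiff_epsstar.
    exact: mdiff_eps.
  - by [].
have dE z : U z -> vdiff Et z.
  move=> Uz; apply: (@vdiff_frame_ext _ _ (fun z => P z)
    (fun z => 1%:M + bv_mx (Bs z)) (fun z => bv_exp_alt (B z)) _ _ _ _ _ _ (dS z Uz)).
  - exact: (mdiff_proj J_gcs).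
  - by apply: mdiffD; [exact: mdiff_cst|apply: mdiff_bv_mx; exact: mdiff_epsstar].
  - by move=> W' dW'; apply: vdiff_bv_exp => //; exact: mdiff_eps.
have sT z : U z -> one_sub_eps_epsstar J eps epsstar k sigma i z = T z :> form.
  move=> Uz; rewrite /one_sub_eps_epsstar sS //.
  apply: (@spin_ext_frame _ _ _ _ _ _ idfun); last exact: Sk.
  - exact: (gcs_at_chart J_gcs).
  - by move=> a; rewrite !bv_mapE mulmxBr mulmx1 -mulmxA.
  - by [].
  - move=> b c; rewrite Lstar_im => bQ cQ.
    by apply: (im_isotropic (polarC (pP z Uz))); exact: Lstar_shrink.
have sE z : U z -> calE J eps epsstar k sigma i z = Et z :> form.
  move=> Uz; rewrite /calE sS //.
  apply: (@spin_ext_frame _ _ _ _ _ _ (bv_exp_alt (B z))); last exact: Sk.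
  - exact: (gcs_at_chart J_gcs).
  - by move=> a; rewrite bv_mapE mulmxDr mulmx1.
  - by move=> h; apply/funext => s; exact: bv_exp_altE.
  - move=> b c; rewrite Lstar_im => bQ cQ.
    by apply: (im_isotropic (polarC (pP' z Uz))); exact: Lstar_shear.
set tau := one_sub_eps_epsstar J eps epsstar k sigma; cbv zeta.
have [aH _] := H_alternating H_3form Uy.
pose D W := twisted_d (H i y) W y.
(* e^eps T = T + W2 + W3, and E sigma = e^eps T + W4 with W4 of lower order. *)
pose W2 z := bv_act_alt (B z) (T z).
pose W3 z := bv_exp_alt (B z) (T z) - T z - W2 z.
pose W4 z := Et z - bv_exp_alt (B z) (T z).
have W2k z : U z -> lev (P z) k.+2 (W2 z).
  by move=> Uz; apply: lev_bv; [exact: pP|exact: eps_bv|exact: Tk].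
have dW2 z : U z -> vdiff W2 z.
  by move=> Uz; apply: vdiff_bv_act; [exact: mdiff_eps|exact: dT].
have dexp z : U z -> vdiff (fun z => bv_exp_alt (B z) (T z)) z.
  by move=> Uz; apply: vdiff_bv_exp; [exact: mdiff_eps|exact: dT].
have vdiffN W z : vdiff W z -> vdiff (fun z => - W z) z.
  move=> dW; have -> : (fun z => - W z) = (fun z => -1 *: W z).
    by apply/funext => x; rewrite scaleN1r.
  by apply: vdiffZ => //; exact: cdiff_cst.
have dW3 z : U z -> vdiff W3 z.
  move=> Uz; apply: vdiffD; last by apply: vdiffN; exact: dW2.
  by apply: vdiffD; [exact: dexp|apply: vdiffN; exact: dT].
have dW4 z : U z -> vdiff W4 z.
  by move=> Uz; apply: vdiffD; [exact: dE|apply: vdiffN; exact: dexp].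
have W4k z : U z -> fil (im (P' z)) k (W4 z).
  move=> Uz.
  have [h hk EE] := frame_ext_exp (pP z Uz) (eps_bv Uz) (epsstar_bv Uz) (Sk z Uz).
  rewrite /W4 /Et EE linearD /= addrC addKr.
  exact/(fil_exp k h (pP z Uz) (eps_bv Uz) (fun a => Lplus_shear a Uz)).
have cofil_D k' W : (forall z, U z -> vdiff W z) ->
    (forall z, U z -> cofil (P z) k' (W z)) ->
    cofil (P y) k'.-1 (D W).
  by move=> dW Wk; apply: (cofil_d H_3form J_gcs).
have [|||||u uE ucomp] := @lev_comp_exp_inv _ _ (P y) (B y) k (D T) (D W2) (D W3).
- exact: pP.
- exact: eps_bv.
- by apply: cofil_D => // z Uz; apply: lev_cofil; [exact: pP|exact: Tk].
- by apply: (cofil_D k.+2) => // z Uz; apply: lev_cofil; [exact: pP|exact: W2k].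
- apply: (cofil_D k.+4) => // z Uz; apply: cofil_exp2; [exact: pP|exact: eps_bv|].
  by apply: lev_cofil; [exact: pP|exact: Tk].
have uE' : bv_exp_alt (B y) u = D (fun z => bv_exp_alt (B z) (T z)).
  have dTW : vdiff (fun z => T z + W2 z) y by apply: vdiffD; [exact: dT|exact: dW2].
  have e1 : D T + D W2 = D (fun z => T z + W2 z).
    by apply/esym; exact: (twisted_dD aH (dT y Uy) (dW2 y Uy)).
  have e2 : D (fun z => T z + W2 z) + D W3 = D (fun z => T z + W2 z + W3 z).
    by apply/esym; exact: (twisted_dD aH dTW (dW3 y Uy)).
  rewrite uE e1 e2; apply: (eq_twisted_d _ Uo Uy) => z Uz.
  have gen (p q r : V) : p + q + (r - p - q) = r.
    by rewrite -[r - p - q]addrA -opprD [LHS]addrC subrK.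
  by rewrite gen.
have DE : D Et = bv_exp_alt (B y) u + D W4.
  have e1 : D (fun z => bv_exp_alt (B z) (T z)) + D W4 =
      D (fun z => bv_exp_alt (B z) (T z) + W4 z).
    by apply/esym; exact: (twisted_dD aH (dexp y Uy) (dW4 y Uy)).
  rewrite uE' e1; apply: (eq_twisted_d _ Uo Uy) => z Uz.
  by rewrite /W4 addrC subrK.
have LL := fun a => @Lplus_shear y a Uy.
have fexp l w := fil_exp l w (pP y Uy) (eps_bv Uy) LL.
have DW4 : fil (im (P' y)) k.+1 (D W4).
  exact: (fil_d_im H_3form J'_gcs dW4 W4k Uy).
have DEk : fil (im (P' y)) k.+2 (D Et).
  exact: (fil_d_im H_3form J'_gcs dE (fun z Uz => proj2 (Ek z Uz)) Uy).
have uDE : bv_exp_alt (B y) u = D Et - D W4 by rewrite DE addrK.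
have uk : fil (im (P y)) k.+2 u.
  by apply: (proj2 (fexp k.+2 u)); rewrite uDE; exact: (filB DEk (filS DW4)).
have topE := fil_compP (pP' y Uy) DEk.
have topu := fil_compP (pP y Uy) uk.
(* The symbols of D Et and of u vanish together, because the exponential matches
   the two filtrations. *)
have key : lev_comp (P' y) (D Et) k.+1 = 0 <-> lev_comp (P y) u k.+1 = 0.
  split=> [/(proj1 topE) h|/(proj1 topu)/(proj1 (fexp k.+1 u)) h].
    by apply: (proj2 topu); apply: (proj2 (fexp k.+1 u)); rewrite uDE; exact: (filB h DW4).
  by apply: (proj2 topE); rewrite DE; exact: (filD h DW4).
have lhs : delbar H J' (calE J eps epsstar k sigma) i y =
    lev_comp (P' y) (D Et) k.+1 :> form by exact: (delbar_section H_3form J'_gcs).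
have rhs : form_add (comm_del_eps H J eps tau) (delbar H J tau) i y =
    lev_comp (P y) u k.+1 :> form.
  apply/funext => s; rewrite /form_add /comm_del_eps.
  rewrite (delbar_section H_3form J_gcs Uy sT Tk dT).
  have sW2 z : U z -> bv_act eps tau i z = W2 z :> form.
    by move=> Uz; apply/funext => x; rewrite /bv_act /tau sT // bv_act_altE.
  rewrite (del_section H_3form J_gcs Uy sW2 W2k dW2).
  rewrite /bv_act (del_section H_3form J_gcs Uy sT Tk dT) bv_act_altE.
  have uE2 : lev_comp (P y) u k.+1 = lev_comp (P y) (D W2) k.+1
      - bv_act_alt (B y) (if k is k'.+1 then lev_comp (P y) (D T) k' else 0)
      + lev_comp (P y) (D T) k.+1.
    rewrite ucomp (lev_compD _ _ _ (pP y Uy)) addrC addrA addrAC; congr (_ + _).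
    rewrite addrC; congr (_ - _).
    case: (k) => [|k']; last exact: (lev_comp_bv k' (D T) (pP y Uy) (eps_bv Uy)).
    rewrite linear0; apply: (@cofil_comp0 _ _ (P y) 2 _ 1) => //; first exact: pP.
    by apply: (cofil_bv (pP y Uy) (eps_bv Uy)); apply: cofil0; exact: pP.
  have evB (w h : V) t : (w - h) t = w t - h t by exact: avalB.
  have evD (w h : V) t : (w + h) t = w t + h t by exact: avalD.
  by rewrite uE2 evD evB.
split=> h s.
  by rewrite rhs (proj1 key) //; apply/aformP => t; rewrite -lhs h.
by rewrite lhs (proj2 key) //; apply/aformP => t; rewrite -rhs h.
Qed.

End Deformation.

Theorem theorem1p1 (R : realType) (n : nat) (X : manifold R (2 * n)%N)
    (X_compact : compact [set: X])
    (H : field X (dform R (2 * n)%N)) (H_3form : closed_real_3form H)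
    (J G : field X 'M[R]_(2 * n + 2 * n))
    (J_gcs : is_gcs H J) (G_metric : is_gen_metric J G)
    (Delta : set R[i]) (Jt : R[i] -> field X 'M[R]_(2 * n + 2 * n))
    (Jt_family : gcs_family H J Delta Jt)
    (t : R[i]) (t_Delta : Delta t)
    (eps epsstar : field X 'M[R[i]]_(2 * n + 2 * n))
    (eps_beltrami : beltrami J (Jt t) eps)
    (epsstar_dual : beltrami_star J (Jt t) epsstar)
    (eps_norm : (Linf_norm J G eps < 1)%E)
    (k : nat) (k_le : (k <= 2 * n)%N)
    (sigma : field X (dform R (2 * n)%N)) (sigma_U : is_Usection J k sigma) :
  form_eq0 (delbar H (Jt t) (calE J eps epsstar k sigma)) <->
  (let tau := one_sub_eps_epsstar J eps epsstar k sigma in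
   form_eq0 (form_add (comm_del_eps H J eps tau) (delbar H J tau))).
Proof.
have [_ Jt_gcs _ _] := Jt_family; have J'_gcs := Jt_gcs t t_Delta.
have main i y (Uy : chart_img i y) :=
  delbar_calE_iff H_3form J_gcs J'_gcs eps_beltrami epsstar_dual sigma_U Uy.
split=> h; first by move=> tau i y Uy; exact: (proj1 (main i y Uy) (h i y Uy)).
by move=> i y Uy; exact: (proj2 (main i y Uy) (h i y Uy)).
Qed.
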